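(* Let $A$ be a commutative unital $C^*$-algebra and let $\mathcal{M}$ be the class of $C^*$ embeddings, i.e. injective (equivalently, isometric) unital $*$-homomorphisms, in the category under consideration. (a) $A$ is $\aleph_0$-generated with respect to $\mathcal{M}$ in the category $\mathcal{C}^*_{c,1}$ of unital commutative $C^*$-algebras if and only if $A$ is finite-dimensional. (b) $A$ is $\aleph_0$-generated with respect to $\mathcal{M}$ in the category $\mathcal{C}^*_1$ of unital $C^*$-algebras if and only if $A$ has dimension $\le 1$.
   Context: $\mathcal{C}^*_1$ (resp. $\mathcal{C}^*_{c,1}$) is the category of unital (resp. unital commutative) complex $C^*$-algebras with unital $*$-homomorphisms; the zero algebra is allowed. Given a class $\mathcal{M}$ of monomorphisms in a cocomplete category $\mathcal{C}$, an object $c$ is $\aleph_0$-generated with respect to $\mathcal{M}$ if $\mathrm{hom}_{\mathcal{C}}(c,-):\mathcal{C}\to\mathrm{Set}$ preserves directed colimits of morphisms from $\mathcal{M}$, i.e. colimits of functors from (nonempty) directed posets all of whose connecting morphisms belong to $\mathcal{M}$. *)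

(* Defs.v *)
From HB Require Import structures.
From mathcomp Require Import all_boot all_order all_algebra.
From mathcomp Require Import complex.
From mathcomp Require Import all_classical reals topology normedtype.

Set Implicit Arguments.
Unset Strict Implicit.
Unset Printing Implicit Defensive.

Import Order.TTheory GRing.Theory Num.Theory.
Import numFieldNormedType.Exports.

Local Open Scope ring_scope.

#[local] Obligation Tactic := idtac.

Record category : Type := Category {
  ob :> Type;
  hom : ob -> ob -> Type;
  idm : forall a, hom a a;
  comp : forall a b c, hom b c -> hom a b -> hom a c;
  comp1m : forall a b (f : hom a b), comp (idm b) f = f;
  compm1 : forall a b (f : hom a b), comp f (idm a) = f;
  compmA : forall a b c d (h : hom c d) (g : hom b c) (f : hom a b),
    comp h (comp g f) = comp (comp h g) f
}.
Arguments hom {_} _ _.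
Arguments idm {_} _.
Arguments comp {_ _ _ _} _ _.

Record functor (C D : category) : Type := Functor {
  fob :> C -> D;
  fmap : forall a b : C, hom a b -> hom (fob a) (fob b);
  fmap1 : forall a : C, fmap (idm a) = idm (fob a);
  fmapM : forall (a b c : C) (g : hom b c) (f : hom a b),
    fmap (comp g f) = comp (fmap g) (fmap f)
}.
Arguments fmap {C D} _ {a b} _.

Program Definition functor_comp (C D E : category) (G : functor D E)
    (F : functor C D) : functor C E :=
  {| fob := fun a => G (F a);
     fmap := fun a b f => fmap G (fmap F f) |}.
Next Obligation. by move=> *; rewrite /= !fmap1. Qed.
Next Obligation. by move=> *; rewrite /= !fmapM. Qed.

Record cocone (J C : category) (F : functor J C) : Type := Cocone {
  apex : C;
  leg : forall j : J, hom (F j) apex;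
  legP : forall (i j : J) (f : hom i j), comp (leg j) (fmap F f) = leg i
}.
Arguments apex {J C F} _.
Arguments leg {J C F} _ _.

Definition is_colimit (J C : category) (F : functor J C) (K : cocone F) : Prop :=
  forall L : cocone F,
    exists! u : hom (apex K) (apex L), forall j : J, comp u (leg K j) = leg L j.

Program Definition map_cocone (J C D : category) (G : functor C D)
    (F : functor J C) (K : cocone F) : cocone (functor_comp G F) :=
  {| apex := G (apex K);
     leg := fun j => fmap G (leg K j) |}.
Next Obligation. by move=> *; rewrite /= -fmapM legP. Qed.

Definition preserves_colimits_of (J C D : category) (G : functor C D)
    (F : functor J C) : Prop :=
  forall K : cocone F, is_colimit K -> is_colimit (map_cocone G K).

(* Plays the role of Set. *)
Definition type_cat : category :=
  {| ob := Type;
     hom := fun X Y => X -> Y;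
     idm := fun X x => x;
     comp := fun X Y Z g f x => g (f x);
     comp1m := fun X Y f => erefl;
     compm1 := fun X Y f => erefl;
     compmA := fun X Y Z T h g f => erefl |}.

Program Definition hom_functor (C : category) (c : C) : functor C type_cat :=
  {| fob := fun a => hom c a;
     fmap := fun a b f g => comp f g |}.
Next Obligation. by move=> *; apply/funext => g /=; rewrite comp1m. Qed.
Next Obligation. by move=> *; apply/funext => g' /=; rewrite compmA. Qed.

Program Definition full_subcat (C : category) (P : C -> Prop) : category :=
  {| ob := {a : C | P a};
     hom := fun a b => hom (sval a) (sval b);
     idm := fun a => idm (sval a);
     comp := fun a b c g f => comp g f |}.
Next Obligation. by move=> *; exact: comp1m. Qed.
Next Obligation. by move=> *; exact: compm1. Qed.
Next Obligation. by move=> *; exact: compmA. Qed.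

Program Definition poset_cat (d : Order.disp_t) (I : porderType d) : category :=
  {| ob := I;
     hom := fun i j : I => (i <= j)%O;
     idm := fun i => lexx i;
     comp := fun i j k jk ij => le_trans ij jk |}.
Next Obligation. by move=> *; exact: bool_irrelevance. Qed.
Next Obligation. by move=> *; exact: bool_irrelevance. Qed.
Next Obligation. by move=> *; exact: bool_irrelevance. Qed.

Definition directed (d : Order.disp_t) (I : porderType d) : Prop :=
  inhabited I /\ forall i j : I, exists k : I, (i <= k)%O /\ (j <= k)%O.

Definition morphism_class (C : category) := forall a b : C, hom a b -> Prop.

Definition aleph0_generated (C : category) (M : morphism_class C) (c : C) : Prop :=
  forall (d : Order.disp_t) (I : porderType d) (F : functor (poset_cat I) C),
    directed I ->
    (forall (i j : poset_cat I) (ij : hom i j), M _ _ (fmap F ij)) ->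
    preserves_colimits_of (hom_functor c) F.

(* The multiplication is a field of the mixin, rather than coming from a
   MathComp ring structure: [algType] excludes the zero algebra, and Hierarchy
   Builder rejects a join of [pzRingType] with a normed module, because
   [numDomainType] already inherits from both.  As usual in MathComp-Analysis,
   norms take their (real nonnegative) values in the field of scalars. *)
HB.mixin Record isCStarAlgebra (C : numClosedFieldType) A
    of CompleteNormedModule C A := {
  cmul : A -> A -> A;
  cone : A;
  star : A -> A;
  cmulA : associative cmul;
  cmul1x : left_id cone cmul;
  cmulx1 : right_id cone cmul;
  cmulDl : left_distributive cmul +%R;
  cmulDr : right_distributive cmul +%R;
  cscalerAl : forall (k : C) (x y : A), k *: cmul x y = cmul (k *: x) y;
  cscalerAr : forall (k : C) (x y : A), k *: cmul x y = cmul x (k *: y);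
  cnormM : forall x y : A, `|cmul x y| <= `|x| * `|y|;
  starK : involutive star;
  starD : {morph star : x y / x + y};
  starZ : forall (k : C) (x : A), star (k *: x) = k^* *: star x;
  starM : forall x y : A, star (cmul x y) = cmul (star y) (star x);
  cstar_identity : forall x : A, `|cmul (star x) x| = `|x| ^+ 2
}.

#[short(type="cstarAlgType")]
HB.structure Definition CStarAlgebra (C : numClosedFieldType) :=
  {A of CompleteNormedModule C A & isCStarAlgebra C A}.

Record star_hom (C : numClosedFieldType) (A B : cstarAlgType C) : Type := StarHom {
  star_hom_fun :> A -> B;
  star_homD : forall x y, star_hom_fun (x + y) = star_hom_fun x + star_hom_fun y;
  star_homZ : forall (k : C) x, star_hom_fun (k *: x) = k *: star_hom_fun x;
  star_hom1 : star_hom_fun cone = cone;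
  star_homM : forall x y,
    star_hom_fun (cmul x y) = cmul (star_hom_fun x) (star_hom_fun y);
  star_hom_star : forall x, star_hom_fun (star x) = star (star_hom_fun x)
}.

Lemma star_hom_ext (C : numClosedFieldType) (A B : cstarAlgType C)
  (f g : star_hom A B) : f =1 g -> f = g.
Proof.
case: f g => [f fD fZ f1 fM fS] [g gD gZ g1 gM gS] /= /funext fg.
by case: g / fg gD gZ g1 gM gS => *; congr StarHom; exact: Prop_irrelevance.
Qed.

Program Definition star_hom_id (C : numClosedFieldType) (A : cstarAlgType C) :
  star_hom A A := {| star_hom_fun := id |}.
Solve All Obligations with by [].

Program Definition star_hom_comp (C : numClosedFieldType)
    (A B D : cstarAlgType C) (g : star_hom B D) (f : star_hom A B) :
  star_hom A D := {| star_hom_fun := g \o f |}.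
Next Obligation. by move=> *; rewrite /= !star_homD. Qed.
Next Obligation. by move=> *; rewrite /= !star_homZ. Qed.
Next Obligation. by move=> *; rewrite /= !star_hom1. Qed.
Next Obligation. by move=> *; rewrite /= !star_homM. Qed.
Next Obligation. by move=> *; rewrite /= !star_hom_star. Qed.

Program Definition cstar_cat (C : numClosedFieldType) : category :=
  {| ob := cstarAlgType C;
     hom := @star_hom C;
     idm := @star_hom_id C;
     comp := @star_hom_comp C |}.
Next Obligation. by move=> *; exact: star_hom_ext. Qed.
Next Obligation. by move=> *; exact: star_hom_ext. Qed.
Next Obligation. by move=> *; exact: star_hom_ext. Qed.

Definition cstar_commutative (C : numClosedFieldType) (A : cstarAlgType C) : Prop :=
  commutative (@cmul C A).

Definition com_cstar_cat (C : numClosedFieldType) : category :=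
  @full_subcat (cstar_cat C) (@cstar_commutative C).

Definition cstar_embedding (C : numClosedFieldType) : morphism_class (cstar_cat C) :=
  fun (A B : cstarAlgType C) (f : star_hom A B) => injective f.

Definition com_cstar_embedding (C : numClosedFieldType) :
  morphism_class (com_cstar_cat C) :=
  fun A B f => @cstar_embedding C (sval A) (sval B) f.

Definition has_dim (K : fieldType) (V : lmodType K) (n : nat) : Prop :=
  inhabited (Vector.axiom n V).

Definition finite_dimensional (K : fieldType) (V : lmodType K) : Prop :=
  exists n, has_dim V n.

Definition dim_le (K : fieldType) (V : lmodType K) (m : nat) : Prop :=
  exists2 n, (n <= m)%N & has_dim V n.

(* Main.v *)
Require Import Defs.
From HB Require Import structures.
From mathcomp Require Import all_boot all_order all_algebra.
From mathcomp Require Import complex.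
From mathcomp Require Import all_classical reals topology normedtype.
From mathcomp Require Import ring lra.

Set Implicit Arguments.
Unset Strict Implicit.
Unset Printing Implicit Defensive.

Import Order.TTheory GRing.Theory Num.Theory.
Import numFieldNormedType.Exports.
Import Defs.

Local Open Scope ring_scope.
Local Open Scope complex_scope.

(** A continuous unital *-homomorphism out of a dense subalgebra extends, so a
    directed family of C*-subalgebras of [B] with union dense in [K] has [K] as
    colimit; this needs that *-homomorphisms are contractive: if [norm h < 1] is
    self-adjoint, then [1 - h^2 = k^2] with [k] in the commutant of [h], and
    [f h + i f k] is unitary.

    (a) If [A] is finitely generated in this sense, embed it by its characters
    into [l^oo(S)], which is the directed colimit of its subalgebras of functions
    constant on the blocks of a finite partition; [A] must land in one of these.
    Conversely, a finite-dimensional [A] is spanned by orthogonal projections, and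
    a projection of the colimit lifts to a finite stage: lift it approximately by
    density, correct it by Newton's iteration, and use that two commuting
    projections at distance less than 1 are equal.  Injectivity of the legs on
    projections is checked in the algebra of bounded families modulo those with
    limsup norm 0, where a nonzero projection keeps norm 1.

    (b) If [A] has two characters [s <> s'], then [x |-> s(x) q_n + s'(x) (1 - q_n)],
    for projections [q_n] converging in [M_2] without being eventually constant,
    lands in the closure of the eventually constant sequences of matrices but at no
    finite stage.

    Characters are obtained without spectral theory: a maximal preordering of the
    self-adjoint part (Zorn) is total, and [a |-> sup {r | a - r >= 0}] is then a
    character. *)

(** * Real-valued norms and completeness *)

Section ComplexModulus.
Context {R : realType}.
Implicit Types (k : R[i]) (r : R).

(** A colimit is known only through its universal property, so neither the density of its legs nor a
    lower bound on their norms can be read off. Both come from comparing it with a concrete cocone,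
    along maps that are contractive because they are *-homomorphisms.

    Every algebra that occurs (closed subalgebras, products, reduced products, the complex numbers,
    matrices) is an instance of one construction, the Hausdorff quotient of the domain of a complete
    C*-seminorm, so the C*-axioms are verified once.

    The two categories differ because projections are rigid in a commutative algebra but move
    continuously in [M_2]: an algebra spanned by two orthogonal projections is generated in the
    first category and not in the second.

    The zero algebra is a genuine case. It has no characters, so the product over its characters is
    empty, and it maps only to zero algebras, so in (b) a vanishing colimit must be shown to have a
    vanishing stage. *)

Definition cmod k : R := complex.Re `|k|.

Lemma cmodE k : `|k| = (cmod k)%:C.
Proof. by rewrite /cmod RRe_real ?normr_real. Qed.

Lemma cmod_ge0 k : 0 <= cmod k.
Proof. by rewrite -ler0c -cmodE. Qed.

Lemma cmodM k l : cmod (k * l) = cmod k * cmod l.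
Proof. by apply: complexI; rewrite rmorphM /= -!cmodE normrM. Qed.

Lemma cmodD k l : cmod (k + l) <= cmod k + cmod l.
Proof. by rewrite -lecR rmorphD /= -!cmodE ler_normD. Qed.

Lemma cmodR r : cmod r%:C = `|r|.
Proof. by rewrite /cmod normc_def /= expr0n addr0 sqrtr_sqr. Qed.

Lemma cmodN k : cmod (- k) = cmod k.
Proof. by rewrite /cmod normrN. Qed.

Lemma cmod0 : cmod 0 = 0.
Proof. by rewrite /cmod normr0. Qed.

Lemma cmod1 : cmod 1 = 1.
Proof. by rewrite /cmod normr1. Qed.

Lemma cmod_eq0 k : cmod k = 0 -> k = 0.
Proof. by move=> k0; apply/eqP; rewrite -normr_eq0 cmodE k0. Qed.

Lemma cmodJ k : cmod k^*%R = cmod k.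
Proof. by rewrite /cmod norm_conjC. Qed.

Lemma conjcE k : k^*%R = conjc k.
Proof.
have [->|k0] := eqVneq k 0; first by rewrite !rmorph0.
by apply: (mulfI k0); rewrite -normCK sqr_normc.
Qed.

Lemma cmod_sq k : (cmod k ^+ 2)%:C = k^*%R * k.
Proof. by rewrite rmorphXn /= -cmodE normCK mulrC. Qed.

Lemma cmod2E k : cmod k ^+ 2 = complex.Re k ^+ 2 + complex.Im k ^+ 2.
Proof.
by rewrite /cmod normc_def /= sqr_sqrtr // addr_ge0 // sqr_ge0.
Qed.

Lemma Re_le_cmod k : `|complex.Re k| <= cmod k.
Proof. by rewrite -lecR -cmodE normc_ge_Re. Qed.

Lemma Im_le_cmod k : `|complex.Im k| <= cmod k.
Proof.
rewrite -(ler_sqr (normr_ge0 _) (cmod_ge0 _)) cmod2E real_normK ?num_real //.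
by rewrite lerDr sqr_ge0.
Qed.

End ComplexModulus.

Section Norm.
Context {R : realType}.

(** Norms live in [R[i]], whose order is only partial; [nr] moves them to [R], where comparisons are
    total and [lra] and [nra] apply. *)
Definition nr (A : normedModType R[i]) (x : A) : R := complex.Re `|x|.
Arguments nr {A}.

Section NormedModule.
Context {A : normedModType R[i]}.
Implicit Types x y : A.

Lemma nrE x : `|x| = (nr x)%:C.
Proof. by rewrite /nr RRe_real ?normr_real. Qed.

Lemma nr_ge0 x : 0 <= nr x.
Proof. by rewrite -ler0c -nrE. Qed.

Lemma nrD x y : nr (x + y) <= nr x + nr y.
Proof. by rewrite -lecR rmorphD /= -!nrE ler_normD. Qed.

Lemma nrZ k x : nr (k *: x) = cmod k * nr x.
Proof. by apply: complexI; rewrite rmorphM /= -!nrE -cmodE normrZ. Qed.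

Lemma nr0 : nr (0 : A) = 0. Proof. by rewrite /nr normr0. Qed.

Lemma nrN x : nr (- x) = nr x. Proof. by rewrite /nr normrN. Qed.

Lemma nrB x y : nr (x - y) <= nr x + nr y.
Proof. by rewrite -(nrN y) nrD. Qed.

Lemma nrC x y : nr (x - y) = nr (y - x).
Proof. by rewrite -nrN opprB. Qed.

Lemma nr_tri z x y : nr (x - y) <= nr (x - z) + nr (z - y).
Proof. by rewrite -[x - y](subrKA z) nrD. Qed.

Lemma nr_eq0 x : nr x = 0 -> x = 0.
Proof. by move=> x0; apply/eqP; rewrite -normr_eq0 nrE x0. Qed.

Lemma nr_le0 x : (forall e, 0 < e -> nr x <= e) -> x = 0.
Proof.
move=> xe; apply: nr_eq0; apply/le_anti; rewrite nr_ge0 andbT.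
by apply/ler_addgt0Pr => e e0; rewrite add0r xe.
Qed.

End NormedModule.

Definition seq_cvg (A : normedModType R[i]) (u : nat -> A) (l : A) : Prop :=
  forall e : R, 0 < e -> exists N, forall n, (N <= n)%N -> nr (u n - l) <= e.

Lemma expr_small (r : R) (c : R) : 0 <= r -> r < 1 -> 0 < c ->
  exists N, forall n, (N <= n)%N -> r ^+ n <= c.
Proof.
move=> r0 r1 c0; have [->|rn0] := eqVneq r 0.
  by exists 1 => -[|n] // _; rewrite expr0n /= ltW.
have rp : 0 < r by rewrite lt_def rn0.
have s0 : 0 < r^-1 - 1 by rewrite subr_gt0 invf_gt1.
have [N hN] : exists N : nat, c^-1 / (r^-1 - 1) <= N%:R.
  exists (Num.bound (c^-1 / (r^-1 - 1))); apply: ltW.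
  by rewrite archi_boundP // divr_ge0 ?invr_ge0 ?ltW.
exists N => n Nn.
(* Bernoulli's inequality for [r^-1 = 1 + (r^-1 - 1)]. *)
have bern m : 1 + m%:R * (r^-1 - 1) <= r^-1 ^+ m.
  elim: m => [|m IH]; first by rewrite mul0r addr0 expr0.
  rewrite exprS -natr1; move: IH s0; set t := r^-1; set p := t ^+ m => IH s0.
  have m0 : 0 <= m%:R :> R by rewrite ler0n.
  have t1 : 1 <= t by rewrite -subr_ge0 ltW.
  apply: le_trans (ler_wpM2l (le_trans ler01 t1) IH).
  have : 0 <= m%:R * (t - 1) ^+ 2 by rewrite mulr_ge0 ?sqr_ge0.
  by move=> H; rewrite -subr_ge0; move: H; congr (0 <= _); ring.
have : c^-1 <= r^-1 ^+ n.
  apply: le_trans (bern n); rewrite (le_trans (y := n%:R * (r^-1 - 1))) ?lerDr //.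
  by rewrite -ler_pdivrMr // (le_trans hN) // ler_nat.
by rewrite exprVn lef_pV2 // posrE exprn_gt0.
Qed.

Lemma geometric_dist (A : normedModType R[i]) (u : nat -> A) (c r : R) :
    0 <= r -> r < 1 -> (forall n, nr (u n.+1 - u n) <= c * r ^+ n) ->
  forall m n, (m <= n)%N -> nr (u n - u m) <= c / (1 - r) * r ^+ m.
Proof.
move=> r0 r1 hu m n mn.
have r1' : 0 < 1 - r by rewrite subr_gt0.
have c0 : 0 <= c by have := hu 0%N; rewrite mulr1; apply: le_trans (nr_ge0 _).
(* Subtracting [r ^+ n] makes the bound telescope, so that the induction on [n] closes. *)
have H : nr (u n - u m) <= c / (1 - r) * (r ^+ m - r ^+ n).
  elim: n mn => [|n IH].
    by rewrite leqn0 => /eqP ->; rewrite !subrr nr0 mulr0.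
  rewrite leq_eqVlt => /predU1P[->|mn]; first by rewrite !subrr nr0 mulr0.
  apply: le_trans (nr_tri (u n) _ _) _.
  apply: le_trans (lerD (hu n) (IH mn)) _.
  by rewrite exprS le_eqVlt; apply/orP; left; apply/eqP; field; rewrite lt0r_neq0.
apply: le_trans H _; apply: ler_wpM2l; first by rewrite divr_ge0 // ltW.
by rewrite lerBlDr lerDl exprn_ge0.
Qed.

Lemma nr_lt (A : normedModType R[i]) (x : A) (e : R) : `|x| < e%:C -> nr x <= e.
Proof. by rewrite nrE ltcR => /ltW. Qed.

Lemma cauchy_seq_cvg (A : completeNormedModType R[i]) (u : nat -> A) :
    (forall e : R, 0 < e -> exists N, forall m n, (N <= m)%N -> (N <= n)%N ->
       nr (u m - u n) <= e) ->
  exists l, seq_cvg u l.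
Proof.
move=> uC.
have : cauchy (u @ \oo)%classic.
  apply/cauchyP => e e0.
  have eR : e = (complex.Re e)%:C by rewrite RRe_real // gtr0_real.
  have r0 : 0 < complex.Re e by rewrite -ltcR -eR.
  have [N hN] := uC (complex.Re e / 2) ltac:(by rewrite divr_gt0).
  exists (u N); exists N => // n /= Nn.
  rewrite -ball_normE /ball_ /= nrE eR ltcR.
  by apply: le_lt_trans (hN N n (leqnn _) Nn) _; rewrite gtr_pMr // invf_lt1 // ltr1n.
move/cauchy_cvg => /cvg_ex [l ul]; exists l => e e0.
move/cvgrPdist_lt : ul => /(_ e%:C); rewrite ltcR => /(_ e0) [N _ hN].
by exists N => n Nn; rewrite nrC nr_lt // hN.
Qed.

Lemma geometric_cvg (A : completeNormedModType R[i]) (u : nat -> A) (c r : R) :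
    0 <= r -> r < 1 -> (forall n, nr (u n.+1 - u n) <= c * r ^+ n) ->
  exists2 l, seq_cvg u l & nr (l - u 0%N) <= c / (1 - r).
Proof.
move=> r0 r1 hu.
have c0 : 0 <= c by have := hu 0%N; rewrite mulr1; apply: le_trans (nr_ge0 _).
have r1' : 0 < 1 - r by rewrite subr_gt0.
have gd := geometric_dist r0 r1 hu.
have K0 : 0 <= c / (1 - r) by rewrite divr_ge0 // ltW.
have K1 : 0 < c / (1 - r) + 1 by rewrite ltr_wpDl.
have [l ul] : exists l, seq_cvg u l.
  apply: cauchy_seq_cvg => e e0.
  have [N hN] := expr_small r0 r1 (divr_gt0 e0 K1).
  have main m n : (N <= m)%N -> (m <= n)%N -> nr (u n - u m) <= e.
    move=> Nm mn; apply: le_trans (gd _ _ mn) _.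
    apply: le_trans (ler_wpM2l K0 (hN _ Nm)) _.
    rewrite mulrCA; apply: ler_piMr; first exact: ltW.
    by rewrite ler_pdivrMr // mul1r lerDl.
  exists N => m n Nm Nn; have [mn|/ltnW nm] := leqP m n; last exact: main.
  by rewrite nrC; exact: main.
exists l => //; apply/ler_addgt0Pr => e e0.
have [N hN] := ul e e0.
apply: le_trans (nr_tri (u N) _ _) _; rewrite addrC; apply: lerD.
  by apply: le_trans (gd _ _ (leq0n N)) _; rewrite expr0 mulr1.
by rewrite nrC hN.
Qed.

End Norm.
Arguments nr {R A}.

(** * Hausdorff quotients of seminormed *-algebras *)

Record staralg (R : realType) := StarAlg {
  sacar :> lmodType R[i];
  samul : sacar -> sacar -> sacar;
  saone : sacar;
  sastar : sacar -> sacar;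
  samulA : associative samul;
  samul1x : left_id saone samul;
  samulx1 : right_id saone samul;
  samulDl : left_distributive samul +%R;
  samulDr : right_distributive samul +%R;
  sascalerAl : forall (k : R[i]) x y, k *: samul x y = samul (k *: x) y;
  sascalerAr : forall (k : R[i]) x y, k *: samul x y = samul x (k *: y);
  sastarK : involutive sastar;
  sastarD : {morph sastar : x y / x + y};
  sastarZ : forall (k : R[i]) x, sastar (k *: x) = k^*%R *: sastar x;
  sastarM : forall x y, sastar (samul x y) = samul (sastar y) (sastar x)
}.

(** The domain is part of the data: a closed subset in the case of a subalgebra, the bounded
    families in the case of a product. Completeness is asked only of sequences with increments at
    most [2^-n]; the passage to Cauchy filters is made once, on the quotient. *)
Record cseminorm (R : realType) (T : staralg R) := CSeminorm {
  cdom : T -> Prop;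
  csn : T -> R;
  cdomD : forall x y, cdom x -> cdom y -> cdom (x + y);
  cdomZ : forall (k : R[i]) x, cdom x -> cdom (k *: x);
  cdom1 : cdom (saone T);
  cdomM : forall x y, cdom x -> cdom y -> cdom (samul x y);
  cdomS : forall x, cdom x -> cdom (sastar x);
  csnD : forall x y, cdom x -> cdom y -> csn (x + y) <= csn x + csn y;
  csnZ : forall (k : R[i]) x, cdom x -> csn (k *: x) = cmod k * csn x;
  csnM : forall x y, cdom x -> cdom y -> csn (samul x y) <= csn x * csn y;
  csnS : forall x, cdom x -> csn (samul (sastar x) x) = csn x ^+ 2;
  csn_complete : forall u : nat -> T, (forall n, cdom (u n)) ->
    (forall n, csn (u n.+1 - u n) <= 2^-1 ^+ n) ->
    exists2 l, cdom l & forall e : R, 0 < e -> exists N, forall n, (N <= n)%N ->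
      csn (u n - l) <= e
}.

Section Quotient.
Context {R : realType} {T : staralg R} (S : cseminorm T).
Implicit Types (x y z : T) (k : R[i]).
Local Notation dom := (@cdom R T S).
Local Notation N := (@csn R T S).

Lemma cdom0 : dom 0.
Proof. by rewrite -(scale0r (saone T)); apply/cdomZ/cdom1. Qed.

Lemma cdomN x : dom x -> dom (- x).
Proof. by rewrite -scaleN1r; exact: cdomZ. Qed.

Lemma cdomB x y : dom x -> dom y -> dom (x - y).
Proof. by move=> dx dy; apply: cdomD => //; exact: cdomN. Qed.

Lemma csn0 : N 0 = 0.
Proof. by rewrite -(scale0r (saone T)) csnZ ?cmod0 ?mul0r //; exact: cdom1. Qed.

Lemma csnN x : dom x -> N (- x) = N x.
Proof. by move=> dx; rewrite -scaleN1r csnZ // cmodN cmod1 mul1r. Qed.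

Lemma csn_ge0 x : dom x -> 0 <= N x.
Proof.
move=> dx; have := csnD dx (cdomN dx).
by rewrite subrr csn0 csnN // -mulr2n pmulrn_lge0.
Qed.

(** The C*-identity gives [N y ^+ 2 <= N (sastar y) * N y]; cancel [N y], then use that [sastar] is
    an involution. *)
Lemma csn_star x : dom x -> N (sastar x) = N x.
Proof.
have le y : dom y -> N y <= N (sastar y).
  move=> dy; have [->|y0] := eqVneq (N y) 0; first by rewrite csn_ge0 //; exact: cdomS.
  have yp : 0 < N y by rewrite lt_def y0 csn_ge0.
  rewrite -(ler_pM2r yp) -expr2 -csnS //; apply: csnM => //; exact: cdomS.
move=> dx; apply/le_anti; rewrite le // andbT.
by rewrite -{2}(sastarK x) le //; exact: cdomS.
Qed.

Lemma sastarN x : sastar (- x) = - sastar x.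
Proof. by rewrite -scaleN1r sastarZ rmorphN rmorph1 scaleN1r. Qed.

Lemma samulNl x y : samul (- x) y = - samul x y.
Proof. by rewrite -scaleN1r -sascalerAl scaleN1r. Qed.

Lemma samulNr x y : samul x (- y) = - samul x y.
Proof. by rewrite -scaleN1r -sascalerAr scaleN1r. Qed.

Definition ceqv x y := dom y /\ N (x - y) = 0.

Lemma csn_eq0D x y : dom x -> dom y -> N x = 0 -> N y = 0 -> N (x + y) = 0.
Proof.
move=> dx dy Nx Ny; apply/le_anti; rewrite csn_ge0 ?andbT; last exact: cdomD.
by rewrite (le_trans (csnD dx dy)) // Nx Ny addr0.
Qed.

(** A class is stored as the set of its members, so that equality in the quotient is Leibniz
    equality, by extensionality. *)
Definition cquot := {X : set T | exists2 x, dom x & X = ceqv x}.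

HB.instance Definition _ := gen_eqMixin cquot.
HB.instance Definition _ := gen_choiceMixin cquot.

(** Total by convention: outside the domain the value is the class of 0. *)
Definition cpi x : cquot :=
  match pselect (dom x) with
  | left dx => exist _ (ceqv x) (ex_intro2 _ _ x dx erefl)
  | right _ => exist _ (ceqv 0) (ex_intro2 _ _ 0 cdom0 erefl)
  end.

Definition crepr (q : cquot) : T := sval (cid2 (svalP q)).

Lemma crepr_dom q : dom (crepr q).
Proof. by rewrite /crepr; case: cid2. Qed.

Lemma cpiP x y : dom x -> dom y -> (cpi x = cpi y <-> N (x - y) = 0).
Proof.
move=> dx dy; rewrite /cpi; case: pselect => // dx'; case: pselect => // dy'.
split=> [[exy]|Nxy].
  have : ceqv y y by split=> //; rewrite subrr csn0.
  by rewrite -exy => -[].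
apply: eq_exist; apply/seteqP; split=> z [dz Nz]; split=> //.
  rewrite -(subrK x y) -addrA; apply: csn_eq0D => //; try exact: cdomB.
  by rewrite -opprB csnN //; exact: cdomB.
by rewrite -(subrK y x) -addrA; apply: csn_eq0D => //; exact: cdomB.
Qed.

Lemma creprK q : cpi (crepr q) = q.
Proof.
case: q => X HX; rewrite /cpi; case: pselect => [d|nd].
  by apply: eq_exist; rewrite /crepr /=; case: cid2 => x /= _ ->.
by case: nd; exact: crepr_dom.
Qed.

Lemma crepr_cpi x : dom x -> N (crepr (cpi x) - x) = 0.
Proof. by move=> dx; apply/cpiP => //; [exact: crepr_dom | rewrite creprK]. Qed.

Lemma cpi_ind (P : cquot -> Prop) : (forall x, dom x -> P (cpi x)) -> forall q, P q.
Proof. by move=> h q; rewrite -(creprK q); apply: h; exact: crepr_dom. Qed.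

Definition cq_add p q := cpi (crepr p + crepr q).
Definition cq_opp p := cpi (- crepr p).
Definition cq_scale k p := cpi (k *: crepr p).
Definition cq_mul p q := cpi (samul (crepr p) (crepr q)).
Definition cq_star p := cpi (sastar (crepr p)).
Definition cq_norm p := N (crepr p).

Lemma cpiD x y : dom x -> dom y -> cq_add (cpi x) (cpi y) = cpi (x + y).
Proof.
move=> dx dy; have [rx ry] := (crepr_dom (cpi x), crepr_dom (cpi y)).
apply/cpiP; try exact: cdomD.
rewrite opprD addrACA; apply: csn_eq0D; try exact: cdomB; exact: crepr_cpi.
Qed.

Lemma cpiZ k x : dom x -> cq_scale k (cpi x) = cpi (k *: x).
Proof.
move=> dx; have rx := crepr_dom (cpi x).
apply/cpiP; try exact: cdomZ.
by rewrite -scalerBr csnZ ?crepr_cpi ?mulr0 //; exact: cdomB.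
Qed.

Lemma cpiN x : dom x -> cq_opp (cpi x) = cpi (- x).
Proof. by move=> dx; rewrite -scaleN1r -cpiZ // /cq_scale scaleN1r. Qed.

Lemma cpiM x y : dom x -> dom y -> cq_mul (cpi x) (cpi y) = cpi (samul x y).
Proof.
move=> dx dy; have [rx ry] := (crepr_dom (cpi x), crepr_dom (cpi y)).
have [bx b_y] := (cdomB rx dx, cdomB ry dy).
apply/cpiP; try exact: cdomM.
set a := crepr _; set b := crepr _.
have -> : samul a b - samul x y = samul (a - x) b + samul x (b - y).
  by rewrite samulDl samulDr samulNl samulNr subrKA.
have M0 u v : dom u -> dom v -> N u = 0 \/ N v = 0 -> N (samul u v) = 0.
  move=> du dv uv; apply/le_anti; rewrite csn_ge0 ?andbT; last exact: cdomM.
  by rewrite (le_trans (csnM du dv)) //; case: uv => ->; rewrite ?mul0r ?mulr0.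
apply: csn_eq0D; try exact: cdomM; apply: M0 => //.
  by left; exact: crepr_cpi.
by right; exact: crepr_cpi.
Qed.

Lemma cpiS x : dom x -> cq_star (cpi x) = cpi (sastar x).
Proof.
move=> dx; have rx := crepr_dom (cpi x).
apply/cpiP; try exact: cdomS.
by rewrite -sastarN -sastarD csn_star ?crepr_cpi //; exact: cdomB.
Qed.

Lemma cpi_norm x : dom x -> cq_norm (cpi x) = N x.
Proof.
move=> dx; have rx := crepr_dom (cpi x); have H := crepr_cpi dx.
have bx := cdomB rx dx; apply/le_anti/andP; split.
  by have := csnD bx dx; rewrite subrK H add0r.
have := csnD (cdomN bx) rx; rewrite opprB subrK.
by rewrite -opprB csnN // H add0r.
Qed.

Local Ltac by_repr := do ?[elim/cpi_ind => ? ?];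
  rewrite ?(cpiD, cpiM, cpiS, cpiZ, cpiN); do ?[apply: cdomD | apply: cdomM
   | apply: cdomS | apply: cdomZ | apply: cdom1 | apply: cdom0 | apply: cdomN] => //.

Lemma cq_addA : associative cq_add.
Proof. by by_repr; rewrite addrA. Qed.
Lemma cq_addC : commutative cq_add.
Proof. by by_repr; rewrite addrC. Qed.
Lemma cq_add0 : left_id (cpi 0) cq_add.
Proof. by by_repr; rewrite add0r. Qed.
Lemma cq_addN : left_inverse (cpi 0) cq_opp cq_add.
Proof. by by_repr; rewrite addNr. Qed.

HB.instance Definition _ :=
  GRing.isZmodule.Build cquot cq_addA cq_addC cq_add0 cq_addN.

Lemma cq_scaleA a b v : cq_scale a (cq_scale b v) = cq_scale (a * b) v.
Proof. by move: v; by_repr; rewrite scalerA. Qed.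
Lemma cq_scale1 : left_id 1 cq_scale.
Proof. by by_repr; rewrite scale1r. Qed.
Lemma cq_scaleDr : right_distributive cq_scale +%R.
Proof.
move=> k; elim/cpi_ind => x dx; elim/cpi_ind => y dy.
rewrite [_ + _]cpiD // !cpiZ //; last exact: cdomD.
by rewrite [RHS]cpiD ?scalerDr //; exact: cdomZ.
Qed.
Lemma cq_scaleDl v : {morph cq_scale^~ v : a b / a + b}.
Proof.
move=> k l; elim/cpi_ind: v => x dx; rewrite !cpiZ //.
by rewrite [RHS]cpiD ?scalerDl //; exact: cdomZ.
Qed.

HB.instance Definition _ := GRing.Zmodule_isLmodule.Build R[i] cquot
  cq_scaleA cq_scale1 cq_scaleDr cq_scaleDl.

Lemma cq_normD (x y : cquot) : (cq_norm (x + y))%:C <= (cq_norm x)%:C + (cq_norm y)%:C.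
Proof.
elim/cpi_ind: x => x dx; elim/cpi_ind: y => y dy.
rewrite [_ + _ in leLHS]cpiD // !cpi_norm //; last exact: cdomD.
by rewrite -(rmorphD (real_complex R)) lecR csnD.
Qed.

Lemma cq_normZ k (x : cquot) : (cq_norm (k *: x))%:C = `|k| * (cq_norm x)%:C.
Proof.
elim/cpi_ind: x => x dx; rewrite [_ *: _]cpiZ // !cpi_norm //; last exact: cdomZ.
by rewrite csnZ // cmodE rmorphM.
Qed.

Lemma cq_norm0 (x : cquot) : (cq_norm x)%:C = 0 -> x = 0.
Proof.
elim/cpi_ind: x => x dx; rewrite cpi_norm // => -[Nx].
by apply/cpiP => //; [exact: cdom0 | rewrite subr0].
Qed.

HB.instance Definition _ := Lmodule_isNormed.Build R[i] cquot
  cq_normD cq_normZ cq_norm0.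

Lemma cq_nr x : dom x -> nr (cpi x : cquot) = N x.
Proof. by move=> dx; rewrite -(cpi_norm dx). Qed.

Lemma cq_piB x y : dom x -> dom y -> cpi x - cpi y = cpi (x - y).
Proof.
move=> dx dy; rewrite [- _]cpiN // [_ + _]cpiD //; exact: cdomN.
Qed.

Lemma cq_complete (F : set_system cquot) : ProperFilter F -> cauchy F -> cvg F.
Proof.
move=> PF /cauchyP Fex.
(* Two members of a proper filter meet, so consecutive centres are at distance at most
   [2^-(n+3) + 2^-(n+2)], below the [2^-n] that [csn_complete] asks for. *)
pose r n : R := 2^-1 ^+ n.+2.
have r0 n : 0 < r n by rewrite exprn_gt0 // invr_gt0.
have /choice[q hq] : forall n, exists q : cquot, F (ball q (r n)%:C).
  by move=> n; apply: Fex; rewrite ltcR.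
pose u n := crepr (q n).
have du n : dom (u n) by exact: crepr_dom.
have qu n : q n = cpi (u n) by rewrite creprK.
have nrF n : F [set p : cquot | nr (q n - p) < r n]%classic.
  by apply: filterS (hq n) => p; rewrite -ball_normE /ball_ /= nrE ltcR.
have fast n : N (u n.+1 - u n) <= 2^-1 ^+ n.
  rewrite -cq_nr; last exact: cdomB.
  rewrite -cq_piB // -!qu.
  have [p [/= p1 p2]] := filter_ex (filterI (nrF n.+1) (nrF n)).
  apply: le_trans (nr_tri p _ _) _; rewrite [nr (p - _)]nrC.
  apply: le_trans (lerD (ltW p1) (ltW p2)) _.
  rewrite /r !exprS; have : 0 <= 2^-1 ^+ n :> R by rewrite exprn_ge0 ?invr_ge0.
  set t := 2^-1 ^+ n; lra.
have [l dl ul] := csn_complete du fast.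
apply/cvg_ex; exists (cpi l); apply/cvgrPdist_lt => e e0.
have eR : e = (complex.Re e)%:C by rewrite RRe_real // gtr0_real.
have re0 : 0 < complex.Re e by rewrite -ltcR -eR.
have e20 : 0 < complex.Re e / 2 by rewrite divr_gt0.
have [M hM] := ul _ e20.
have [M' hM'] := @expr_small R 2^-1 (complex.Re e / 2)
   ltac:(by rewrite invr_ge0) ltac:(by rewrite invf_lt1 // ltr1n) e20.
pose n := maxn M M'.
apply: filterS (nrF n) => p /= qp.
rewrite nrE eR ltcR; apply: le_lt_trans (nr_tri (q n) _ _) _.
rewrite [ltRHS](splitr (complex.Re e)); apply: ler_ltD.
  rewrite nrC qu cq_piB // cq_nr ?hM ?leq_maxl //; exact: cdomB.
apply: lt_le_trans qp _; apply: hM'; rewrite /n.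
by rewrite (leq_trans (leq_maxr M M')) // -addn2 leq_addr.
Qed.

HB.instance Definition _ := Uniform_isComplete.Build cquot cq_complete.

Lemma cq_mulA : associative cq_mul.
Proof. by by_repr; rewrite samulA. Qed.
Lemma cq_mul1x : left_id (cpi (saone T)) cq_mul.
Proof. by by_repr; rewrite samul1x. Qed.
Lemma cq_mulx1 : right_id (cpi (saone T)) cq_mul.
Proof. by by_repr; rewrite samulx1. Qed.
Lemma cq_mulDl : left_distributive cq_mul +%R.
Proof.
move=> x y z; rewrite -[x + y]/(cq_add x y) -[RHS]/(cq_add _ _).
by move: x y z; by_repr; rewrite samulDl.
Qed.
Lemma cq_mulDr : right_distributive cq_mul +%R.
Proof.
move=> x y z; rewrite -[y + z]/(cq_add y z) -[RHS]/(cq_add _ _).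
by move: x y z; by_repr; rewrite samulDr.
Qed.
Lemma cq_scalerAl k p q : k *: cq_mul p q = cq_mul (k *: p) q.
Proof.
rewrite -[LHS]/(cq_scale _ _) -[k *: p]/(cq_scale _ _).
by move: p q; by_repr; rewrite sascalerAl.
Qed.
Lemma cq_scalerAr k p q : k *: cq_mul p q = cq_mul p (k *: q).
Proof.
rewrite -[LHS]/(cq_scale _ _) -[k *: q]/(cq_scale _ _).
by move: p q; by_repr; rewrite sascalerAr.
Qed.
Lemma cq_starK : involutive cq_star.
Proof. by by_repr; rewrite sastarK. Qed.
Lemma cq_starD : {morph cq_star : x y / x + y}.
Proof.
move=> x y; rewrite -[x + y]/(cq_add x y) -[RHS]/(cq_add _ _).
by move: x y; by_repr; rewrite sastarD.
Qed.
Lemma cq_starZ k p : cq_star (k *: p) = k^*%R *: cq_star p.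
Proof.
rewrite -[RHS]/(cq_scale _ _) -[k *: p]/(cq_scale _ _).
by move: p; by_repr; rewrite sastarZ.
Qed.
Lemma cq_starM p q : cq_star (cq_mul p q) = cq_mul (cq_star q) (cq_star p).
Proof. by move: p q; by_repr; rewrite sastarM. Qed.
Lemma cq_normM (p q : cquot) : `|cq_mul p q| <= `|p| * `|q|.
Proof.
rewrite !nrE -(rmorphM (real_complex R)) lecR.
elim/cpi_ind: p => x dx; elim/cpi_ind: q => y dy.
rewrite cpiM // !cq_nr ?csnM //; exact: cdomM.
Qed.
Lemma cq_cstar (p : cquot) : `|cq_mul (cq_star p) p| = `|p| ^+ 2.
Proof.
rewrite !nrE -(rmorphXn (real_complex R)) /=; congr (_%:C).
elim/cpi_ind: p => x dx; have sx := cdomS dx.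
rewrite cpiS // cpiM // !cq_nr ?csnS //; exact: cdomM.
Qed.

HB.instance Definition _ := isCStarAlgebra.Build R[i] cquot
  cq_mulA cq_mul1x cq_mulx1 cq_mulDl cq_mulDr cq_scalerAl cq_scalerAr
  cq_normM cq_starK cq_starD cq_starZ cq_starM cq_cstar.

Definition cstar_quot : cstarAlgType R[i] := cquot.

Definition cproj : T -> cstar_quot := cpi.

End Quotient.

Section QuotientTheory.
Context {R : realType} {T : staralg R} (S : cseminorm T).
Implicit Types (x y : T) (k : R[i]).
Local Notation dom := (@cdom R T S).
Local Notation N := (@csn R T S).
Local Notation pi := (@cproj R T S).

Lemma cprojD x y : dom x -> dom y -> pi (x + y) = pi x + pi y.
Proof. by move=> dx dy; rewrite -[RHS]/(cq_add _ _) cpiD. Qed.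
Lemma cprojZ k x : dom x -> pi (k *: x) = k *: pi x.
Proof. by move=> dx; rewrite -[RHS]/(cq_scale _ _) cpiZ. Qed.
Lemma cprojM x y : dom x -> dom y -> pi (samul x y) = cmul (pi x) (pi y).
Proof. by move=> dx dy; rewrite -[RHS]/(cq_mul _ _) cpiM. Qed.
Lemma cprojS x : dom x -> pi (sastar x) = star (pi x).
Proof. by move=> dx; rewrite -[RHS]/(cq_star _) cpiS. Qed.
Lemma cproj1 : pi (saone T) = cone.
Proof. by []. Qed.
Lemma nr_cproj x : dom x -> nr (pi x) = N x.
Proof. exact: cq_nr. Qed.
Lemma cprojP x y : dom x -> dom y -> (pi x = pi y <-> N (x - y) = 0).
Proof. exact: cpiP. Qed.
Lemma cproj_surj (q : cstar_quot S) : exists2 x, dom x & q = pi x.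
Proof. by exists (crepr q); [exact: crepr_dom | rewrite /cproj creprK]. Qed.

End QuotientTheory.

(** * Square roots and contractivity of *-homomorphisms *)

Section CStarRing.
Context {R : realType}.

Definition cring (A : cstarAlgType R[i]) : Type := A.

HB.instance Definition _ (A : cstarAlgType R[i]) := GRing.Lmodule.copy (cring A) A.
HB.instance Definition _ (A : cstarAlgType R[i]) :=
  GRing.Zmodule_isPzRing.Build (cring A) cmulA cmul1x cmulx1 cmulDl cmulDr.

(** The commutativity proof is a parameter of the type, so that instance inference finds it and
    [ring] applies; the operations are convertible to those of [A]. *)
Definition comring (A : cstarAlgType R[i]) (A_com : cstar_commutative A) : Type := A.

HB.instance Definition _ (A : cstarAlgType R[i]) (A_com : cstar_commutative A) :=
  GRing.Lmodule.copy (comring A_com) A.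
HB.instance Definition _ (A : cstarAlgType R[i]) (A_com : cstar_commutative A) :=
  GRing.Zmodule_isComPzRing.Build (comring A_com) cmulA A_com cmul1x cmulDl.

Context {A : cstarAlgType R[i]}.
Implicit Types (x y z : A) (k : R[i]).

Lemma cmul0x x : cmul 0 x = 0. Proof. exact: (@mul0r (cring A)). Qed.
Lemma cmulx0 x : cmul x 0 = 0. Proof. exact: (@mulr0 (cring A)). Qed.
Lemma cmulBl x y z : cmul (x - y) z = cmul x z - cmul y z.
Proof. exact: (@mulrBl (cring A)). Qed.
Lemma cmulBr x y z : cmul x (y - z) = cmul x y - cmul x z.
Proof. exact: (@mulrBr (cring A)). Qed.

Lemma star0 : star (0 : A) = 0.
Proof. by rewrite -(scale0r (0 : A)) starZ rmorph0 !scale0r. Qed.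
Lemma starN x : star (- x) = - star x.
Proof. by rewrite -(scaleN1r x) starZ rmorphN rmorph1 scaleN1r. Qed.
Lemma starB x y : star (x - y) = star x - star y.
Proof. by rewrite starD starN. Qed.
Lemma star1 : star (cone : A) = cone.
Proof. by rewrite -[LHS]cmul1x -{1}(starK cone) -starM cmul1x starK. Qed.
Lemma starZr (r : R) x : star (r%:C *: x) = r%:C *: star x.
Proof. by rewrite starZ conjcE conjc_real. Qed.

Lemma nrM x y : nr (cmul x y) <= nr x * nr y.
Proof. by rewrite -lecR rmorphM /= -!nrE cnormM. Qed.

Lemma nr_starM x : nr (cmul (star x) x) = nr x ^+ 2.
Proof. by apply: complexI; rewrite rmorphXn /= -!nrE cstar_identity. Qed.

Lemma nr_star x : nr (star x) = nr x.
Proof.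
have le y : nr y <= nr (star y).
  have [->|y0] := eqVneq (nr y) 0; first exact: nr_ge0.
  have yp : 0 < nr y by rewrite lt_def y0 nr_ge0.
  by rewrite -(ler_pM2r yp) -expr2 -nr_starM nrM.
by apply/le_anti; rewrite le -{2}(starK x) le.
Qed.

Lemma nr_sa_sq x : star x = x -> nr (cmul x x) = nr x ^+ 2.
Proof. by move=> sx; rewrite -{1}sx nr_starM. Qed.

Lemma starM_eq0 x : cmul (star x) x = 0 -> x = 0.
Proof.
move=> x0; apply: nr_eq0; apply/eqP; rewrite -sqrf_eq0 -nr_starM.
by rewrite x0 nr0.
Qed.

Lemma nr1_eq : (cone : A) <> 0 -> nr (cone : A) = 1.
Proof.
move=> n0; have : nr (cone : A) = nr (cone : A) ^+ 2.
  by rewrite -nr_starM star1 cmul1x.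
have : nr (cone : A) != 0 by apply/eqP => /nr_eq0.
by move=> h; rewrite expr2 -{1}[nr _]mulr1 => /(mulfI h).
Qed.

(** Only an inequality, because the unit of the zero algebra has norm 0. *)
Lemma nr1_le : nr (cone : A) <= 1.
Proof.
have [->|/eqP/nr1_eq -> //] := eqVneq (cone : A) 0; by rewrite nr0.
Qed.

Lemma nrZr (r : R) x : 0 <= r -> nr (r%:C *: x) = r * nr x.
Proof. by move=> r0; rewrite nrZ cmodR ger0_norm. Qed.

End CStarRing.

(** * Limits of sequences and the algebra operations *)

Section SeqCvg.
Context {R : realType}.

Lemma seq_cvg_unique (A : normedModType R[i]) (u : nat -> A) l l' :
  seq_cvg u l -> seq_cvg u l' -> l = l'.
Proof.
move=> ul ul'; apply/eqP; rewrite -subr_eq0; apply/eqP/nr_le0 => e e0.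
have [|N hN] := ul (e / 2); first by rewrite divr_gt0.
have [|N' hN'] := ul' (e / 2); first by rewrite divr_gt0.
apply: le_trans (nr_tri (u (maxn N N')) _ _) _; rewrite [leRHS](splitr e) nrC.
by apply: lerD; [apply: hN | apply: hN']; rewrite ?leq_maxl ?leq_maxr.
Qed.

Lemma seq_cvg_lip (A B : normedModType R[i]) (f : A -> B) (c : R) u l :
  (forall x y, nr (f x - f y) <= c * nr (x - y)) ->
  seq_cvg u l -> seq_cvg (f \o u) (f l).
Proof.
move=> fL ul e e0; have c1 : 0 < `|c| + 1 by rewrite ltr_wpDl.
have [|N hN] := ul (e / (`|c| + 1)); first by rewrite divr_gt0.
exists N => n Nn; apply: le_trans (fL _ _) _.
have := hN n Nn; rewrite ler_pdivlMr // => H; apply: le_trans H.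
rewrite mulrC ler_wpM2l ?nr_ge0 // (le_trans (ler_norm c)) // lerDl //.
Qed.

Lemma seq_cvg_cst (A : normedModType R[i]) (l : A) : seq_cvg (fun=> l) l.
Proof. by move=> e e0; exists 0%N => n _; rewrite subrr nr0 ltW. Qed.

Lemma seq_cvgD (A : normedModType R[i]) (u v : nat -> A) l m :
  seq_cvg u l -> seq_cvg v m -> seq_cvg (fun n => u n + v n) (l + m).
Proof.
move=> ul vm e e0.
have [|N hN] := ul (e / 2); first by rewrite divr_gt0.
have [|N' hN'] := vm (e / 2); first by rewrite divr_gt0.
exists (maxn N N') => n; rewrite geq_max => /andP[Nn N'n].
rewrite opprD addrACA (le_trans (nrD _ _)) // [leRHS](splitr e).
by apply: lerD; [apply: hN | apply: hN'].
Qed.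

Lemma seq_cvgZ (A : normedModType R[i]) (k : R[i]) (u : nat -> A) l :
  seq_cvg u l -> seq_cvg (fun n => k *: u n) (k *: l).
Proof.
by apply: (@seq_cvg_lip _ _ _ (cmod k)) => x y; rewrite -scalerBr nrZ.
Qed.

Lemma seq_cvgM (A : cstarAlgType R[i]) (u v : nat -> A) l m :
  seq_cvg u l -> seq_cvg v m -> seq_cvg (fun n => cmul (u n) (v n)) (cmul l m).
Proof.
move=> ul vm e e0; pose c := nr l + nr m + 1.
have [l0 m0] := (nr_ge0 l, nr_ge0 m).
have c0 : 0 < c by rewrite ltr_wpDl // addr_ge0.
(* The cap at 1 bounds the product of the two errors by [d], so the total error is at most
   [d * c]. *)
pose d := Num.min 1 (e / c).
have d0 : 0 < d by rewrite lt_min ltr01 divr_gt0.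
have [N hN] := ul d d0; have [N' hN'] := vm d d0.
exists (maxn N N') => n; rewrite geq_max => /andP[/hN uN /hN' vN].
have -> : cmul (u n) (v n) - cmul l m
  = cmul (u n - l) (v n - m) + (cmul (u n - l) m + cmul l (v n - m)).
  by rewrite addrA -cmulDr subrK cmulBl cmulBr addrA subrK.
apply: le_trans (nrD _ _) _.
apply: le_trans (lerD (nrM _ _) (le_trans (nrD _ _) (lerD (nrM _ _) (nrM _ _)))) _.
have : d <= e / c by rewrite ge_min lexx orbT.
rewrite ler_pdivlMr // => dc; apply: le_trans dc.
have d1 : d <= 1 by rewrite ge_min lexx.
have [a0 b0] := (nr_ge0 (u n - l), nr_ge0 (v n - m)).
rewrite /c; move: (nr (u n - l)) (nr (v n - m)) (nr l) (nr m) uN vN a0 b0 l0 m0.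
by clear -d0 d1 => a b p q; nra.
Qed.

Lemma seq_cvg_star (A : cstarAlgType R[i]) (u : nat -> A) l :
  seq_cvg u l -> seq_cvg (fun n => star (u n)) (star l).
Proof.
by apply: (@seq_cvg_lip _ _ _ 1) => x y; rewrite -starB nr_star mul1r.
Qed.

Lemma seq_cvg_shift (A : normedModType R[i]) (u : nat -> A) l :
  seq_cvg u l -> seq_cvg (fun n => u n.+1) l.
Proof.
by move=> ul e e0; have [N hN] := ul e e0; exists N => n Nn; apply/hN/leqW.
Qed.

End SeqCvg.

Section Sqrt.
Context {R : realType} {A : cstarAlgType R[i]}.
Implicit Types (x y z k : A).

(* The iteration [y := (x + y^2) / 2] converges to [1 - sqrt (1 - x)]. *)
Lemma sqrt_1Bx x : nr x < 1 ->
  exists k, [/\ cmul k k = cone - x, star x = x -> star k = k &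
    forall z, cmul x z = cmul z x -> cmul k z = cmul z k].
Proof.
move=> x1; pose h : R[i] := (2^-1)%:C.
pose f y := h *: (x + cmul y y); pose u n := iter n f 0.
have h0 : 0 <= 2^-1 :> R by rewrite invr_ge0.
have x0 := nr_ge0 x.
(* The ball of radius [nr x] is stable because [(r + r^2) / 2 <= r] for [0 <= r <= 1]; on it [f] is
   Lipschitz with constant [nr x]. *)
have ux n : nr (u n) <= nr x.
  elim: n => [|n IH]; first by rewrite nr0.
  rewrite /= -/(u n) /f nrZr //.
  have := le_trans (nrD x (cmul (u n) (u n))) (lerD (lexx _) (nrM _ _)).
  have := nr_ge0 (u n); nra.
have fL n : nr (u n.+2 - u n.+1) <= nr x * nr (u n.+1 - u n).
  rewrite /= -/(u n) -[f (u n)]/(u n.+1) /f -scalerBr nrZr //.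
  set a := u n.+1; set b := u n.
  have -> : x + cmul a a - (x + cmul b b) = cmul a (a - b) + cmul (a - b) b.
    by rewrite cmulBr cmulBl subrKA opprD addrACA subrr add0r.
  have := le_trans (nrD _ _) (lerD (nrM a (a - b)) (nrM (a - b) b)).
  have := ux n.+1; have := ux n; rewrite -/a -/b.
  have := nr_ge0 (a - b); nra.
have cL n : nr (u n.+1 - u n) <= nr (u 1%N) * nr x ^+ n.
  elim: n => [|n IH]; first by rewrite subr0 mulr1.
  apply: le_trans (fL n) _; rewrite exprS mulrCA.
  by apply: ler_wpM2l.
have [l ul _] := geometric_cvg x0 x1 cL.
have fl : f l = l.
  apply: seq_cvg_unique (seq_cvg_shift ul).
  by apply: seq_cvgZ; apply: seq_cvgD; [exact: seq_cvg_cst | exact: seq_cvgM].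
exists (cone - l); split.
- have -> : x = l + l - cmul l l.
    rewrite -{1 2}fl /f -scalerDl -rmorphD /=.
    by rewrite (_ : 2^-1 + 2^-1 = 1) ?scale1r ?addrK //; lra.
  by rewrite cmulBl !cmulBr !cmul1x cmulx1 !opprB -!addrA opprD; congr (_ + _); rewrite addrCA.
- move=> sx; rewrite starB star1; congr (_ - _).
  apply: (seq_cvg_unique (seq_cvg_star ul)).
  have su n : star (u n) = u n.
    by elim: n => [|n IH]; rewrite ?star0 //= starZr starD starM sx IH.
  by move=> e e0; have [N hN] := ul e e0; exists N => n; rewrite su; exact: hN.
- move=> z xz; rewrite cmulBl cmulBr cmul1x cmulx1; congr (_ - _).
  have uz n : cmul (u n) z = cmul z (u n).
    elim: n => [|n IH]; first by rewrite cmul0x cmulx0.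
    rewrite /= -/(u n) /f -cscalerAl -cscalerAr cmulDl cmulDr xz.
    by rewrite -cmulA IH cmulA IH cmulA.
  apply: (seq_cvg_unique (seq_cvgM ul (seq_cvg_cst z))).
  have := seq_cvgM (seq_cvg_cst z) ul.
  by move=> H e e0; have [N hN] := H e e0; exists N => n; rewrite uz; exact: hN.
Qed.

(* [a + i b] is unitary. *)
Lemma nr_sq_sum1 (a b : A) : star a = a -> star b = b -> cmul a b = cmul b a ->
  cmul a a + cmul b b = cone -> nr a <= 1.
Proof.
move=> sa sb ab ab1.
have ii : 'i%C * 'i%C = -1 :> R[i] by rewrite -expr2 sqr_i.
pose u := a + 'i%C *: b; pose v := a - 'i%C *: b.
have su : star u = v.
  rewrite starD starZ sa sb conjcE /v -scaleNr; congr (_ + _ *: _).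
  by apply/eqP; rewrite eq_complex /= oppr0 !eqxx.
have sv : star v = u by rewrite -su starK.
have vu : cmul v u = cone.
  rewrite /v /u cmulBl !cmulDr -!cscalerAl -!cscalerAr scalerA ii scaleN1r ab.
  by rewrite opprD opprK addrA addrK.
have uv : cmul u v = cone.
  rewrite /v /u cmulBr !cmulDl -!cscalerAl -!cscalerAr scalerA ii scaleN1r ab.
  by rewrite opprD opprK addrA addrK.
have nu : nr u <= 1.
  by rewrite -(@expr_le1 _ 2) ?nr_ge0 // -nr_starM su vu nr1_le.
have nv : nr v <= 1 by rewrite -su nr_star.
have : nr (a + a) <= 2.
  have -> : a + a = u + v by rewrite addrACA addrN addr0.
  by rewrite (le_trans (nrD _ _)) // lerD.
rewrite -mulr2n -scaler_nat -(rmorph_nat (real_complex R)) nrZr //.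
by rewrite ger_pMr.
Qed.

End Sqrt.

Section StarHom.
Context {R : realType}.

Section Morphism.
Context {A B : cstarAlgType R[i]} (f : star_hom A B).

Lemma star_hom0 : f 0 = 0.
Proof. by rewrite -(scale0r (0 : A)) star_homZ !scale0r. Qed.
Lemma star_homN x : f (- x) = - f x.
Proof. by rewrite -(scaleN1r x) star_homZ scaleN1r. Qed.
Lemma star_homB x y : f (x - y) = f x - f y.
Proof. by rewrite star_homD star_homN. Qed.

Lemma star_hom_inj0 : (forall x, f x = 0 -> x = 0) -> injective f.
Proof.
move=> f0 x y fxy; apply/eqP; rewrite -subr_eq0; apply/eqP/f0.
by rewrite star_homB fxy subrr.
Qed.

Theorem star_hom_contract x : nr (f x) <= nr x.
Proof.
have small h : star h = h -> nr h < 1 -> nr (f h) <= 1.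
  move=> sh h1.
  have hh1 : nr (cmul h h) < 1.
    by rewrite nr_sa_sq // expr_lt1 // nr_ge0.
  have [k [kk sk ck]] := sqrt_1Bx hh1.
  apply: (@nr_sq_sum1 _ _ _ (f k)); rewrite -?star_hom_star -?star_homM.
  - by rewrite sh.
  - by rewrite sk // starM sh.
  - by rewrite ck // cmulA.
  - by rewrite -star_homD kk addrC subrK star_hom1.
(* Dividing by [nr h + e] keeps the norm strictly below 1 and covers [h = 0]. *)
have sa h : star h = h -> nr (f h) <= nr h.
  move=> sh; apply/ler_addgt0Pr => e e0; pose c := nr h + e.
  have c0 : 0 < c by rewrite ltr_wpDl // nr_ge0.
  have ci : 0 <= c^-1 by rewrite invr_ge0 ltW.
  have := small (c^-1%:C *: h); rewrite starZr sh star_homZ !nrZr //.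
  rewrite ![c^-1 * _]mulrC !ltr_pdivrMr // !ler_pdivrMr // !mul1r; apply => //.
  by rewrite /c ltrDl.
(* By the C*-identity, the estimate for this self-adjoint element is the square of the one for
   [x]. *)
have := sa (cmul (star x) x); rewrite star_homM star_hom_star !nr_starM starM starK.
by move/(_ erefl); rewrite ler_sqr ?nnegrE ?nr_ge0.
Qed.

Lemma seq_cvg_star_hom u l : seq_cvg u l -> seq_cvg (f \o u) (f l).
Proof.
by apply: (@seq_cvg_lip _ _ _ _ 1) => x y; rewrite mul1r -star_homB star_hom_contract.
Qed.

End Morphism.

(** Being injective, [i] reflects all the equations of a *-homomorphism, so any choice of preimages
    satisfies them. *)
Lemma star_hom_lift {A B D : cstarAlgType R[i]} (f : star_hom B A) (i : star_hom D A) :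
  injective i -> (forall x, exists y, i y = f x) ->
  exists g : star_hom B D, forall x, i (g x) = f x.
Proof.
move=> inji /choice[g hg].
unshelve eexists; first (exists g).
- by move=> x y; apply: inji; rewrite star_homD !hg star_homD.
- by move=> k x; apply: inji; rewrite star_homZ !hg star_homZ.
- by apply: inji; rewrite hg !star_hom1.
- by move=> x y; apply: inji; rewrite star_homM !hg star_homM.
- by move=> x; apply: inji; rewrite star_hom_star !hg star_hom_star.
- exact: hg.
Qed.

(** A partial *-homomorphism is given by its graph [G], not assumed functional: the norm bound,
    applied to differences, yields single-valuedness and passes to the closure [H], which is defined
    everywhere by density and by completeness of [L]. *)
Lemma graph_extension {K L : cstarAlgType R[i]} (G : K -> L -> Prop) :
    G cone cone ->
    (forall p q p' q', G p q -> G p' q' -> G (p + p') (q + q')) ->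
    (forall k p q, G p q -> G (k *: p) (k *: q)) ->
    (forall p q p' q', G p q -> G p' q' -> G (cmul p p') (cmul q q')) ->
    (forall p q, G p q -> G (star p) (star q)) ->
    (forall p q, G p q -> nr q <= nr p) ->
    (forall (p : K) (e : R), 0 < e -> exists p' q', G p' q' /\ nr (p - p') <= e) ->
  exists f : star_hom K L, forall p q, G p q -> f p = q.
Proof.
move=> G1 GD GZ GM GS Gn Gd.
pose H a b := exists u v, [/\ forall n, G (u n) (v n), seq_cvg u a & seq_cvg v b].
have HG p q : G p q -> H p q.
  by move=> pq; exists (fun=> p), (fun=> q); split => //; exact: seq_cvg_cst.
have HD a b a' b' : H a b -> H a' b' -> H (a + a') (b + b').
  move=> [u [v [uv ua vb]]] [u' [v' [uv' ua' vb']]].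
  exists (fun n => u n + u' n), (fun n => v n + v' n).
  by split=> [n||]; [exact: GD | exact: seq_cvgD | exact: seq_cvgD].
have HZ k a b : H a b -> H (k *: a) (k *: b).
  move=> [u [v [uv ua vb]]]; exists (fun n => k *: u n), (fun n => k *: v n).
  by split=> [n||]; [exact: GZ | exact: seq_cvgZ | exact: seq_cvgZ].
have HM a b a' b' : H a b -> H a' b' -> H (cmul a a') (cmul b b').
  move=> [u [v [uv ua vb]]] [u' [v' [uv' ua' vb']]].
  exists (fun n => cmul (u n) (u' n)), (fun n => cmul (v n) (v' n)).
  by split=> [n||]; [exact: GM | exact: seq_cvgM | exact: seq_cvgM].
have HS a b : H a b -> H (star a) (star b).
  move=> [u [v [uv ua vb]]]; exists (fun n => star (u n)), (fun n => star (v n)).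
  by split=> [n||]; [exact: GS | exact: seq_cvg_star | exact: seq_cvg_star].
have H0 b : H 0 b -> b = 0.
  move=> [u [v [uv u0 vb]]]; apply: (seq_cvg_unique vb) => e e0.
  have [N hN] := u0 e e0; exists N => n Nn.
  by have := hN n Nn; rewrite !subr0; apply: le_trans; exact: Gn.
have HU a b b' : H a b -> H a b' -> b = b'.
  move=> ab ab'; apply/eqP; rewrite -subr_eq0; apply/eqP/H0.
  by rewrite -(subrr a) -(scaleN1r a) -(scaleN1r b'); apply: HD => //; exact: HZ.
have HE a : exists b, H a b.
  have /choice[w hw] : forall n, exists w : K * L,
      G w.1 w.2 /\ nr (a - w.1) <= 2^-1 ^+ n.
    move=> n; have [|p [q pq]] := Gd a (2^-1 ^+ n); last by exists (p, q).
    by rewrite exprn_gt0 // invr_gt0.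
  pose u n := (w n).1; pose v n := (w n).2.
  have uv n : G (u n) (v n) by have [] := hw n.
  have h0 : 0 <= 2^-1 :> R by rewrite invr_ge0.
  have h1 : 2^-1 < 1 :> R by rewrite invf_lt1 // ltr1n.
  have ua : seq_cvg u a.
    move=> e e0; have [N hN] := expr_small h0 h1 e0; exists N => n Nn.
    by rewrite nrC (le_trans _ (hN n Nn)) //; have [] := hw n.
  have vv n : nr (v n.+1 - v n) <= 2 * 2^-1 ^+ n.
    apply: le_trans (_ : nr (u n.+1 - u n) <= _).
      by apply: Gn; rewrite -(scaleN1r (u n)) -(scaleN1r (v n)); apply: GD => //; exact: GZ.
    apply: le_trans (nr_tri a _ _) _.
    have [_] := hw n; have [_] := hw n.+1; rewrite -/(u _) nrC -/(u _) exprS.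
    have := exprn_ge0 n h0; lra.
  by have [b vb _] := geometric_cvg h0 h1 vv; exists b, u, v.
have [f hf] := choice HE.
unshelve eexists; first (exists f).
- by move=> x y; apply: (HU _ _ _ (hf _)); exact: HD.
- by move=> k x; apply: (HU _ _ _ (hf _)); exact: HZ.
- by apply: (HU _ _ _ (hf _)); exact: HG.
- by move=> x y; apply: (HU _ _ _ (hf _)); exact: HM.
- by move=> x; apply: (HU _ _ _ (hf _)); exact: HS.
- by move=> p q /HG; exact: HU (hf _).
Qed.

End StarHom.

(** * Closed subalgebras and directed unions *)

Section Subalgebra.
Context {R : realType}.

Record is_subalg (A : cstarAlgType R[i]) (P : A -> Prop) : Prop := {
  subalg1 : P cone;
  subalgD : forall x y, P x -> P y -> P (x + y);
  subalgZ : forall (k : R[i]) x, P x -> P (k *: x);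
  subalgM : forall x y, P x -> P y -> P (cmul x y);
  subalgS : forall x, P x -> P (star x)
}.

Definition seq_closed (A : normedModType R[i]) (P : A -> Prop) : Prop :=
  forall u l, (forall n, P (u n)) -> seq_cvg u l -> P l.

Definition staralg_of (A : cstarAlgType R[i]) : staralg R :=
  @StarAlg R A cmul cone star cmulA cmul1x cmulx1 cmulDl cmulDr
    cscalerAl cscalerAr starK starD starZ starM.

Section Build.
Context (A : cstarAlgType R[i]) (P : A -> Prop) (PS : is_subalg P) (PC : seq_closed P).

Lemma subalg_complete (u : nat -> A) : (forall n, P (u n)) ->
  (forall n, nr (u n.+1 - u n) <= 2^-1 ^+ n) ->
  exists2 l, P l & forall e : R, 0 < e -> exists N, forall n, (N <= n)%N ->
    nr (u n - l) <= e.
Proof.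
move=> Pu hu; have [||n|l ul _] := @geometric_cvg R A u 1 2^-1.
- by rewrite invr_ge0.
- by rewrite invf_lt1 // ltr1n.
- by rewrite mul1r.
- by exists l => //; exact: PC Pu ul.
Qed.

Definition subalg_seminorm : cseminorm (staralg_of A) :=
  @CSeminorm R (staralg_of A) P (@nr R A) (subalgD PS) (subalgZ PS)
    (subalg1 PS) (subalgM PS) (subalgS PS) (fun x y _ _ => nrD x y)
    (fun k x _ => nrZ k x) (fun x y _ _ => nrM x y) (fun x _ => nr_starM x)
    subalg_complete.

(** On [P] the seminorm is a norm, so each class is a singleton and the choice of a representative
    is the inclusion into [A]. *)
Definition csub : cstarAlgType R[i] := cstar_quot subalg_seminorm.

Lemma csub_repr (x : A) : P x -> crepr (@cproj _ _ subalg_seminorm x) = x.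
Proof.
move=> Px; apply/eqP; rewrite -subr_eq0; apply/eqP/nr_eq0.
exact: (crepr_cpi (S := subalg_seminorm)).
Qed.

Program Definition csub_val : star_hom csub A := {| star_hom_fun := fun q => crepr q |}.
Next Obligation.
move=> p q; have [x Px ->] := cproj_surj p; have [y Py ->] := cproj_surj q.
by rewrite -cprojD // !csub_repr //; exact: (subalgD PS).
Qed.
Next Obligation.
move=> k p; have [x Px ->] := cproj_surj p.
by rewrite -cprojZ // !csub_repr //; exact: (subalgZ PS).
Qed.
Next Obligation. by rewrite -cproj1 csub_repr //; exact: (subalg1 PS). Qed.
Next Obligation.
move=> p q; have [x Px ->] := cproj_surj p; have [y Py ->] := cproj_surj q.
by rewrite -cprojM // !csub_repr //; exact: (subalgM PS).
Qed.
Next Obligation.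
move=> p; have [x Px ->] := cproj_surj p.
by rewrite -cprojS // !csub_repr //; exact: (subalgS PS).
Qed.

Lemma csub_valP (q : csub) : P (csub_val q).
Proof. exact: (crepr_dom (S := subalg_seminorm) q). Qed.

Lemma csub_val_surj (x : A) : P x -> exists q, csub_val q = x.
Proof. by move=> Px; exists (@cproj _ _ subalg_seminorm x); exact: csub_repr. Qed.

Lemma nr_csub_val (q : csub) : nr (csub_val q) = nr q.
Proof.
by have [x Px ->] := cproj_surj q; rewrite /= csub_repr // nr_cproj.
Qed.

Lemma csub_val_inj : injective csub_val.
Proof.
by apply: star_hom_inj0 => q q0; apply: nr_eq0; rewrite -nr_csub_val q0 nr0.
Qed.

Lemma csub_com : cstar_commutative A -> cstar_commutative csub.
Proof. by move=> A_com x y; apply: csub_val_inj; rewrite !star_homM A_com. Qed.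

End Build.

Definition seq_closure (A : normedModType R[i]) (P : A -> Prop) (a : A) : Prop :=
  forall e : R, 0 < e -> exists b, P b /\ nr (a - b) <= e.

Lemma seq_closureP (A : normedModType R[i]) (P : A -> Prop) a :
  seq_closure P a <-> exists u, (forall n, P (u n)) /\ seq_cvg u a.
Proof.
split=> [Pa|[u [Pu ua]] e e0]; last first.
  by have [N hN] := ua e e0; exists (u N); split => //; rewrite nrC hN.
have /choice[u hu] : forall n, exists b, P b /\ nr (a - b) <= 2^-1 ^+ n.
  by move=> n; apply: Pa; rewrite exprn_gt0 // invr_gt0.
exists u; split=> [n|e e0]; first by have [] := hu n.
have [||N hN] := @expr_small R 2^-1 e _ _ e0.
- by rewrite invr_ge0.
- by rewrite invf_lt1 // ltr1n.
exists N => n Nn; rewrite nrC; have [_] := hu n; move/le_trans; apply.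
exact: hN.
Qed.

Lemma seq_closure_sub (A : normedModType R[i]) (P : A -> Prop) a :
  P a -> seq_closure P a.
Proof. by move=> Pa e e0; exists a; rewrite subrr nr0 ltW. Qed.

Lemma seq_closed_closure (A : normedModType R[i]) (P : A -> Prop) :
  seq_closed (seq_closure P).
Proof.
move=> u l Pu ul e e0; have [|N hN] := ul (e / 2); first by rewrite divr_gt0.
have [|b [Pb ub]] := Pu N (e / 2); first by rewrite divr_gt0.
exists b; split=> //; apply: le_trans (nr_tri (u N) _ _) _.
by rewrite [leRHS](splitr e); apply: lerD => //; rewrite nrC hN.
Qed.

Lemma closure_subalg (A : cstarAlgType R[i]) (P : A -> Prop) :
  is_subalg P -> is_subalg (seq_closure P).
Proof.
move=> PS; split.
- by apply: seq_closure_sub; exact: (subalg1 PS).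
- move=> x y /seq_closureP[u [Pu ux]] /seq_closureP[v [Pv vy]].
  apply/seq_closureP; exists (fun n => u n + v n).
  by split=> [n|]; [exact: (subalgD PS) | exact: seq_cvgD].
- move=> k x /seq_closureP[u [Pu ux]]; apply/seq_closureP; exists (fun n => k *: u n).
  by split=> [n|]; [exact: (subalgZ PS) | exact: seq_cvgZ].
- move=> x y /seq_closureP[u [Pu ux]] /seq_closureP[v [Pv vy]].
  apply/seq_closureP; exists (fun n => cmul (u n) (v n)).
  by split=> [n|]; [exact: (subalgM PS) | exact: seq_cvgM].
- move=> x /seq_closureP[u [Pu ux]]; apply/seq_closureP; exists (fun n => star (u n)).
  by split=> [n|]; [exact: (subalgS PS) | exact: seq_cvg_star].
Qed.

Lemma directed_union_subalg (A : cstarAlgType R[i]) (d : Order.disp_t)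
    (I : porderType d) (P : I -> A -> Prop) :
  directed I -> (forall i, is_subalg (P i)) ->
  (forall i j x, (i <= j)%O -> P i x -> P j x) ->
  is_subalg (fun x => exists i, P i x).
Proof.
move=> [[i0] dirI] PS mono; split.
- by exists i0; exact: (subalg1 (PS i0)).
- move=> x y [i ix] [j jy]; have [k [ik jk]] := dirI i j; exists k.
  by apply: (subalgD (PS k)); [exact: mono ix | exact: mono jy].
- by move=> k x [i ix]; exists i; exact: (subalgZ (PS i)).
- move=> x y [i ix] [j jy]; have [k [ik jk]] := dirI i j; exists k.
  by apply: (subalgM (PS k)); [exact: mono ix | exact: mono jy].
- by move=> x [i ix]; exists i; exact: (subalgS (PS i)).
Qed.

End Subalgebra.

#[local] Obligation Tactic := idtac.

(** * Colimits in full subcategories, and factorization through a stage *)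

Section FullSubcategory.
Context {J C : category} {Q : C -> Prop}.

Program Definition corestrict (F : functor J C) (QF : forall j, Q (F j)) :
    functor J (full_subcat Q) :=
  {| fob := fun j => exist Q (F j) (QF j) : full_subcat Q;
     fmap := fun a b f => fmap F f |}.
Next Obligation. by move=> F QF a; exact: fmap1. Qed.
Next Obligation. by move=> F QF a b c g f; exact: fmapM. Qed.

Program Definition corestrict_cocone (F : functor J C) (QF : forall j, Q (F j))
    (K : cocone F) (QK : Q (apex K)) : cocone (corestrict QF) :=
  {| apex := exist Q (apex K) QK : full_subcat Q;
     leg := fun j => leg K j |}.
Next Obligation. by move=> F QF K QK i j f; exact: (legP K f). Qed.

(** A cocone in the full subcategory is a cocone in [C], so the universal property restricts. One
    computation of a colimit thus serves both categories of the theorem. *)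
Lemma corestrict_colimit (F : functor J C) (QF : forall j, Q (F j))
    (K : cocone F) (QK : Q (apex K)) :
  is_colimit K -> is_colimit (corestrict_cocone QF QK).
Proof.
move=> colK L.
pose L' : cocone F := {| apex := sval (apex L) : C; leg := fun j => leg L j;
  legP := fun i j f => legP L f |}.
exact: (colK L').
Qed.

Program Definition forget (F : functor J (full_subcat Q)) : functor J C :=
  {| fob := fun j => sval (F j); fmap := fun a b f => fmap F f |}.
Next Obligation. by move=> F a; exact: (fmap1 F a). Qed.
Next Obligation. by move=> F a b c g f; exact: (fmapM F g f). Qed.

End FullSubcategory.

(** The preserved colimit is tested against the set [Prop]: the constant [True] and the predicate of
    factoring through some stage agree on all legs, so uniqueness of the mediating map makes them
    equal. *)
Lemma aleph0_factor (C : category) (M : morphism_class C) (c : C)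
    (d : Order.disp_t) (I : porderType d) (F : functor (poset_cat I) C)
    (K : cocone F) :
  aleph0_generated M c -> directed I ->
  (forall (i j : poset_cat I) (ij : hom i j), M _ _ (fmap F ij)) ->
  is_colimit K ->
  forall f : hom c (apex K), exists i (g : hom c (F i)), f = comp (leg K i) g.
Proof.
move=> cM dirI FM colK f.
pose L : cocone (functor_comp (hom_functor c) F) :=
  {| apex := Prop : type_cat; leg := fun j => fun=> True : Prop;
     legP := fun i j f => erefl |}.
have [u [_ uU]] := cM d I F dirI FM K colK L.
have e1 : u = fun=> True by apply: uU => j; apply/funext.
have : u f.
  by rewrite e1.
have -> : u = fun f => exists i (g : hom c (F i)), f = comp (leg K i) g; last by [].
apply: uU => j; apply/funext => g /=; apply/propext; split=> // _.
by exists j, g.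
Qed.

(** * The closed union of a directed family of subalgebras as a colimit *)

Section DirectedUnion.
Context {R : realType} {B : cstarAlgType R[i]} {d : Order.disp_t} {I : porderType d}.
Context (P : I -> B -> Prop) (dirI : directed I).
Context (PS : forall i, is_subalg (P i)) (PC : forall i, seq_closed (P i)).
Context (mono : forall i j x, (i <= j)%O -> P i x -> P j x).

Let U : B -> Prop := seq_closure (fun x => exists i, P i x).
Let US : is_subalg U := closure_subalg (directed_union_subalg dirI PS mono).
Let UC : seq_closed U := @seq_closed_closure R B _.
Let D i := csub (PS i) (@PC i).
Let val i : star_hom (D i) B := csub_val (PS i) (@PC i).
Let K := csub US UC.
Let valK : star_hom K B := csub_val US UC.

Lemma union_inc_ex i j (ij : (i <= j)%O) :
  exists g : star_hom (D i) (D j), forall x, val j (g x) = val i x.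
Proof.
apply: star_hom_lift; first exact: csub_val_inj.
move=> x; apply: csub_val_surj; apply: mono ij _; exact: csub_valP.
Qed.

Definition union_inc i j ij := sval (cid (@union_inc_ex i j ij)).

Lemma union_incP i j ij x : val j (@union_inc i j ij x) = val i x.
Proof. by rewrite /union_inc; case: cid. Qed.

Lemma union_leg_ex i : exists g : star_hom (D i) K, forall x, valK (g x) = val i x.
Proof.
apply: star_hom_lift; first exact: csub_val_inj.
move=> x; apply: csub_val_surj; apply: seq_closure_sub; exists i; exact: csub_valP.
Qed.

Definition union_leg i := sval (cid (@union_leg_ex i)).

Lemma union_legP i x : valK (union_leg i x) = val i x.
Proof. by rewrite /union_leg; case: cid. Qed.

Program Definition union_functor : functor (poset_cat I) (cstar_cat R[i]) :=
  {| fob := fun i : poset_cat I => D i : cstar_cat R[i];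
     fmap := fun (i j : poset_cat I) (ij : hom i j) => @union_inc i j ij |}.
Next Obligation.
move=> i; apply: star_hom_ext => x; apply: (csub_val_inj (PS := PS i)).
exact: union_incP.
Qed.
Next Obligation.
move=> i j k jk ij; apply: star_hom_ext => x; apply: (csub_val_inj (PS := PS k)).
by rewrite [LHS]union_incP [RHS]union_incP union_incP.
Qed.

Program Definition union_cocone : cocone union_functor :=
  {| apex := K : cstar_cat R[i]; leg := fun i : poset_cat I => union_leg i |}.
Next Obligation.
move=> i j ij; apply: star_hom_ext => x; apply: (csub_val_inj (PS := US)).
by rewrite [LHS]union_legP [RHS]union_legP union_incP.
Qed.

Lemma union_leg_dense (p : K) (e : R) : 0 < e ->
  exists i x, nr (p - union_leg i x) <= e.
Proof.
move=> e0; have [b [[i Pb] pb]] := csub_valP p e e0.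
have [x xb] := csub_val_surj (PS i) (@PC i) Pb.
by exists i, x; rewrite -(nr_csub_val (PS := US)) star_homB [X in _ - X]union_legP xb.
Qed.

Lemma union_colimit : is_colimit union_cocone.
Proof.
move=> L; case: dirI => [[i0] dI].
pose lL i : star_hom (D i) (apex L) := leg L i.
have lLP i j (ij : (i <= j)%O) x : lL j (union_inc ij x) = lL i x.
  by rewrite /lL -(legP L (ij : @hom (poset_cat I) i j)).
have lKP i j (ij : (i <= j)%O) x : union_leg j (union_inc ij x) = union_leg i x.
  by apply: (csub_val_inj (PS := US)); rewrite !union_legP union_incP.
pose G p q := exists i x, p = union_leg i x /\ q = lL i x.
have common p q p' q' : G p q -> G p' q' -> exists k x x',
    [/\ p = union_leg k x, q = lL k x, p' = union_leg k x' & q' = lL k x'].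
  move=> [i [x [-> ->]]] [j [y [-> ->]]]; have [k [ik jk]] := dI i j.
  by exists k, (union_inc ik x), (union_inc jk y); rewrite !lKP !lLP.
have [||||||p e e0|f fG] := @graph_extension R K (apex L) G.
- by exists i0, cone; rewrite !star_hom1.
- move=> p q p' q' pq pq'; have [k [x [x' [-> -> -> ->]]]] := common _ _ _ _ pq pq'.
  by exists k, (x + x'); rewrite !star_homD.
- by move=> k p q [i [x [-> ->]]]; exists i, (k *: x); rewrite !star_homZ.
- move=> p q p' q' pq pq'; have [k [x [x' [-> -> -> ->]]]] := common _ _ _ _ pq pq'.
  by exists k, (cmul x x'); rewrite !star_homM.
- by move=> p q [i [x [-> ->]]]; exists i, (star x); rewrite !star_hom_star.
(* [lL i] is contractive for the norm of [D i]; this transfers to [K] because both norms are that of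
   [B]. *)
- move=> p q [i [x [-> ->]]]; rewrite (le_trans (star_hom_contract _ _)) //.
  by rewrite -(nr_csub_val (PS := PS i)) -[csub_val _ _ x]union_legP nr_csub_val.
- have [i [x px]] := union_leg_dense p e0; exists (union_leg i x), (lL i x).
  by split => //; exists i, x.
exists f; split.
  by move=> i; apply: star_hom_ext => x; apply: fG; exists i, x.
move=> g gL; apply: star_hom_ext => p.
apply/eqP; rewrite -subr_eq0; apply/eqP/nr_le0 => e e0.
have [|i [x px]] := @union_leg_dense p (e / 2); first by rewrite divr_gt0.
have gx : g (union_leg i x) = f (union_leg i x).
  rewrite (fG _ (lL i x)); last by exists i, x.
  by rewrite -[RHS]/(leg L i x) -gL.
apply: le_trans (nr_tri (f (union_leg i x)) _ _) _.
rewrite [leRHS](splitr e) lerD //.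
  by rewrite -star_homB (le_trans (star_hom_contract _ _)).
by rewrite -gx -star_homB (le_trans (star_hom_contract _ _)) // nrC.
Qed.

Lemma union_inc_inj i j ij : injective (@union_inc i j ij).
Proof.
move=> x y xy; apply: (csub_val_inj (PS := PS i)).
by have := congr1 (val j) xy; rewrite !union_incP.
Qed.

Section Range.
Context {A : cstarAlgType R[i]} (f : star_hom A B).
Context (fU : forall a, U (f a)).

Lemma union_lift_range (g : star_hom A K) :
  (forall a, valK (g a) = f a) ->
  (exists i (h : star_hom A (D i)), forall a, g a = union_leg i (h a)) ->
  exists i, forall a, P i (f a).
Proof.
move=> gf [i [h hg]]; exists i => a.
by rewrite -gf hg [X in P i X]union_legP; exact: csub_valP.
Qed.

(** The form in which generation is used. The closure of the union may be smaller than [B], so [f]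
    is first lifted to that closure, which is the apex of the colimit. *)
Lemma aleph0_range :
  aleph0_generated (@cstar_embedding R[i]) (A : cstar_cat R[i]) ->
  exists i, forall a, P i (f a).
Proof.
move=> Agen.
have [|g gf] := star_hom_lift (csub_val_inj (PS := US) (PC := UC)) (f := f).
  by move=> a; exact: csub_val_surj.
apply: (union_lift_range gf).
have [|i [h gh]] := aleph0_factor Agen dirI _ union_colimit (g : @hom (cstar_cat R[i]) A K).
  by move=> i j ij; exact: union_inc_inj.
by exists i, h => a; rewrite gh.
Qed.

(** Subalgebras of the commutative [B] are commutative, so the same colimit lies in the full
    subcategory. *)
Lemma com_aleph0_range (A_com : cstar_commutative A) (B_com : cstar_commutative B) :
  aleph0_generated (@com_cstar_embedding R[i]) (exist _ A A_com : com_cstar_cat R[i]) ->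
  exists i, forall a, P i (f a).
Proof.
move=> Agen.
have [|g gf] := star_hom_lift (csub_val_inj (PS := US) (PC := UC)) (f := f).
  by move=> a; exact: csub_val_surj.
apply: (union_lift_range gf).
have DC i : cstar_commutative (union_functor i) by exact: csub_com.
have KC : cstar_commutative (apex union_cocone) by exact: csub_com.
have [|i [h gh]] := aleph0_factor Agen dirI _ (@corestrict_colimit _ _ _ _ DC _ KC union_colimit) g.
  by move=> i j ij; exact: union_inc_inj.
by exists i, h => a; rewrite gh.
Qed.

End Range.
End DirectedUnion.

(** * Reduced products *)

Definition dprod (J : Type) (F : J -> Type) : Type := forall j, F j.

HB.instance Definition _ (J : Type) (F : J -> Type) := gen_eqMixin (dprod F).
HB.instance Definition _ (J : Type) (F : J -> Type) := gen_choiceMixin (dprod F).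

Section DependentProduct.
Context {K : pzRingType} (J : Type) (F : J -> lmodType K).
Local Notation T := (dprod F).
Implicit Types f g h : T.

Let add f g : T := fun j => f j + g j.
Let opp f : T := fun j => - f j.
Let zero : T := fun=> 0.
Let scale (k : K) f : T := fun j => k *: f j.

Let addA : associative add.
Proof. by move=> f g h; apply: functional_extensionality_dep => j; rewrite /add addrA. Qed.
Let addC : commutative add.
Proof. by move=> f g; apply: functional_extensionality_dep => j; rewrite /add addrC. Qed.
Let add0 : left_id zero add.
Proof. by move=> f; apply: functional_extensionality_dep => j; rewrite /add add0r. Qed.
Let addN : left_inverse zero opp add.
Proof. by move=> f; apply: functional_extensionality_dep => j; rewrite /add addNr. Qed.

HB.instance Definition _ := GRing.isZmodule.Build T addA addC add0 addN.

Let scaleA a b f : scale a (scale b f) = scale (a * b) f.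
Proof. by apply: functional_extensionality_dep => j; rewrite /scale scalerA. Qed.
Let scale1 : left_id 1 scale.
Proof. by move=> f; apply: functional_extensionality_dep => j; rewrite /scale scale1r. Qed.
Let scaleDr : right_distributive scale +%R.
Proof. by move=> a f g; apply: functional_extensionality_dep => j; rewrite /scale scalerDr. Qed.
Let scaleDl f : {morph scale^~ f : a b / a + b}.
Proof. by move=> a b; apply: functional_extensionality_dep => j; rewrite /scale scalerDl. Qed.

HB.instance Definition _ :=
  GRing.Zmodule_isLmodule.Build K T scaleA scale1 scaleDr scaleDl.

End DependentProduct.

(* [FF] is the filter along which the norm is a limsup: the filter [{setT}]
   gives the l^oo product, the filter of tails of a directed set the algebra
   in which a directed system has its colimit. *)
Section ReducedProduct.
Context {R : realType} {J : Type} (F : J -> cstarAlgType R[i]).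
Context (FF : set_system J) {FFF : Filter FF}.

Local Notation T := (dprod F).
Implicit Types f g h : T.

Let mul f g : T := fun j => cmul (f j) (g j).
Let one : T := fun=> cone.
Let st f : T := fun j => star (f j).

Local Ltac ext := do ?move=> ?; apply: functional_extensionality_dep => j.

Program Definition dprod_staralg : staralg R :=
  @StarAlg R T mul one st _ _ _ _ _ _ _ _ _ _ _.
Next Obligation. by ext; exact: cmulA. Qed.
Next Obligation. by ext; exact: cmul1x. Qed.
Next Obligation. by ext; exact: cmulx1. Qed.
Next Obligation. by ext; exact: cmulDl. Qed.
Next Obligation. by ext; exact: cmulDr. Qed.
Next Obligation. by ext; exact: cscalerAl. Qed.
Next Obligation. by ext; exact: cscalerAr. Qed.
Next Obligation. by ext; exact: starK. Qed.
Next Obligation. by ext; exact: starD. Qed.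
Next Obligation. by ext; exact: starZ. Qed.
Next Obligation. by ext; exact: starM. Qed.

(** The condition [0 <= c] keeps the infimum meaningful when [J] is empty, where every [c] would be
    a bound; the empty product is then the zero algebra. *)
Definition rbound f (c : R) : Prop := 0 <= c /\ FF (fun j => nr (f j) <= c).

Definition rdom f : Prop := exists c : R, forall j, nr (f j) <= c.

Definition rnorm f : R := inf [set c | rbound f c]%classic.

Lemma rdom_bound f : rdom f -> exists c, rbound f c.
Proof.
move=> [c fc]; exists `|c|; split=> //; apply: filterE => j.
by rewrite (le_trans (fc j)) // ler_norm.
Qed.

Lemma rnorm_le f c : rbound f c -> rnorm f <= c.
Proof.
by move=> fc; apply: ge_inf => //; exists 0 => b [].
Qed.

(** The factor [a] allows a product of two norms to be bounded by taking one infimum at a time. *)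
Lemma le_rnorm f a c : rdom f -> 0 <= a -> (forall b, rbound f b -> c <= a * b) ->
  c <= a * rnorm f.
Proof.
move=> /rdom_bound[b0 fb0]; rewrite le_eqVlt => /predU1P[<-|a0] H.
  by rewrite mul0r; have := H _ fb0; rewrite mul0r.
rewrite mulrC -ler_pdivrMr //; apply: lb_le_inf; first by exists b0.
by move=> b fb; rewrite ler_pdivrMr // mulrC H.
Qed.

Lemma rnorm_ge0 f : rdom f -> 0 <= rnorm f.
Proof.
by move=> df; rewrite -[rnorm f]mul1r le_rnorm // => b []; rewrite mul1r.
Qed.

Lemma rnorm_bound f c : rdom f -> rnorm f < c -> rbound f c.
Proof.
move=> df fc; have [b0 fb0] := rdom_bound df.
have [|b fb bc] := @inf_lt _ [set c | rbound f c]%classic c _ fc; first by exists b0.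
case: fb => b_ge0 fb; split; first by rewrite (le_trans b_ge0) // ltW.
by apply: filterS fb => j /le_trans; apply; exact: ltW.
Qed.

Lemma rdomD f g : rdom f -> rdom g -> rdom (f + g).
Proof.
move=> [c fc] [d gd]; exists (c + d) => j.
by rewrite (le_trans (nrD _ _)) // lerD.
Qed.

Lemma rdomZ (k : R[i]) f : rdom f -> rdom (k *: f).
Proof.
by move=> [c fc]; exists (cmod k * c) => j; rewrite nrZ ler_wpM2l // cmod_ge0.
Qed.

Lemma rdom1 : rdom one.
Proof. by exists 1 => j; exact: nr1_le. Qed.

Lemma rdomM f g : rdom f -> rdom g -> rdom (mul f g).
Proof.
move=> [c fc] [d gd]; exists (c * d) => j.
by rewrite (le_trans (nrM _ _)) // ler_pM // nr_ge0.
Qed.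

Lemma rdomS f : rdom f -> rdom (st f).
Proof. by move=> [c fc]; exists c => j; rewrite nr_star. Qed.

Lemma rnormD f g : rdom f -> rdom g -> rnorm (f + g) <= rnorm f + rnorm g.
Proof.
move=> df dg; rewrite -lerBlDr -[rnorm f]mul1r; apply: le_rnorm => // b [b0 fb].
rewrite mul1r lerBlDr -lerBlDl -[rnorm g]mul1r; apply: le_rnorm => // c [c0 gc].
rewrite mul1r lerBlDl; apply: rnorm_le; split; first exact: addr_ge0.
apply: filterS (filterI fb gc) => j [fjb gjc].
by rewrite (le_trans (nrD _ _)) // lerD.
Qed.

Lemma rnormZ_le (k : R[i]) f : rdom f -> rnorm (k *: f) <= cmod k * rnorm f.
Proof.
move=> df; apply: le_rnorm => //; first exact: cmod_ge0.
move=> b [b0 fb]; apply: rnorm_le; split; first by rewrite mulr_ge0 // cmod_ge0.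
by apply: filterS fb => j fj; rewrite nrZ ler_wpM2l // cmod_ge0.
Qed.

Lemma rnormZ (k : R[i]) f : rdom f -> rnorm (k *: f) = cmod k * rnorm f.
Proof.
move=> df; apply/le_anti; rewrite rnormZ_le //=.
have [->|k0] := eqVneq k 0.
  by rewrite cmod0 mul0r rnorm_ge0 //; exact: rdomZ.
have kp : 0 < cmod k.
  by rewrite lt_def cmod_ge0 andbT; apply/eqP => /cmod_eq0; exact/eqP.
rewrite -{1}[f](scalerK k0) (le_trans (ler_wpM2l (ltW kp) (rnormZ_le _ _))) //.
  exact: rdomZ.
by rewrite mulrA -cmodM mulfV // cmod1 mul1r.
Qed.

Lemma rnormM f g : rdom f -> rdom g -> rnorm (mul f g) <= rnorm f * rnorm g.
Proof.
move=> df dg; rewrite mulrC; apply: le_rnorm => //; first exact: rnorm_ge0.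
move=> b [b0 fb]; rewrite mulrC; apply: le_rnorm => // c [c0 gc].
apply: rnorm_le; split; first exact: mulr_ge0.
apply: filterS (filterI fb gc) => j [fjb gjc].
by rewrite (le_trans (nrM _ _)) // ler_pM // nr_ge0.
Qed.

Lemma rnormS f : rdom f -> rnorm (mul (st f) f) = rnorm f ^+ 2.
Proof.
move=> df; have ds := rdomS df; apply/le_anti/andP; split.
  have sf : rnorm (st f) = rnorm f.
    by congr inf; apply/seteqP; split=> c [c0 fc]; split=> //; apply: filterS fc => j;
      rewrite nr_star.
  by rewrite expr2 -{1}sf rnormM.
(* If [b] bounds [f^* f] along the filter, then [sqrt b] bounds [f]. *)
rewrite -[leRHS]mul1r; apply: le_rnorm => //; first exact: rdomM.
move=> b [b0 fb]; rewrite mul1r -(sqr_sqrtr b0) ler_sqr ?nnegrE ?sqrtr_ge0 ?rnorm_ge0 //.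
apply: rnorm_le; split; first exact: sqrtr_ge0.
apply: filterS fb => j; rewrite nr_starM => fj.
by rewrite -ler_sqr ?nnegrE ?sqrtr_ge0 ?nr_ge0 // sqr_sqrtr.
Qed.

(* Truncating each increment to a set of [FF] on which it is uniformly small
   turns a fast Cauchy sequence for the limsup into a uniformly convergent one
   with the same classes. *)
Lemma rnorm_complete (u : nat -> T) : (forall n, rdom (u n)) ->
    (forall n, rnorm (u n.+1 - u n) <= 2^-1 ^+ n) ->
  exists2 l, rdom l & forall e : R, 0 < e -> exists N, forall n, (N <= n)%N ->
    rnorm (u n - l) <= e.
Proof.
move=> du hu.
have h0 : 0 <= 2^-1 :> R by rewrite invr_ge0.
have h1 : 2^-1 < 1 :> R by rewrite invf_lt1 // ltr1n.
have hp n : 0 < 2^-1 ^+ n :> R by rewrite exprn_gt0 // invr_gt0.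
pose small n j := nr (u n.+1 j - u n j) <= 2 * 2^-1 ^+ n.
pose V n j := forall m, (m <= n)%N -> small m j.
have FV n : FF (V n).
  have Fsmall m : FF (small m).
    have db : rdom (u m.+1 - u m).
      by rewrite -(scaleN1r (u m)); apply: rdomD => //; exact: rdomZ.
    have [|_ //] := @rnorm_bound _ (2 * 2^-1 ^+ m) db.
    by rewrite (le_lt_trans (hu m)) // mulrDl mul1r ltrDl.
  elim: n => [|n IH].
    by apply: filterS (Fsmall 0%N) => j sj [|m].
  apply: filterS (filterI IH (Fsmall n.+1)) => j [Vj sj] m.
  by rewrite leq_eqVlt ltnS => /predU1P[->//|]; exact: Vj.
pose w := fix w n j : F j := if n is m.+1 then
   w m j + (if `[< V m j >] then u m.+1 j - u m j else 0) else u 0%N j.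
have wS n j : nr (w n.+1 j - w n j) <= 2 * 2^-1 ^+ n.
  rewrite /= addrAC subrr add0r; case: asboolP => [Vj|_]; first exact: Vj.
  by rewrite nr0 mulr_ge0 // ltW.
have wu n j : V n j -> w n j = u n j.
  elim: n => [//|n IH Vj /=].
  have Vn : V n j by move=> m mn; apply: Vj; exact: leqW.
  by rewrite asboolT // IH // addrC subrK.
have lim j : exists l : F j, forall n, nr (l - w n j) <= 4 * 2^-1 ^+ n.
  have [l wl _] := geometric_cvg h0 h1 (fun n => wS n j).
  exists l => n.
  have [|l' wl' H] := @geometric_cvg _ _ (fun m => w (n + m)%N j) (2 * 2^-1 ^+ n) _ h0 h1.
    by move=> m; rewrite addnS (le_trans (wS _ _)) // exprD mulrA.
  have -> : l = l'.
    apply: seq_cvg_unique wl' => e e0; have [N hN] := wl e e0.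
    by exists N => m Nm; apply: hN; rewrite (leq_trans Nm) // leq_addl.
  rewrite addn0 in H; apply: le_trans H _; rewrite le_eqVlt; apply/orP; left.
  by apply/eqP; field.
pose l : T := fun j => sval (cid (lim j)).
have hl j n : nr (l j - w n j) <= 4 * 2^-1 ^+ n by exact: (svalP (cid (lim j))).
have ul n : rbound (u n - l) (4 * 2^-1 ^+ n).
  split; first by rewrite mulr_ge0 // ltW.
  by apply: filterS (FV n) => j Vj; rewrite -[X in nr X]/(u n j - l j) -wu // nrC.
exists l.
  have [c hc] := du 0%N; exists (4 + c) => j.
  rewrite -[l j](subrK (u 0%N j)) (le_trans (nrD _ _)) // lerD //.
  by have := hl j 0%N; rewrite expr0 mulr1.
move=> e e0; have [|N hN] := expr_small h0 h1 (_ : 0 < e / 4); first by rewrite divr_gt0.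
exists N => n Nn; rewrite (le_trans (rnorm_le (ul n))) //.
by rewrite mulrC -ler_pdivlMr // hN.
Qed.

Definition rseminorm : cseminorm dprod_staralg :=
  @CSeminorm R dprod_staralg rdom rnorm rdomD rdomZ rdom1 rdomM rdomS
    rnormD rnormZ rnormM rnormS rnorm_complete.

Definition rprod : cstarAlgType R[i] := cstar_quot rseminorm.

Lemma rprod_com : (forall j, cstar_commutative (F j)) -> cstar_commutative rprod.
Proof.
move=> FC p q; have [f df ->] := cproj_surj p; have [g dg ->] := cproj_surj q.
rewrite -!cprojM //; congr cproj; apply: functional_extensionality_dep => j.
exact: FC.
Qed.

Lemma rproj_eq f g : rdom f -> rdom g -> FF (fun j => f j = g j) ->
  cproj rseminorm f = cproj rseminorm g.
Proof.
move=> df dg fg; apply/cprojP => //; apply/le_anti/andP; split.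
  apply: rnorm_le; split=> //; apply: filterS fg => j fgj.
  by rewrite -[X in nr X]/(f j - g j) fgj subrr nr0.
by apply: rnorm_ge0; rewrite -(scaleN1r g); apply: rdomD => //; exact: rdomZ.
Qed.

End ReducedProduct.
Arguments rseminorm {R J} F FF {FFF}.
Arguments rprod {R J} F FF {FFF}.
Arguments rnorm_bound {R J F} FF {FFF} f c.

Section Product.
Context {R : realType} {J : Type} (F : J -> cstarAlgType R[i]).

Definition linf : cstarAlgType R[i] := rprod F (globally [set: J]%classic).

Let S := rseminorm F (globally [set: J]%classic).

(** Norm zero for the trivial filter means zero at every index, so classes are singletons and
    evaluation can be defined through [crepr]. *)
Lemma crepr_linf (f : dprod F) : rdom f -> crepr (@cproj _ _ S f) = f.
Proof.
move=> df; have H : rnorm (globally [set: J]%classic) (crepr (@cproj _ _ S f) - f) = 0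
  := crepr_cpi (S := S) df; set g := crepr _ in H *.
have dg : rdom g := crepr_dom (S := S) _.
apply: functional_extensionality_dep => j; apply/eqP; rewrite -subr_eq0; apply/eqP/nr_le0 => e e0.
have [||_] := @rnorm_bound R J F (globally [set: J]%classic) _ (g - f) e.
- by rewrite -(scaleN1r f); apply: rdomD => //; exact: rdomZ.
- by rewrite H.
- exact.
Qed.

Program Definition linf_ev (j : J) : star_hom linf (F j) :=
  {| star_hom_fun := fun q => (crepr q : dprod F) j |}.
Next Obligation.
move=> j p q; have [f df ->] := cproj_surj p; have [g dg ->] := cproj_surj q.
by rewrite -cprojD // !crepr_linf //; exact: rdomD.
Qed.
Next Obligation.
move=> j k p; have [f df ->] := cproj_surj p.
by rewrite -cprojZ // !crepr_linf //; exact: rdomZ.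
Qed.
Next Obligation. by move=> j; rewrite -cproj1 crepr_linf //; exact: rdom1. Qed.
Next Obligation.
move=> j p q; have [f df ->] := cproj_surj p; have [g dg ->] := cproj_surj q.
by rewrite -cprojM // !crepr_linf //; exact: rdomM.
Qed.
Next Obligation.
move=> j p; have [f df ->] := cproj_surj p.
by rewrite -cprojS // !crepr_linf //; exact: rdomS.
Qed.

Lemma linf_tuple (f : forall j, F j) (c : R) : (forall j, nr (f j) <= c) ->
  exists x, forall j, linf_ev j x = f j.
Proof.
move=> fc; exists (@cproj _ _ S (f : dprod F)) => j.
by rewrite /linf_ev /= crepr_linf //; exists c.
Qed.

Lemma nr_linf (x : linf) (c : R) : 0 <= c -> (forall j, nr (linf_ev j x) <= c) ->
  nr x <= c.
Proof.
have [f df ->] := cproj_surj x => c0 H; rewrite nr_cproj //.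
by apply: rnorm_le; split=> // j _; have := H j; rewrite /linf_ev /= crepr_linf.
Qed.

Lemma linf_ext (x y : linf) : (forall j, linf_ev j x = linf_ev j y) -> x = y.
Proof.
move=> xy; apply/eqP; rewrite -subr_eq0; apply/eqP/nr_le0 => e e0.
apply: nr_linf (ltW e0) _ => j; rewrite star_homB xy subrr nr0; exact: ltW.
Qed.

Lemma linf_pair (A : cstarAlgType R[i]) (f : forall j, star_hom A (F j)) :
  exists g : star_hom A linf, forall a j, linf_ev j (g a) = f j a.
Proof.
have /choice[g hg] : forall a, exists x, forall j, linf_ev j x = f j a.
  by move=> a; apply: (@linf_tuple _ (nr a)) => j; exact: star_hom_contract.
unshelve eexists; first (exists g).
- by move=> x y; apply: linf_ext => j; rewrite !(star_homD, hg).
- by move=> k x; apply: linf_ext => j; rewrite !(star_homZ, hg).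
- by apply: linf_ext => j; rewrite !(star_hom1, hg).
- by move=> x y; apply: linf_ext => j; rewrite !(star_homM, hg).
- by move=> x; apply: linf_ext => j; rewrite !(star_hom_star, hg).
- exact: hg.
Qed.

Lemma linf_com : (forall j, cstar_commutative (F j)) -> cstar_commutative linf.
Proof. exact: rprod_com. Qed.

End Product.
Arguments linf_ev {R J F} j.

(** * A concrete cocone under a directed system *)

Section DirectedSystem.
Context {R : realType} {d : Order.disp_t} {I : porderType d}.
Context (F : functor (poset_cat I) (cstar_cat R[i])) (dirI : directed I).

Let Fc (i : I) : cstarAlgType R[i] := F i.
Let phi (i j : I) (ij : (i <= j)%O) : star_hom (Fc i) (Fc j) :=
  @fmap _ _ F i j (ij : @hom (poset_cat I) i j).

Lemma tails_filter :
  Filter (fun U : I -> Prop => exists i, forall j, (i <= j)%O -> U j).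
Proof.
have [[i0] dI] := dirI; split; first by exists i0.
  move=> U V [i Ui] [j Vj]; have [k [ik jk]] := dI i j; exists k => l kl.
  by split; [exact: Ui (le_trans ik kl) | exact: Vj (le_trans jk kl)].
by move=> U V UV [i Ui]; exists i => j /Ui /UV.
Qed.

(** An abstract colimit maps contractively to this cocone, so the second property carries over to
    it: a norm that is small in the colimit is already small at some stage. *)
Theorem directed_system_cocone :
  exists (L : cstarAlgType R[i]) (lam : forall i : I, star_hom (F i) L), [/\
    forall (i j : I) (ij : (i <= j)%O) (x : Fc i), lam j (phi ij x) = lam i x,
    forall (i : I) (x : Fc i) (c : R), nr (lam i x) < c ->
      exists (j : I) (ij : (i <= j)%O), nr (phi ij x) <= c &
    (forall i : I, cstar_commutative (Fc i)) -> cstar_commutative L].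
Proof.
have FF := tails_filter; set T := fun U : I -> Prop => _ in FF.
pose S := @rseminorm R I Fc T FF.
(* The images of [x] at the stages above [i], and 0 at the others, which the norm along tails does
   not see. *)
pose ext (i : I) (x : Fc i) : dprod (fun j => Fc j : Type) := fun j =>
  match @idP (i <= j)%O with ReflectT ij => phi ij x | ReflectF _ => 0 end.
have extE i x j (ij : (i <= j)%O) : ext i x j = phi ij x.
  rewrite /ext; case: {-}_ / idP => // ij'; congr (phi _ x); exact: bool_irrelevance.
have dom i x : rdom (ext i x).
  exists (nr x) => j; rewrite /ext; case: {-}_ / idP => [ij|_].
    exact: star_hom_contract.
  by rewrite nr0 nr_ge0.
have eqT i f g : rdom f -> rdom g -> (forall j (ij : (i <= j)%O), f j = g j) ->
    cproj S f = cproj S g.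
  by move=> df dg fg; apply: rproj_eq => //; exists i.
pose lam0 i x := cproj S (ext i x).
have lamP i : exists l : star_hom (Fc i) (@rprod R I Fc T FF), forall x, l x = lam0 i x.
  unshelve eexists; first (exists (lam0 i)).
  - move=> x y; rewrite /lam0 -cprojD; [|exact: dom|exact: dom].
    apply: (eqT i (ext i (x + y)) (fun j => ext i x j + ext i y j)) => [||j ij].
    + exact: dom.
    + exact: (rdomD (dom i x) (dom i y)).
    + by rewrite !extE star_homD.
  - move=> k x; rewrite /lam0 -cprojZ; last exact: dom.
    apply: (eqT i (ext i (k *: x)) (fun j => k *: ext i x j)) => [||j ij].
    + exact: dom.
    + exact: (rdomZ k (dom i x)).
    + by rewrite !extE star_homZ.
  - rewrite /lam0 -cproj1; apply: (eqT i (ext i cone) (fun=> cone)) => [||j ij].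
    + exact: dom.
    + exact: (rdom1 Fc).
    + by rewrite extE star_hom1.
  - move=> x y; rewrite /lam0 -cprojM; [|exact: dom|exact: dom].
    apply: (eqT i (ext i (cmul x y)) (fun j => cmul (ext i x j) (ext i y j))) => [||j ij].
    + exact: dom.
    + exact: (rdomM (dom i x) (dom i y)).
    + by rewrite !extE star_homM.
  - move=> x; rewrite /lam0 -cprojS; last exact: dom.
    apply: (eqT i (ext i (star x)) (fun j => star (ext i x j))) => [||j ij].
    + exact: dom.
    + exact: (rdomS (dom i x)).
    + by rewrite !extE star_hom_star.
  - by [].
pose lam i := sval (cid (lamP i)).
have lamE i x : lam i x = lam0 i x by exact: (svalP (cid (lamP i))).
exists (@rprod R I Fc T FF), lam; split.
- move=> i j ij x; rewrite !lamE; apply: (eqT j) => // k jk.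
  rewrite (extE _ _ _ (le_trans ij jk)) extE.
  rewrite -[LHS]/(comp (fmap F (jk : @hom (poset_cat I) j k))
                       (fmap F (ij : @hom (poset_cat I) i j)) x) -fmapM.
  by congr (phi _ x); exact: bool_irrelevance.
- move=> i x c; rewrite lamE nr_cproj; last exact: dom.
  move=> /(@rnorm_bound R I Fc T FF _ _ (dom i x))[_ [k hk]].
  have [_ dI] := dirI; have [l [il kl]] := dI i k.
  by exists l, il; rewrite -extE; exact: hk.
- exact: rprod_com.
Qed.

End DirectedSystem.

(** * The algebras of complex numbers and of matrices *)

Section Complex.
Context {R : realType}.

(** The intervals of radius [2 * 2^-n] around [u n] are nested; the limit is the supremum of their
    left ends. *)
Lemma real_fast_cvg (u : nat -> R) : (forall n, `|u n.+1 - u n| <= 2^-1 ^+ n) ->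
  exists l, forall n, `|u n - l| <= 2 * 2^-1 ^+ n.
Proof.
move=> hu; pose h n : R := 2^-1 ^+ n.
have hS n : h n.+1 = h n / 2 by rewrite /h exprS mulrC.
have h0 n : 0 <= h n by rewrite exprn_ge0 // invr_ge0.
pose a n := u n - 2 * h n; pose b n := u n + 2 * h n.
have aS n : a n <= a n.+1.
  by have := hu n; rewrite /a hS ler_norml -/(h n) => /andP[]; lra.
have bS n : b n.+1 <= b n.
  by have := hu n; rewrite /b hS ler_norml -/(h n) => /andP[]; lra.
have am m n : (m <= n)%N -> a m <= a n.
  by move=> /subnK <-; elim: (n - m)%N => // k; move/le_trans; apply; rewrite addSn.
have bm m n : (m <= n)%N -> b n <= b m.
  by move=> /subnK <-; elim: (n - m)%N => // k; apply: le_trans; rewrite addSn.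
have ab m n : a m <= b n.
  apply: le_trans (am _ _ (leq_maxl m n)) _; apply: le_trans (bm _ _ (leq_maxr m n)).
  by rewrite /a /b; have := h0 (maxn m n); lra.
pose l := sup (range a).
exists l => n; rewrite ler_norml -/(h n).
have la : a n <= l.
  by apply: ub_le_sup; [exists (b 0%N) => _ [m _ <-] | exists n].
have lb : l <= b n.
  by apply: ge_sup; [exists (a 0%N), 0%N | move=> _ [m _ <-]].
by move: la lb; rewrite /a /b => la lb; apply/andP; split; lra.
Qed.

Lemma complex_fast_cvg (u : nat -> R[i]) :
  (forall n, cmod (u n.+1 - u n) <= 2^-1 ^+ n) ->
  exists l, forall n, cmod (u n - l) <= 4 * 2^-1 ^+ n.
Proof.
move=> hu.
have [a ha] : exists a, forall n, `|complex.Re (u n) - a| <= 2 * 2^-1 ^+ n.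
  apply: real_fast_cvg => n; rewrite -raddfB /=.
  by rewrite (le_trans (Re_le_cmod _)).
have [b hb] : exists b, forall n, `|complex.Im (u n) - b| <= 2 * 2^-1 ^+ n.
  apply: real_fast_cvg => n; rewrite -raddfB /=.
  by rewrite (le_trans (Im_le_cmod _)).
(* Two coordinates within [2 * 2^-n] give a distance of at most [2 sqrt 2 * 2^-n], rounded up. *)
exists (Complex a b) => n.
have h0 : 0 <= 2^-1 ^+ n :> R by rewrite exprn_ge0 // invr_ge0.
rewrite -ler_sqr ?nnegrE ?cmod_ge0 ?mulr_ge0 // cmod2E.
have := ha n; have := hb n; case: (u n) => x y /=.
rewrite !ler_norml; set t := _ ^+ n => /andP[? ?] /andP[? ?].
nra.
Qed.

Definition cplx_staralg : staralg R :=
  @StarAlg R (R[i]^o) *%R 1 (fun z => z^*%R) (@mulrA _) (@mul1r _) (@mulr1 _)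
    (@mulrDl _) (@mulrDr _) (@scalerAl _ (R[i]^o)) (@scalerAr _ (R[i]^o))
    (@conjCK _) (rmorphD _) (fun k x => rmorphM _ k x)
    (fun x y => etrans (rmorphM _ x y) (mulrC _ _)).

Program Definition cplx_seminorm : cseminorm cplx_staralg :=
  @CSeminorm R cplx_staralg (fun=> True) (@cmod R) _ _ _ _ _ _ _ _ _ _.
Next Obligation. by []. Qed.
Next Obligation. by []. Qed.
Next Obligation. by []. Qed.
Next Obligation. by []. Qed.
Next Obligation. by []. Qed.
Next Obligation. by move=> x y _ _; exact: cmodD. Qed.
Next Obligation. by move=> k x _; exact: cmodM. Qed.
Next Obligation. by move=> x y _ _; rewrite cmodM. Qed.
Next Obligation. by move=> x _; rewrite /= cmodM cmodJ. Qed.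
Next Obligation.
move=> u _ /complex_fast_cvg[l hl]; exists l => // e e0.
have [|||N hN] := @expr_small R 2^-1 (e / 4) _ _ _.
- by rewrite invr_ge0.
- by rewrite invf_lt1 // ltr1n.
- by rewrite divr_gt0.
exists N => n Nn; apply: le_trans (hl n) _.
by rewrite mulrC -ler_pdivlMr // hN.
Qed.

(** The seminorm [cmod] is a norm, so the quotient is [R[i]] again; [in_cplx] and [cplx_val] are the
    inverse identifications. *)
Definition cplx : cstarAlgType R[i] := cstar_quot cplx_seminorm.

Definition in_cplx (z : R[i]) : cplx := cproj cplx_seminorm z.
Definition cplx_val (z : cplx) : R[i] := crepr z.

Lemma in_cplxK z : cplx_val (in_cplx z) = z.
Proof.
apply/eqP; rewrite -subr_eq0; apply/eqP/cmod_eq0.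
exact: (crepr_cpi (S := cplx_seminorm)).
Qed.

Lemma cplx_valK z : in_cplx (cplx_val z) = z.
Proof. exact: creprK. Qed.

Lemma cplx_val_inj : injective cplx_val.
Proof. exact: can_inj cplx_valK. Qed.

Lemma in_cplxD x y : in_cplx (x + y) = in_cplx x + in_cplx y.
Proof. exact: cprojD. Qed.
Lemma in_cplxZ k x : in_cplx (k * x) = k *: in_cplx x.
Proof. exact: cprojZ. Qed.
Lemma in_cplxM x y : in_cplx (x * y) = cmul (in_cplx x) (in_cplx y).
Proof. exact: cprojM. Qed.
Lemma in_cplxS x : in_cplx x^*%R = star (in_cplx x).
Proof. exact: cprojS. Qed.
Lemma in_cplx1 : in_cplx 1 = cone. Proof. exact: cproj1. Qed.

Lemma cplx_valD x y : cplx_val (x + y) = cplx_val x + cplx_val y.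
Proof. by rewrite -{1}(cplx_valK x) -{1}(cplx_valK y) -in_cplxD in_cplxK. Qed.
Lemma cplx_valZ k x : cplx_val (k *: x) = k * cplx_val x.
Proof. by rewrite -{1}(cplx_valK x) -in_cplxZ in_cplxK. Qed.
Lemma cplx_valM x y : cplx_val (cmul x y) = cplx_val x * cplx_val y.
Proof. by rewrite -{1}(cplx_valK x) -{1}(cplx_valK y) -in_cplxM in_cplxK. Qed.
Lemma cplx_valS x : cplx_val (star x) = (cplx_val x)^*%R.
Proof. by rewrite -{1}(cplx_valK x) -in_cplxS in_cplxK. Qed.
Lemma cplx_val1 : cplx_val cone = 1. Proof. by rewrite -in_cplx1 in_cplxK. Qed.
Lemma cplx_val0 : cplx_val 0 = 0.
Proof. by rewrite -(scale0r (0 : cplx)) cplx_valZ mul0r. Qed.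

Lemma nr_cplx (z : cplx) : nr z = cmod (cplx_val z).
Proof. by rewrite -{1}(cplx_valK z) nr_cproj. Qed.

Lemma cplx_com : cstar_commutative cplx.
Proof. by move=> x y; apply: cplx_val_inj; rewrite !cplx_valM mulrC. Qed.

End Complex.

(** * Matrices with the operator norm *)

Section Matrices.
Context {R : realType} {n : nat}.
Local Notation M := 'M[R[i]]_n.
Local Notation V := 'cV[R[i]]_n.
Implicit Types (x y : M) (v w : V).

Definition mxadj m p (A : 'M[R[i]]_(m, p)) : 'M[R[i]]_(p, m) := map_mx Num.conj A^T.

Lemma mxadjM m p q (A : 'M_(m, p)) (B : 'M_(p, q)) :
  mxadj (A *m B) = mxadj B *m mxadj A.
Proof. by rewrite /mxadj trmx_mul map_mxM. Qed.

Lemma mxadjK m p (A : 'M_(m, p)) : mxadj (mxadj A) = A.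
Proof. by apply/matrixP => i j; rewrite !mxE conjCK. Qed.

Lemma mxadjD m p (A B : 'M_(m, p)) : mxadj (A + B) = mxadj A + mxadj B.
Proof. by apply/matrixP => i j; rewrite !mxE rmorphD. Qed.

Lemma mxadjZ m p (k : R[i]) (A : 'M_(m, p)) : mxadj (k *: A) = k^*%R *: mxadj A.
Proof. by apply/matrixP => i j; rewrite !mxE rmorphM. Qed.

(** The real part of the Hermitian product is a real inner product with the same norm and the same
    adjoints, which is enough for the operator norm. *)
Definition dot v w : R := complex.Re ((mxadj v *m w) 0 0).
Definition vnorm v : R := Num.sqrt (dot v v).

Lemma dotE v w : dot v w = \sum_i complex.Re ((v i 0)^*%R * w i 0).
Proof. by rewrite /dot mxE raddf_sum; apply: eq_bigr => i _; rewrite !mxE. Qed.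

Lemma dot_sqE v : dot v v = \sum_i cmod (v i 0) ^+ 2.
Proof. by rewrite dotE; apply: eq_bigr => i _; rewrite -cmod_sq. Qed.

Lemma dot_ge0 v : 0 <= dot v v.
Proof. by rewrite dot_sqE sumr_ge0 // => i _; exact: sqr_ge0. Qed.

Lemma vnorm_ge0 v : 0 <= vnorm v. Proof. exact: sqrtr_ge0. Qed.

Lemma vnorm2 v : vnorm v ^+ 2 = dot v v.
Proof. by rewrite sqr_sqrtr // dot_ge0. Qed.

Lemma coord_le_vnorm v i : cmod (v i 0) <= vnorm v.
Proof.
rewrite -ler_sqr ?nnegrE ?cmod_ge0 ?vnorm_ge0 // vnorm2 dot_sqE (bigD1 i) //=.
by rewrite lerDl sumr_ge0 // => j _; exact: sqr_ge0.
Qed.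

Lemma vnorm_eq0 v : vnorm v = 0 -> v = 0.
Proof.
move=> v0; apply/matrixP => i j; rewrite mxE ord1; apply: cmod_eq0.
by apply/le_anti; rewrite cmod_ge0 andbT -v0 coord_le_vnorm.
Qed.

(** Cauchy-Schwarz: with [p] and [q] the norms of [v] and [w], sum the inequalities
    [a b <= (q/p a^2 + p/q b^2) / 2] over the coordinates. *)
Lemma dot_le v w : dot v w <= vnorm v * vnorm w.
Proof.
have Rle (a b : R[i]) : complex.Re (a^*%R * b) <= cmod a * cmod b.
  by rewrite -(cmodJ a) -cmodM (le_trans (ler_norm _)) // Re_le_cmod.
have [/vnorm_eq0 ->|v0] := eqVneq (vnorm v) 0.
  rewrite dotE big1 ?mulr_ge0 ?vnorm_ge0 // => i _.
  by rewrite mxE rmorph0 mul0r.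
have [/vnorm_eq0 ->|w0] := eqVneq (vnorm w) 0.
  by rewrite dotE big1 ?mulr_ge0 ?vnorm_ge0 // => i _; rewrite mxE mulr0.
have vp : 0 < vnorm v by rewrite lt_def v0 vnorm_ge0.
have wp : 0 < vnorm w by rewrite lt_def w0 vnorm_ge0.
set p := vnorm v in v0 vp *; set q := vnorm w in w0 wp *.
have H : dot v w <= 2^-1 * (q / p * dot v v + p / q * dot w w).
  rewrite dotE !dot_sqE !mulr_sumr -big_split mulr_sumr.
  apply: ler_sum => i _ /=; apply: le_trans (Rle _ _) _.
  set a := cmod _; set b := cmod _; rewrite -subr_ge0.
  have -> : 2^-1 * (q / p * a ^+ 2 + p / q * b ^+ 2) - a * b
    = (2 * p * q)^-1 * (q * a - p * b) ^+ 2 by field; rewrite v0 w0.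
  by rewrite mulr_ge0 ?sqr_ge0 // invr_ge0 !mulr_ge0 // ltW.
apply: le_trans H _; rewrite -!vnorm2 -/p -/q le_eqVlt; apply/orP; left; apply/eqP.
by field; rewrite v0 w0.
Qed.

Lemma dotDl v v' w : dot (v + v') w = dot v w + dot v' w.
Proof. by rewrite /dot mxadjD mulmxDl mxE raddfD. Qed.
Lemma dotDr v w w' : dot v (w + w') = dot v w + dot v w'.
Proof. by rewrite /dot mulmxDr mxE raddfD. Qed.
Lemma dot_adj x v w : dot (x *m v) w = dot v (mxadj x *m w).
Proof. by rewrite /dot mxadjM mulmxA. Qed.

Lemma vnormD v w : vnorm (v + w) <= vnorm v + vnorm w.
Proof.
rewrite -ler_sqr ?nnegrE ?vnorm_ge0 ?addr_ge0 ?vnorm_ge0 // vnorm2 dotDl !dotDr.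
rewrite sqrrD -!vnorm2; have := dot_le v w; have := dot_le w v; nra.
Qed.

Lemma vnormZ k v : vnorm (k *: v) = cmod k * vnorm v.
Proof.
apply/eqP; rewrite -(@eqrXn2 _ 2) ?vnorm_ge0 ?mulr_ge0 ?cmod_ge0 ?vnorm_ge0 //.
rewrite exprMn !vnorm2 !dot_sqE mulr_sumr; apply/eqP/eq_bigr => i _.
by rewrite mxE cmodM exprMn.
Qed.

Definition opbound x (c : R) : Prop := 0 <= c /\ forall v, vnorm (x *m v) <= c * vnorm v.

Definition opnorm x : R := inf [set c | opbound x c]%classic.

(** A crude bound on the operator norm: it makes the set of bounds nonempty and turns entrywise
    convergence into convergence in norm. *)
Definition entry_sum x : R := \sum_i \sum_j cmod (x i j).

Lemma entry_sum_ge0 x : 0 <= entry_sum x.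
Proof. by apply: sumr_ge0 => i _; apply: sumr_ge0 => j _; exact: cmod_ge0. Qed.

Lemma opbound_entries x : opbound x (entry_sum x).
Proof.
split; first exact: entry_sum_ge0.
move=> v; pose r i := \sum_j cmod (x i j).
have r0 i : 0 <= r i by apply: sumr_ge0 => j _; exact: cmod_ge0.
have xv i : cmod ((x *m v) i 0) <= r i * vnorm v.
  rewrite mxE mulr_suml; apply: (@le_trans _ _ (\sum_j cmod (x i j * v j 0))).
    elim/big_ind2: _ => [|a b c d ab cd|//]; first by rewrite cmod0.
    by rewrite (le_trans (cmodD _ _)) // lerD.
  by apply: ler_sum => j _; rewrite cmodM ler_wpM2l ?cmod_ge0 // coord_le_vnorm.
rewrite -ler_sqr ?nnegrE ?mulr_ge0 ?vnorm_ge0 ?entry_sum_ge0 // vnorm2 dot_sqE exprMn.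
apply: (@le_trans _ _ (\sum_i r i ^+ 2 * vnorm v ^+ 2)).
  apply: ler_sum => i _; rewrite -exprMn ler_sqr ?nnegrE ?cmod_ge0 //.
  by rewrite mulr_ge0 // vnorm_ge0.
rewrite -mulr_suml ler_wpM2r ?sqr_ge0 //.
rewrite [leRHS]expr2 [leRHS]mulr_suml.
apply: ler_sum => i _; rewrite expr2 -/(r i); apply: ler_wpM2l => //.
by rewrite /entry_sum (bigD1 i) //= lerDl; apply: sumr_ge0 => j _; exact: r0.
Qed.

Lemma opnorm_le x c : opbound x c -> opnorm x <= c.
Proof. by move=> xc; apply: ge_inf => //; exists 0 => b []. Qed.

Lemma le_opnorm x c : (forall b, opbound x b -> c <= b) -> c <= opnorm x.
Proof.
move=> H; apply: lb_le_inf; first by exists (entry_sum x); exact: opbound_entries.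
by move=> b /H.
Qed.

Lemma opnorm_ge0 x : 0 <= opnorm x.
Proof. by apply: le_opnorm => b []. Qed.

Lemma opnormP x v : vnorm (x *m v) <= opnorm x * vnorm v.
Proof.
have [v0|v0] := eqVneq (vnorm v) 0.
  by have [_ /(_ v)] := opbound_entries x; rewrite v0 !mulr0.
have vp : 0 < vnorm v by rewrite lt_def v0 vnorm_ge0.
by rewrite -ler_pdivrMr //; apply: le_opnorm => b [_ xb]; rewrite ler_pdivrMr.
Qed.

Lemma opnormD x y : opnorm (x + y) <= opnorm x + opnorm y.
Proof.
apply: opnorm_le; split=> [|v]; first by rewrite addr_ge0 // opnorm_ge0.
by rewrite mulmxDl mulrDl (le_trans (vnormD _ _)) // lerD // opnormP.
Qed.

Lemma opnormM x y : opnorm (x *m y) <= opnorm x * opnorm y.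
Proof.
apply: opnorm_le; split=> [|v]; first by rewrite mulr_ge0 // opnorm_ge0.
rewrite -mulmxA (le_trans (opnormP _ _)) // -mulrA ler_wpM2l ?opnorm_ge0 //.
exact: opnormP.
Qed.

Lemma opnormZ_le k x : opnorm (k *: x) <= cmod k * opnorm x.
Proof.
apply: opnorm_le; split=> [|v]; first by rewrite mulr_ge0 ?cmod_ge0 ?opnorm_ge0.
by rewrite -scalemxAl vnormZ -mulrA ler_wpM2l ?cmod_ge0 // opnormP.
Qed.

Lemma opnormZ k x : opnorm (k *: x) = cmod k * opnorm x.
Proof.
apply/le_anti; rewrite opnormZ_le /=.
have [->|k0] := eqVneq k 0; first by rewrite cmod0 mul0r opnorm_ge0.
rewrite -{1}[x](scalerK k0) (le_trans (ler_wpM2l (cmod_ge0 _) (opnormZ_le _ _))) //.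
by rewrite mulrA -cmodM mulfV // cmod1 mul1r.
Qed.

(** With [w = x^* v], one has [|w|^2 = <v, x w> <= |v| |x| |w|]; cancel [|w|]. *)
Lemma opnorm_adj x : opnorm (mxadj x) <= opnorm x.
Proof.
apply: opnorm_le; split=> [|v]; first exact: opnorm_ge0.
have [->|w0] := eqVneq (vnorm (mxadj x *m v)) 0.
  by rewrite mulr_ge0 ?opnorm_ge0 ?vnorm_ge0.
have wp : 0 < vnorm (mxadj x *m v) by rewrite lt_def w0 vnorm_ge0.
rewrite -(ler_pM2l wp) -expr2 vnorm2 dot_adj mxadjK.
apply: le_trans (dot_le _ _) _.
apply: le_trans (ler_wpM2l (vnorm_ge0 v) (opnormP _ _)) _.
by rewrite le_eqVlt; apply/orP; left; apply/eqP; ring.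
Qed.

(** The lower bound comes from [|x v|^2 = <v, x^* x v>], which makes the square root of the norm of
    [x^* x] a bound for [x]. *)
Lemma opnormS x : opnorm (mxadj x *m x) = opnorm x ^+ 2.
Proof.
apply/le_anti/andP; split.
  by rewrite (le_trans (opnormM _ _)) // expr2 ler_wpM2r ?opnorm_ge0 // opnorm_adj.
have y0 := opnorm_ge0 (mxadj x *m x); set y := opnorm _ in y0 *.
rewrite -(sqr_sqrtr y0) ler_sqr ?nnegrE ?sqrtr_ge0 ?opnorm_ge0 //.
apply: opnorm_le; split=> [|v]; first exact: sqrtr_ge0.
rewrite -ler_sqr ?nnegrE ?vnorm_ge0 ?mulr_ge0 ?sqrtr_ge0 ?vnorm_ge0 //.
rewrite exprMn (sqr_sqrtr y0) vnorm2 dot_adj mulmxA.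
apply: le_trans (dot_le _ _) _.
apply: le_trans (ler_wpM2l (vnorm_ge0 v) (opnormP _ _)) _.
by rewrite -/y le_eqVlt; apply/orP; left; apply/eqP; ring.
Qed.

Lemma entry_le_opnorm x i j : cmod (x i j) <= opnorm x.
Proof.
have := opnormP x (delta_mx j 0).
have -> : vnorm (delta_mx j 0) = 1.
  rewrite /vnorm dot_sqE (bigD1 j) //= big1 => [|k kj].
    by rewrite !mxE !eqxx cmod1 expr1n addr0 sqrtr1.
  by rewrite mxE (negbTE kj) cmod0 expr0n.
rewrite mulr1 -colE; apply: le_trans.
by have := coord_le_vnorm (col j x) i; rewrite mxE.
Qed.

Lemma opnorm_complete (u : nat -> M) :
    (forall m, opnorm (u m.+1 - u m) <= 2^-1 ^+ m) ->
  exists2 l, True & forall e : R, 0 < e -> exists N, forall m, (N <= m)%N ->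
    opnorm (u m - l) <= e.
Proof.
move=> hu.
have lim i j : exists l, forall m, cmod (u m i j - l) <= 4 * 2^-1 ^+ m.
  apply: complex_fast_cvg => m; apply: le_trans (hu m).
  by have := entry_le_opnorm (u m.+1 - u m) i j; rewrite !mxE.
pose l : M := \matrix_(i, j) sval (cid (lim i j)).
have hl i j m : cmod ((u m - l) i j) <= 4 * 2^-1 ^+ m.
  by rewrite !mxE; exact: (svalP (cid (lim i j))).
(* There are [n * n] entries, each within [4 * 2^-m] of its limit; the added 1 keeps [c] positive
   when [n = 0]. *)
exists l => // e e0; pose c : R := (n * n)%:R * 4 + 1.
have c0 : 0 < c by rewrite ltr_wpDl // mulr_ge0.
have [||N hN] := @expr_small R 2^-1 (e / c) _ _ (divr_gt0 e0 c0).
- by rewrite invr_ge0.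
- by rewrite invf_lt1 // ltr1n.
exists N => m Nm; apply: le_trans (opnorm_le (opbound_entries _)) _.
have h0 : 0 <= 2^-1 ^+ m :> R by rewrite exprn_ge0 // invr_ge0.
have : c * 2^-1 ^+ m <= e by rewrite mulrC -ler_pdivlMr // hN.
apply: le_trans.
apply: (@le_trans _ _ ((n * n)%:R * (4 * 2^-1 ^+ m))); last first.
  by rewrite mulrA; apply: ler_wpM2r => //; rewrite /c lerDl ler01.
rewrite natrM -mulrA /entry_sum.
apply: (@le_trans _ _ (\sum_(i < n) n%:R * (4 * 2^-1 ^+ m))); last first.
  by rewrite sumr_const card_ord -[leLHS]mulr_natl.
apply: ler_sum => i _; apply: (@le_trans _ _ (\sum_(j < n) (4 * 2^-1 ^+ m))).
  by apply: ler_sum => j _; exact: hl.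
by rewrite sumr_const card_ord -[leLHS]mulr_natl.
Qed.

Lemma mxscalerAr (k : R[i]) x y : k *: (x *m y) = x *m (k *: y).
Proof. exact: scalemxAr. Qed.

Definition mx_staralg : staralg R :=
  @StarAlg R M (@mulmx _ n n n) 1%:M (@mxadj n n) (@mulmxA _ n n n n) (@mul1mx _ n n)
    (@mulmx1 _ n n) (@mulmxDl _ n n n) (@mulmxDr _ n n n) (@scalemxAl _ n n n)
    mxscalerAr (@mxadjK n n) (@mxadjD n n) (@mxadjZ n n) (@mxadjM n n n).

Definition mx_seminorm : cseminorm mx_staralg :=
  @CSeminorm R mx_staralg (fun=> True) opnorm (fun _ _ _ _ => I) (fun _ _ _ => I) I
    (fun _ _ _ _ => I) (fun _ _ => I) (fun x y _ _ => opnormD x y)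
    (fun k x _ => opnormZ k x) (fun x y _ _ => opnormM x y) (fun x _ => opnormS x)
    (fun u _ => @opnorm_complete u).

Definition mxalg : cstarAlgType R[i] := cstar_quot mx_seminorm.

Definition in_mxalg (x : M) : mxalg := cproj mx_seminorm x.

Lemma in_mxalg_inj : injective in_mxalg.
Proof.
move=> x y /cprojP => /(_ I I) xy; apply/matrixP => i j.
apply/eqP; rewrite -subr_eq0; apply/eqP/cmod_eq0/le_anti; rewrite cmod_ge0 andbT.
by have := entry_le_opnorm (x - y) i j; rewrite [opnorm _]xy !mxE.
Qed.

Lemma in_mxalgD x y : in_mxalg (x + y) = in_mxalg x + in_mxalg y.
Proof. exact: cprojD. Qed.
Lemma in_mxalgZ (k : R[i]) x : in_mxalg (k *: x) = k *: in_mxalg x.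
Proof. exact: cprojZ. Qed.
Lemma in_mxalgM x y : in_mxalg (x *m y) = cmul (in_mxalg x) (in_mxalg y).
Proof. exact: cprojM. Qed.
Lemma in_mxalgS x : in_mxalg (mxadj x) = star (in_mxalg x).
Proof. exact: cprojS. Qed.
Lemma in_mxalg1 : in_mxalg 1%:M = cone. Proof. exact: cproj1. Qed.

Lemma nr_in_mxalg x : nr (in_mxalg x) <= entry_sum x.
Proof. by rewrite nr_cproj //; apply: opnorm_le; exact: opbound_entries. Qed.

End Matrices.
Arguments mxalg R n : clear implicits.
Arguments cplx R : clear implicits.

(** * Characters *)

Section Positivity.
Context {R : realType} {A : cstarAlgType R[i]}.
Context (A_com : cstar_commutative A).
Implicit Types (x k h s a b c : A) (r t : R).

Definition scal (r : R) : A := r%:C *: cone.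

Lemma star_scal r : star (scal r) = scal r.
Proof. by rewrite starZr star1. Qed.

Lemma scalD r t : scal (r + t) = scal r + scal t.
Proof. by rewrite /scal rmorphD scalerDl. Qed.

Lemma scalN r : scal (- r) = - scal r.
Proof. by rewrite /scal rmorphN scaleNr. Qed.

Lemma cmul_scal r x : cmul (scal r) x = r%:C *: x.
Proof. by rewrite -cscalerAl cmul1x. Qed.

Lemma scalM r t : scal (r * t) = cmul (scal r) (scal t).
Proof. by rewrite cmul_scal /scal rmorphM scalerA. Qed.

Lemma sqrt_scalB t x : nr x < t -> star x = x ->
  exists k, star k = k /\ cmul k k = scal t - x.
Proof.
move=> xt sx; have t0 : 0 < t := le_lt_trans (nr_ge0 x) xt.
have y1 : nr (t^-1%:C *: x) < 1.
  by rewrite nrZr ?invr_ge0 ?ltW // mulrC ltr_pdivrMr // mul1r.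
have [k [kk sk _]] := sqrt_1Bx y1.
have {}sk : star k = k by apply: sk; rewrite starZr sx.
exists ((Num.sqrt t)%:C *: k); split; first by rewrite starZr sk.
rewrite -cscalerAl -cscalerAr scalerA -rmorphM -expr2 sqr_sqrtr ?ltW // kk.
by rewrite scalerBr scalerA -rmorphM mulfV ?gt_eqF // scale1r.
Qed.

Lemma sq_sum_scal t a b : star a = a -> star b = b -> 0 < t -> cmul a a + cmul b b = scal t -> nr (cmul a a) <= t.
Proof.
move=> sa sb t0 abt; pose q := (Num.sqrt t)^-1.
have q0 : 0 < q by rewrite invr_gt0 sqrtr_gt0.
have q2 : q * q = t^-1 by rewrite -invfM -expr2 sqr_sqrtr // ltW.
have H : nr (q%:C *: a) <= 1.
  apply: (@nr_sq_sum1 _ _ _ (q%:C *: b)); rewrite ?starZr ?sa ?sb //.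
  rewrite -!cscalerAl -!cscalerAr !scalerA -rmorphM -scalerDr abt scalerA -rmorphM.
  by rewrite q2 mulVf ?gt_eqF // scale1r.
rewrite nr_sa_sq //; move: H; rewrite (nrZr _ (ltW q0)) mulrC ler_pdivrMr ?sqrtr_gt0 //.
by rewrite mul1r -ler_sqr ?nnegrE ?nr_ge0 ?sqrtr_ge0 // sqr_sqrtr // ltW.
Qed.

Inductive sos : A -> Prop :=
| sos_sq k of star k = k : sos (cmul k k)
| sos_add s s' of sos s & sos s' : sos (s + s').

Lemma sos_sa s : sos s -> star s = s.
Proof.
elim=> [k sk|u v _ su _ sv]; first by rewrite starM sk.
by rewrite starD su sv.
Qed.

Lemma scal_sq r : 0 <= r -> exists k, star k = k /\ cmul k k = scal r.
Proof.
move=> r0; exists (scal (Num.sqrt r)); split; first exact: star_scal.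
by rewrite -scalM -expr2 sqr_sqrtr.
Qed.

(* For self-adjoint [a], the bound [nr (t - a) <= t] expresses [a >= 0] in a form
   that is stable under sums. *)
Lemma sos_bound s : sos s -> exists t, 0 <= t /\ nr (scal t - s) <= t.
Proof.
elim=> [k sk|u v _ [t [t0 ut]] _ [r [r0 vr]]].
  have kk : nr (cmul k k) < nr (cmul k k) + 1 by rewrite ltrDl.
  have [|g [sg gg]] := sqrt_scalB kk; first by rewrite starM sk.
  have t0 : 0 < nr (cmul k k) + 1 by rewrite ltr_wpDl // nr_ge0.
  exists (nr (cmul k k) + 1); split; first exact: ltW.
  by rewrite -gg; apply: (@sq_sum_scal _ _ k) => //; rewrite gg subrK.
exists (t + r); split; first exact: addr_ge0.
by rewrite scalD opprD addrACA (le_trans (nrD _ _)) // lerD.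
Qed.

(** Up to an arbitrarily small scalar, a sum of squares is a single square: [t + e - (t - s)] has a
    square root because [t - s] has norm at most [t]. *)
Lemma sos_scal_sq s e : sos s -> 0 < e -> exists g, star g = g /\ cmul g g = s + scal e.
Proof.
move=> sS e0; have [t [t0 st]] := sos_bound sS.
have st' : nr (scal t - s) < t + e by rewrite (le_lt_trans st) // ltrDl.
have [|g [sg gg]] := sqrt_scalB st'; first by rewrite starB star_scal sos_sa.
by exists g; split => //; rewrite gg scalD opprB addrC addrA subrK addrC.
Qed.

Lemma norm_scal_sq h e : star h = h -> 0 < e ->
  exists g, star g = g /\ cmul g g = scal (nr h + e) - h.
Proof. by move=> sh e0; apply: sqrt_scalB => //; rewrite ltrDl. Qed.

(** Monotonicity of the norm on positive elements. For [b = c^2 + s], write [nr b + e/2 - b = g1^2]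
    and [s + g1^2 + e/2 = g^2]; then [c^2 + g^2 = nr b + e]. *)
Lemma nr_sos_mono c s : star c = c -> sos s -> nr (cmul c c) <= nr (cmul c c + s).
Proof.
move=> sc sS; set b := cmul c c + s; apply/ler_addgt0Pr => e e0.
have sb : star b = b by rewrite /b starD starM sc sos_sa.
have e20 : 0 < e / 2 by rewrite divr_gt0.
have [g1 [sg1 gg1]] := norm_scal_sq sb e20.
have [g [sg gg]] := sos_scal_sq (sos_add sS (sos_sq sg1)) e20.
apply: (@sq_sum_scal _ _ g) => //; first by rewrite ltr_wpDl // nr_ge0.
have -> : scal (nr b + e) = scal (nr b + e / 2) + scal (e / 2).
  by rewrite -scalD -addrA -splitr.
by rewrite gg gg1 !addrA -/b [b + _]addrC addrK.
Qed.

End Positivity.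

(** * Preorderings of the self-adjoint part and the characters they define *)

Section Preorderings.
Context {R : realType} {A : cstarAlgType R[i]} (A_com : cstar_commutative A).
Local Notation C := (comring A_com).
Implicit Types (x y k h s t a b c : C) (r : R).
Local Notation sa x := (star (x : A) = x :> A).
Local Notation sc r := (scal r : C).

Lemma saD x y : sa x -> sa y -> sa (x + y).
Proof. by move=> sx sy; rewrite starD sx sy. Qed.
Lemma saN x : sa x -> sa (- x).
Proof. by move=> sx; rewrite starN sx. Qed.
Lemma saM x y : sa x -> sa y -> sa (x * y).
Proof. by move=> sx sy; rewrite starM sx sy; exact: A_com. Qed.
Lemma sa_sc r : sa (sc r). Proof. exact: star_scal. Qed.
Lemma sa1 : sa (1 : C). Proof. exact: star1. Qed.

Lemma sc1 : sc 1 = 1. Proof. exact: scale1r. Qed.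
Lemma scD r r' : sc (r + r') = sc r + sc r'. Proof. exact: scalD. Qed.
Lemma scN r : sc (- r) = - sc r. Proof. exact: scalN. Qed.
Lemma scM r r' : sc (r * r') = sc r * sc r'. Proof. exact: scalM. Qed.
Lemma sc0 : sc 0 = 0. Proof. exact: scale0r. Qed.

(** The proper preorderings of real algebra, in the real commutative ring of self-adjoint
    elements. *)
Record preorder (T : set C) : Prop := {
  po_sa : forall x, T x -> sa x;
  poD : forall x y, T x -> T y -> T (x + y);
  poM : forall x y, T x -> T y -> T (x * y);
  po_sq : forall k, sa k -> T (k * k);
  poN1 : ~ T (- 1)
}.

Section Order.
Context (T : set C) (TP : preorder T).

Lemma po_sc r : 0 <= r -> T (sc r).
Proof. by move=> r0; have [k [sk <-]] := @scal_sq R A r r0; exact: (po_sq TP). Qed.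

Lemma poZ r x : 0 <= r -> T x -> T (sc r * x).
Proof. by move=> r0 Tx; apply: (poM TP) => //; exact: po_sc. Qed.

Lemma po_scE r : T (sc r) -> 0 <= r.
Proof.
move=> Tr; rewrite leNgt; apply/negP => r0; apply: (poN1 TP).
have -> : -1 = sc (- r^-1) * sc r.
  by rewrite -scM mulNr mulVf ?lt_eqF // scN sc1.
by apply: poZ => //; rewrite oppr_ge0 invr_le0 ltW.
Qed.

Lemma po_norm h e : sa h -> 0 < e -> T (sc (nr (h : A) + e) - h).
Proof.
by move=> sh e0; have [g [sg <-]] := norm_scal_sq sh e0; exact: (po_sq TP).
Qed.

Context (Tmax : forall a, sa a -> T a \/ T (- a)).

Definition rchar a : R := sup [set r | T (a - sc r)]%classic.

Lemma po_lower_le a r e : sa a -> 0 < e -> T (a - sc r) -> r <= nr (a : A) + e.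
Proof.
move=> aa e0 Tar; have := poD TP (po_norm aa e0) Tar.
by rewrite addrA subrK -scN -scD => /po_scE; rewrite subr_ge0.
Qed.

Lemma rchar_sup a : sa a -> has_sup [set r | T (a - sc r)]%classic.
Proof.
move=> aa; split.
  exists (- (nr (- a : A) + 1)); rewrite /= scN opprK addrC -[a in _ + a]opprK.
  by apply: po_norm => //; exact: saN.
by exists (nr (a : A) + 1) => r /(po_lower_le aa); apply.
Qed.

Lemma rchar_ge a r : sa a -> T (a - sc r) -> r <= rchar a.
Proof. by move=> aa Tr; apply: ub_le_sup => //; have [] := rchar_sup aa. Qed.

Lemma rchar_le a r : sa a -> T (sc r - a) -> rchar a <= r.
Proof.
move=> aa Tr; apply: ge_sup; first by have [] := rchar_sup aa.
move=> r' /(poD TP Tr); rewrite addrA subrK -scN -scD => /po_scE.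
by rewrite subr_ge0.
Qed.

Lemma rchar_gt a r : sa a -> r < rchar a -> T (a - sc r).
Proof.
move=> aa ra; have [|//|H] := Tmax (a := a - sc r).
  by apply: saD => //; apply/saN/sa_sc.
have : rchar a <= r by apply: rchar_le => //; rewrite -opprB.
by rewrite leNgt ra.
Qed.

Lemma rchar_lt a r : sa a -> rchar a < r -> T (sc r - a).
Proof.
move=> aa ra; have [|H|] := Tmax (a := a - sc r).
- by apply: saD => //; apply/saN/sa_sc.
- by have := rchar_ge aa H; rewrite leNgt ra.
- by rewrite opprB.
Qed.

Lemma rcharD a b : sa a -> sa b -> rchar (a + b) = rchar a + rchar b.
Proof.
move=> aa ab; have aab := saD aa ab; apply/le_anti/andP; split.
  apply/ler_addgt0Pr => e e0; have e20 : 0 < e / 2 by rewrite divr_gt0.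
  rewrite [in leRHS](splitr e) addrACA; apply: rchar_le => //.
  rewrite scD opprD addrACA; apply: (poD TP); apply: rchar_lt => //; rewrite ltrDl //.
apply/ler_addgt0Pr => e e0; have e20 : 0 < e / 2 by rewrite divr_gt0.
rewrite -lerBlDr [e in X in _ - X](splitr e) opprD addrACA; apply: rchar_ge => //.
rewrite scD opprD addrACA; apply: (poD TP); apply: rchar_gt => //; rewrite gtrDl oppr_lt0 //.
Qed.

Lemma rchar_sc r : rchar (sc r) = r.
Proof.
apply/le_anti/andP; split; [apply: rchar_le | apply: rchar_ge]; try exact: sa_sc;
  by rewrite subrr -sc0; apply: po_sc.
Qed.

Lemma rcharN a : sa a -> rchar (- a) = - rchar a.
Proof.
move=> aa; apply/eqP; rewrite -addr_eq0 -rcharD //; last exact: saN.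
by rewrite addNr -sc0 rchar_sc.
Qed.

Lemma rcharM0 b c : sa b -> sa c -> rchar b = 0 -> rchar (b * c) = 0.
Proof.
move=> sb cc b0.
have up c' : sa c' -> rchar (b * c') <= 0.
  move=> sc'; have sbc := saM sb sc'; apply/ler_addgt0Pr => e e0; rewrite add0r.
  (* In the order of [T], [c'] lies between [- m] and [m], and [b] between [- d] and [d] with
     [d = e / m]. The identity [2 (d m - b c') = (d - b) (m + c') + (b + d) (m - c')] then puts
     [e - b c'] in [T]. *)
  pose m := nr (c' : A) + 1.
  have m0 : 0 < m by rewrite ltr_wpDl // nr_ge0.
  pose d := e / m.
  have d0 : 0 < d by rewrite divr_gt0.
  have T1 : T (sc d - b) by apply: rchar_lt; rewrite ?b0.
  have T2 : T (b + sc d).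
    by have := @rchar_gt b (- d) sb; rewrite b0 oppr_lt0 scN opprK; apply.
  have T3 : T (sc m - c') by exact: po_norm.
  have T4 : T (sc m + c').
    by have := po_norm (saN sc') ltr01; rewrite opprK nrN.
  have H2 : sc 2^-1 + sc 2^-1 = 1 by rewrite -scD -sc1; congr scal; lra.
  have dm : sc d * sc m = sc e by rewrite -scM /d mulfVK // gt_eqF.
  apply: rchar_le => //.
  have -> : sc e - b * c' =
      sc 2^-1 * ((sc d - b) * (sc m + c') + (b + sc d) * (sc m - c')).
    rewrite -dm -[LHS]mul1r -H2; ring.
  apply: poZ; first by rewrite invr_ge0.
  by apply: (poD TP); apply: (poM TP).
apply/le_anti; rewrite up //= -[leRHS]opprK -rcharN ?oppr_ge0; last exact: saM.
by rewrite -mulrN up //; exact: saN.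
Qed.

Lemma rcharM b c : sa b -> sa c -> rchar (b * c) = rchar b * rchar c.
Proof.
have zero b' : sa b' -> sa (b' - sc (rchar b')) /\ rchar (b' - sc (rchar b')) = 0.
  move=> sb'; have sN := saN (sa_sc (rchar b')); split; first exact: saD.
  by rewrite rcharD // -scN rchar_sc subrr.
move=> sb cc; have [sb' b0] := zero b sb; have [sc' c0] := zero c cc.
have -> : b * c = (b - sc (rchar b)) * c
    + ((c - sc (rchar c)) * sc (rchar b) + sc (rchar b * rchar c)).
  by rewrite scM; ring.
have s1 := saM sb' cc; have s2 := saM sc' (sa_sc (rchar b)).
rewrite rcharD //; last by apply: saD => //; exact: sa_sc.
rewrite rcharD //; last exact: sa_sc.
by rewrite !rcharM0 ?rchar_sc ?add0r //; exact: sa_sc.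
Qed.

Lemma rchar_po a : T a -> 0 <= rchar a.
Proof. by move=> Ta; apply: rchar_ge; rewrite ?sc0 ?subr0 //; exact: (po_sa TP). Qed.

Definition re_part (x : C) : C := (2^-1)%:C *: (x + star (x : A)).
Definition im_part (x : C) : C := (- (2^-1)%:C * 'i%C) *: (x - star (x : A) : A).

Lemma sa_re x : sa (re_part x).
Proof. by rewrite /re_part starZr starD starK addrC. Qed.

Let ci := 'i%C : R[i].

Lemma ci2 : ci * ci = -1. Proof. by rewrite -expr2 sqr_i. Qed.
Lemma conj_ci : ci^*%R = - ci.
Proof. by rewrite conjcE /ci; apply/eqP; rewrite eq_complex /= oppr0 !eqxx. Qed.

Lemma sa_im x : sa (im_part x).
Proof.
have conj_k : (- (2^-1)%:C * ci)^*%R = - (- (2^-1)%:C * ci).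
  by rewrite rmorphM rmorphN /= conj_ci conjcE conjc_real mulrN.
by rewrite /im_part starZ conj_k starB starK scaleNr -scalerN opprB.
Qed.

Lemma re_im x : x = re_part x + ci *: im_part x.
Proof.
have hh : (2^-1)%:C + (2^-1)%:C = 1 :> R[i].
  by rewrite -rmorphD /= (_ : 2^-1 + 2^-1 = 1) //; lra.
rewrite /re_part /im_part scalerA -/ci mulNr mulrN mulrCA ci2 mulrN1 opprK.
by rewrite -scalerDr addrACA subrr addr0 scalerDr -scalerDl hh scale1r.
Qed.

Lemma re_im_unique a b a' b' : sa a -> sa b -> sa a' -> sa b' ->
  a + ci *: b = a' + ci *: b' -> a = a' /\ b = b'.
Proof.
have re u v : sa u -> sa v -> re_part (u + ci *: v) = u.
  move=> su sv; rewrite /re_part starD starZ su sv conj_ci scaleNr addrACA subrr addr0.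
  by rewrite scalerDr -scalerDl -rmorphD /= (_ : 2^-1 + 2^-1 = 1) ?scale1r //; lra.
move=> sa_ sb sa' sb' ab; have aa' : a = a' by rewrite -(re a b) // ab re.
split => //; move: ab; rewrite aa' => /addrI /(congr1 (fun z : C => (- ci) *: z)).
by rewrite !scalerA mulNr ci2 opprK !scale1r.
Qed.

Definition cchar (x : C) : R[i] := (rchar (re_part x))%:C + ci * (rchar (im_part x))%:C.

Lemma ccharE a b : sa a -> sa b -> cchar (a + ci *: b) = (rchar a)%:C + ci * (rchar b)%:C.
Proof.
move=> aa ab; rewrite /cchar.
by have [<- <-] := re_im_unique aa ab (sa_re _) (sa_im _) (re_im (a + ci *: b)).
Qed.

Lemma complex_sa x : exists a b, [/\ sa a, sa b & x = a + ci *: b].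
Proof. by exists (re_part x), (im_part x); split; [exact: sa_re | exact: sa_im | exact: re_im]. Qed.

Lemma ccharD x y : cchar (x + y) = cchar x + cchar y.
Proof.
have [a [b [aa ab ->]]] := complex_sa x; have [c [d [cc dd ->]]] := complex_sa y.
rewrite addrACA -scalerDr !ccharE //; try exact: saD.
by rewrite !rcharD // !rmorphD /= mulrDr addrACA.
Qed.

Lemma comring_scaleE (k : R[i]) x : k *: x = (k *: (1 : C)) * x.
Proof. by rewrite -[LHS]/(k *: (x : A)) -{1}(cmul1x (x : A)) cscalerAl. Qed.

Lemma ccharM x y : cchar (x * y) = cchar x * cchar y.
Proof.
have [a [b [aa ab ->]]] := complex_sa x; have [c [d [cc dd ->]]] := complex_sa y.
have -> : (a + ci *: b) * (c + ci *: d) = (a * c - b * d) + ci *: (a * d + b * c).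
  have i2 : (ci *: (1 : C)) * (ci *: (1 : C)) = -1.
    by rewrite -comring_scaleE scalerA ci2 scaleN1r.
  rewrite (comring_scaleE ci b) (comring_scaleE ci d) (comring_scaleE ci (_ + _)); set u := ci *: _ in i2 *.
  have -> : (a + u * b) * (c + u * d) = a * c + (u * u) * (b * d) + u * (a * d + b * c).
    by ring.
  by rewrite i2 mulN1r.
have [ac bd] := (saM aa cc, saM ab dd); have [ad bc] := (saM aa dd, saM ab cc).
rewrite !ccharE //; try (apply: saD => //; exact: saN).
rewrite !rcharD ?rcharN ?rcharM //; try exact: saN.
rewrite !(rmorphD, rmorphN, rmorphM) /=.
have E (p q r s : R[i]) :
    (p + ci * r) * (q + ci * s) = p * q + (ci * ci) * (r * s) + ci * (p * s + r * q).
  by ring.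
by rewrite E ci2 mulN1r.
Qed.

Lemma cchar1 : cchar 1 = 1.
Proof.
have -> : (1 : C) = 1 + ci *: sc 0 by rewrite sc0 scaler0 addr0.
rewrite ccharE; [|exact: sa1|exact: sa_sc].
by rewrite -{1}sc1 !rchar_sc mulr0 addr0.
Qed.

Lemma ccharZ (k : R[i]) x : cchar (k *: x) = k * cchar x.
Proof.
rewrite comring_scaleE ccharM; congr (_ * _).
have -> : k *: (1 : C) = sc (complex.Re k) + ci *: sc (complex.Im k).
  by rewrite /scal scalerA -scalerDl /ci -complexE.
by rewrite ccharE ?rchar_sc; [rewrite /ci -complexE | exact: sa_sc | exact: sa_sc].
Qed.

Lemma ccharS x : cchar (star (x : A)) = (cchar x)^*%R.
Proof.
have [a [b [aa ab ->]]] := complex_sa x.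
have -> : star (a + ci *: b : A) = a + ci *: (- b).
  by rewrite starD starZ aa ab conj_ci scaleNr scalerN.
rewrite !ccharE //; last exact: saN.
by rewrite rcharN // rmorphD rmorphM /= conj_ci !conjcE !conjc_real rmorphN mulrN mulNr.
Qed.

Lemma preorder_char : exists chi : star_hom A (cplx R),
  forall a, T a -> exists2 r : R, 0 <= r & cplx_val (chi a) = r%:C.
Proof.
unshelve eexists; first (exists (fun x : A => in_cplx (cchar x))).
- by move=> x y; rewrite -in_cplxD -ccharD.
- by move=> k x; rewrite -in_cplxZ -ccharZ.
- by rewrite -in_cplx1 -cchar1.
- by move=> x y; rewrite -in_cplxM -ccharM.
- by move=> x; rewrite -in_cplxS -ccharS.
move=> a Ta; exists (rchar a); first exact: rchar_po.
rewrite /= in_cplxK; have := ccharE (po_sa TP Ta) (sa_sc 0).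
by rewrite rchar_sc mulr0 addr0 sc0 scaler0 addr0.
Qed.

End Order.

Lemma preorder_max (T0 : set C) : preorder T0 ->
  exists T : set C, [/\ preorder T, (T0 `<=` T)%classic & forall a, sa a -> T a \/ T (- a)].
Proof.
move=> T0P; pose P (X : set C) := X = set0 \/ preorder X /\ (T0 `<=` X)%classic.
have [F FP Ftot|T [TP Tmax]] := @Zorn_bigcup C P.
  have [[X FX X0]|F0] := pselect (exists2 X, F X & X <> set0); last first.
    left; apply/seteqP; split=> // x [X FX Xx].
    by apply: F0; exists X => // X0; rewrite X0 in Xx.
  have PX Y y : F Y -> Y y -> preorder Y /\ (T0 `<=` Y)%classic.
    by move=> FY Yy; have [Y0|//] := FP _ FY; rewrite Y0 in Yy.
  have [XP T0X] : preorder X /\ (T0 `<=` X)%classic by have [|] := FP _ FX.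
  right; split; last by move=> x /T0X Xx; exists X.
  split.
  - by move=> x [Y FY Yx]; have [/po_sa H _] := PX _ _ FY Yx; exact: H.
  - move=> x y [Y FY Yx] [Z FZ Zy]; have [YP _] := PX _ _ FY Yx.
    have [ZP _] := PX _ _ FZ Zy; have [YZ|ZY] := Ftot _ _ FY FZ.
      by exists Z => //; apply: (poD ZP) => //; exact: YZ.
    by exists Y => //; apply: (poD YP) => //; exact: ZY.
  - move=> x y [Y FY Yx] [Z FZ Zy]; have [YP _] := PX _ _ FY Yx.
    have [ZP _] := PX _ _ FZ Zy; have [YZ|ZY] := Ftot _ _ FY FZ.
      by exists Z => //; apply: (poM ZP) => //; exact: YZ.
    by exists Y => //; apply: (poM YP) => //; exact: ZY.
  - by move=> k sk; exists X => //; exact: (po_sq XP).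
  - by move=> [Y FY YN1]; have [YP _] := PX _ _ FY YN1; exact: (poN1 YP).
have T00 : T0 (sc 0) by exact: (po_sc T0P (lexx 0)).
have [Te|[{}TP T0T]] := TP.
  case: (Tmax T0); last by right; split.
  by rewrite Te; split=> [x []|/(_ _ T00)].
exists T; split=> // a aa; apply: contrapT => /not_orP[nTa nTNa].
have T0_ : T 0 by rewrite -sc0; exact: T0T.
have T1 : T 1 by rewrite -(mulr1 1); apply: (po_sq TP); exact: sa1.
(* By maximality, the preordering generated by [T] and an outside element [b] is improper. *)
have ext b : sa b -> ~ T b -> exists s t, [/\ T s, T t & -1 = s + b * t].
  move=> sb nTb; pose B : set C := fun x => exists s t, [/\ T s, T t & x = s + b * t].
  have TB : (T `<=` B)%classic by move=> x Tx; exists x, 0; rewrite mulr0 addr0.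
  have Bb : B b by exists 0, 1; rewrite mulr1 add0r.
  apply: contrapT => nB; apply: (Tmax B).
    by split=> // BT; apply: nTb; exact: BT.
  right; split; last exact: subset_trans T0T TB.
  split=> //.
  - move=> x [s [t [Ts Tt ->]]]; have [ss st] := (po_sa TP Ts, po_sa TP Tt).
    by apply: saD => //; exact: saM.
  - move=> x y [s [t [Ts Tt ->]]] [s' [t' [Ts' Tt' ->]]].
    exists (s + s'), (t + t'); split; [exact: (poD TP) | exact: (poD TP) |].
    by rewrite mulrDr addrACA.
  - move=> x y [s [t [Ts Tt ->]]] [s' [t' [Ts' Tt' ->]]].
    exists (s * s' + (b * b) * (t * t')), (s * t' + t * s'); split.
    + apply: (poD TP); first exact: (poM TP).
      by apply: (poM TP); [exact: (po_sq TP) | exact: (poM TP)].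
    + by apply: (poD TP); exact: (poM TP).
    + by ring.
  - by move=> k sk; apply: TB; exact: (po_sq TP).
have [s [t [Ts Tt e1]]] := ext a aa nTa.
have [s' [t' [Ts' Tt' e2]]] := ext (- a) (saN aa) nTNa.
apply: (poN1 TP).
(* Multiplying [a t = - (1 + s)] by [- a t' = - (1 + s')] gives [(1 + s) (1 + s') = - a^2 t t'],
   which exhibits [- 1] in [T]. *)
have -> : -1 = s + s' + s * s' + (a * a) * (t * t').
  have -> : (a * a) * (t * t') = - ((a * t) * (- a * t')) by ring.
  have -> : a * t = -1 - s by rewrite e1; ring.
  have -> : - a * t' = -1 - s' by rewrite e2; ring.
  by ring.
apply: (poD TP); last by apply: (poM TP); [exact: (po_sq TP) | exact: (poM TP)].
by apply: (poD TP); [exact: (poD TP) | exact: (poM TP)].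
Qed.

Lemma sos_mulr s c : (forall k, sa k -> sos (k * k * c : A)) -> sos (s : A) -> sos (s * c : A).
Proof.
move=> sqc; elim=> [k sk|u v _ IHu _ IHv]; first exact: sqc.
by move: (sos_add IHu IHv); congr sos; exact/esym/(mulrDl (u : C) v c).
Qed.

Lemma sosM s t : sos (s : A) -> sos (t : A) -> sos (s * t : A).
Proof.
move=> sS; elim=> [l sl|u v _ IHu _ IHv]; last first.
  by move: (sos_add IHu IHv); congr sos; exact/esym/(mulrDr s (u : C) v).
apply: sos_mulr sS => k sk.
have E (p q : C) : (p * q) * (p * q) = (p * p) * (q * q) by ring.
by move: (sos_sq (saM sk sl)); congr sos; exact: (E k l).
Qed.

(* If [- 1 = s + (h^2 - 1/4) t] then [h^(2n) <= t / 4^(n+1)] for all [n], which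
   is impossible when [h] has norm 1. *)
Lemma start_preorder h : sa h -> nr (h : A) = 1 ->
  preorder (fun x : C => exists s t : C, [/\ sos (s : A), sos (t : A)
    & x = s + (h * h - sc 4^-1) * t]).
Proof.
move=> sh h1; have sg : sa (h * h - sc 4^-1).
  by apply: saD; [exact: saM | exact/saN/sa_sc].
set g := h * h - sc 4^-1 in sg *.
have sos0 : sos (0 : A) by rewrite -(cmul0x 0); apply: sos_sq; exact: star0.
split.
- by move=> x [s [t [/(sos_sa A_com) ss /(sos_sa A_com) st ->]]]; exact: (saD ss (saM sg st)).
- move=> x y [s [t [Ts Tt ->]]] [s' [t' [Ts' Tt' ->]]].
  by exists (s + s'), (t + t'); split; [exact: sos_add | exact: sos_add | rewrite mulrDr addrACA].
- move=> x y [s [t [Ts Tt ->]]] [s' [t' [Ts' Tt' ->]]].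
  exists (s * s' + (g * g) * (t * t')), (s * t' + t * s'); split.
  + by apply: sos_add; [exact: sosM | apply: sosM; [exact: sos_sq | exact: sosM]].
  + by apply: sos_add; exact: sosM.
  + by ring.
- by move=> k sk; exists (k * k), 0; split => //; [exact: sos_sq | rewrite mulr0 addr0].
move=> [s [t [sS tS e]]].
have sos_sc r : 0 <= r -> sos (sc r : A).
  by move=> /(@scal_sq R A)[k [sk <-]]; exact: sos_sq.
have sos1s : sos (1 + s : A) by apply: sos_add => //; rewrite -[1]sc1; exact: sos_sc.
have e' : 1 + s = sc 4^-1 * t - h * h * t.
  by have -> : 1 = - (s + g * t); [rewrite -e opprK | rewrite /g; ring].
have bound n : exists w : C, sos (w : A) /\ h ^+ n * h ^+ n + w = sc (4^-1 ^+ n.+1) * t.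
  elim: n => [|n [w [wS hw]]].
    exists (h * h * t + s); split.
      by apply: sos_add => //; apply: sosM => //; exact: sos_sq.
    have E (p q : C) : 1 + (p + q) = 1 + q + p by ring.
    by rewrite !expr0 expr1 mulr1 E e' subrK.
  exists (sc (4^-1 ^+ n.+1) * (1 + s) + h * h * w); split.
    apply: sos_add; first by apply: sosM => //; apply: sos_sc; rewrite exprn_ge0 // invr_ge0.
    by apply: sosM => //; exact: sos_sq.
  rewrite e' [in RHS]exprS scM; set D := sc (4^-1 ^+ n.+1) in hw *.
  have -> : h ^+ n.+1 * h ^+ n.+1 + (D * (sc 4^-1 * t - h * h * t) + h * h * w)
     = h * h * (h ^+ n * h ^+ n + w) + D * (sc 4^-1 * t - h * h * t).
    by rewrite !exprS; ring.
  by rewrite hw; ring.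
(* Exponents [2 ^ j] are used because the C*-identity computes the norm of the square of a
   self-adjoint element. *)
have pow j : sa (h ^+ (2 ^ j)) /\ nr (h ^+ (2 ^ j) : A) = 1.
  elim: j => [|j [IHs IHn]]; first by rewrite expr1.
  rewrite expnS mul2n -addnn exprD; split; first exact: saM.
  by rewrite -[_ * _]/(cmul (h ^+ (2 ^ j) : A) (h ^+ (2 ^ j))) nr_sa_sq // IHn expr1n.
have nt1 : 0 < nr (t : A) + 1 by rewrite ltr_wpDl // nr_ge0.
have [||N hN] := @expr_small R 4^-1 (nr (t : A) + 1)^-1 _ _ ltac:(by rewrite invr_gt0).
- by rewrite invr_ge0.
- by rewrite invf_lt1 // ltr1n.
have [sp np] := pow N; have [w [wS hw]] := bound (2 ^ N)%N.
have := nr_sos_mono A_com sp wS.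
rewrite nr_sa_sq // np expr1n; apply/negP; rewrite -ltNge.
rewrite [cmul _ _ + _]hw [_ * _]cmul_scal nrZr; last by rewrite exprn_ge0 // invr_ge0.
have := hN (2 ^ N).+1 (leqW (ltnW (ltn_expl N (ltnSn 1)))).
move=> /(ler_wpM2r (nr_ge0 (t : A))) /le_lt_trans; apply.
by rewrite mulrC ltr_pdivrMr // mul1r ltrDl.
Qed.

(** For [h] the normalization of [star x] times [x], a total preordering contains [h^2 - 1/4]; a
    character killing [x] would kill [h] and make [- 1/4] nonnegative. Any constant strictly between
    0 and 1 would serve as well as 1/4. *)
Theorem char_separates (x : A) : x <> 0 ->
  exists chi : star_hom A (cplx R), cplx_val (chi x) <> 0.
Proof.
move=> x0; pose y : A := cmul (star x) x.
have sy : star y = y by rewrite /y starM starK.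
have y0 : 0 < nr y.
  rewrite lt_def nr_ge0 andbT; apply/eqP => /nr_eq0 y0; apply: x0.
  exact: starM_eq0.
pose h : C := (nr y)^-1%:C *: y.
have sh : sa h by rewrite starZr sy.
have h1 : nr (h : A) = 1.
  by rewrite nrZr ?invr_ge0 ?nr_ge0 // mulVf // gt_eqF.
have [T [TP T0T Tmax]] := preorder_max (start_preorder sh h1).
have [chi chiP] := preorder_char TP Tmax; exists chi => chix.
have chih : cplx_val (chi h) = 0.
  by rewrite star_homZ star_homM !(cplx_valZ, cplx_valM) chix !mulr0.
have Tg : T (h * h - sc 4^-1).
  apply: T0T; exists 0, 1; split; last by rewrite mulr1 add0r.
    by rewrite -(cmul0x (0 : A)); apply: sos_sq; exact: star0.
  by have := @sos_sq R A cone star1; rewrite cmul1x.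
have [r r0] := chiP _ Tg.
have -> : chi (h * h - sc 4^-1) = cmul (chi h) (chi h) + (- 4^-1%:C) *: cone.
  by rewrite star_homB [chi (h * h)]star_homM [chi (sc _)]star_homZ star_hom1 scaleNr.
have -> : cplx_val (cmul (chi h) (chi h) + (- 4^-1%:C) *: cone) = - 4^-1%:C.
  apply: etrans (cplx_valD _ _) _; apply: etrans (congr2 +%R (cplx_valM _ _)
    (etrans (cplx_valZ _ _) (congr1 _ cplx_val1))) _.
  by rewrite chih mul0r add0r mulr1.
move=> /(congr1 (@complex.Re R)) r4; move: r0.
by rewrite -[r]/(complex.Re r%:C) -r4 raddfN oppr_ge0 leNgt invr_gt0 ltr0n.
Qed.

End Preorderings.

(** * Necessity *)

Section LinearAlgebra.
Context {K : fieldType} {V : lmodType K}.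

Lemma linear_sum m (u : V -> 'rV[K]_m) (I : finType) (c : I -> K) (v : I -> V) :
  linear u -> u (\sum_i c i *: v i) = \sum_i c i *: u (v i).
Proof.
move=> lu.
have u0 : u 0 = 0 by have := lu (-1) 0 0; rewrite scaler0 addr0 scaleN1r addNr.
elim/big_rec2: _ => [|i y x _ <-]; first by [].
by rewrite lu.
Qed.

(** [has_dim] asks for an isomorphism with row vectors. It comes from a row-free matrix [M] of
    maximal height with rows in the image of [u]; the coordinates are read off with [pinvmx M]. *)
Lemma dim_le_inj n (u : V -> 'rV[K]_n) : linear u -> injective u -> dim_le V n.
Proof.
move=> lu iu.
have lsum := fun I c v => @linear_sum n u I c v lu.
pose im (w : 'rV[K]_n) := exists v, u v = w.
pose P r := `[< exists M : 'M[K]_(r, n), row_free M /\ forall i, im (row i M) >].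
have P0 : exists r, P r.
  by exists 0%N; apply/asboolP; exists 0; split=> [|[]//]; rewrite /row_free mxrank0.
have Pn r : P r -> (r <= n)%N.
  by move=> /asboolP[M [fM _]]; rewrite -(eqP fM) rank_leq_col.
case: (ex_maxnP P0 Pn) => r /asboolP[M [fM imM]] rmax.
have sub a : (u a <= M)%MS.
  apply: contraT => naM; have : P (r + 1)%N.
    apply/asboolP; exists (col_mx M (u a)); split.
      have rM := eqP fM; rewrite -row_leq_rank -addsmxE addn1.
      suff : (\rank M < \rank (M + u a)%MS)%N by rewrite rM.
      by rewrite rank_ltmx // ltmxE addsmxSl addsmx_sub submx_refl naM.
    move=> i; rewrite -(splitK i); case: (fintype.split i) => j /=.
      by rewrite rowKu; exact: imM.
    by rewrite rowKd row_id; exists a.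
  by move/rmax; rewrite addn1 ltnn.
have [v hv] := choice imM.
exists r; first by apply: Pn; apply/asboolP; exists M.
constructor; exists (fun a => u a *m pinvmx M).
  by move=> k a b; rewrite lu mulmxDl scalemxAl.
exists (fun c : 'rV_r => \sum_i c 0 i *: v i).
  move=> a; apply: iu; rewrite lsum -[RHS](mulmxKpV (sub a)).
  rewrite [RHS](mulmx_sum_row (u a *m pinvmx M) M).
  by apply: eq_bigr => i _; rewrite hv.
move=> c; rewrite lsum; under eq_bigr do rewrite hv.
by rewrite -mulmx_sum_row mulmxKp.
Qed.

Lemma indep_card_le n m (u : V -> 'rV[K]_n) (p : 'I_m -> V) : linear u -> injective u ->
  (forall c : 'rV[K]_m, \sum_i c 0 i *: p i = 0 -> c = 0) -> (m <= n)%N.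
Proof.
move=> lu iu ind; pose M := \matrix_i u (p i).
suff /eqP <- : row_free M by exact: rank_leq_col.
apply/inj_row_free => c; rewrite mulmx_sum_row => cM; apply: ind; apply: iu.
rewrite linear_sum // -[u 0](_ : 0 = _); last first.
  by have := lu (-1) 0 0; rewrite scaler0 addr0 scaleN1r addNr.
by rewrite -[RHS]cM; apply: eq_bigr => i _; rewrite rowK.
Qed.

End LinearAlgebra.

(** * Functions constant on the blocks of a finite partition *)

Section FiniteLevels.
Context {R : realType} (S : Type).
Local Notation B := (linf (fun _ : S => cplx R)).
Local Notation ev := (@linf_ev R S (fun _ => cplx R)).

Definition level (T : finType) (q : S -> T) (x : B) : Prop :=
  forall s s', q s = q s' -> ev s x = ev s' x.

Lemma level_subalg (T : finType) (q : S -> T) : is_subalg (level q).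
Proof.
split.
- by move=> s s' _; rewrite !star_hom1.
- by move=> x y qx qy s s' ss'; rewrite !star_homD (qx _ _ ss') (qy _ _ ss').
- by move=> k x qx s s' ss'; rewrite !star_homZ (qx _ _ ss').
- by move=> x y qx qy s s' ss'; rewrite !star_homM (qx _ _ ss') (qy _ _ ss').
- by move=> x qx s s' ss'; rewrite !star_hom_star (qx _ _ ss').
Qed.

Lemma level_closed (T : finType) (q : S -> T) : seq_closed (level q).
Proof.
move=> u l qu ul s s' ss'.
apply: (seq_cvg_unique (seq_cvg_star_hom (ev s) ul)).
have := seq_cvg_star_hom (ev s') ul.
by rewrite (_ : ev s' \o u = ev s \o u) //; apply/funext => n; exact/esym/(qu n _ _ ss').
Qed.

(** The index set consists of the subalgebras themselves, since refinement of the maps [q] is only a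
    preorder and the diagram must be indexed by a poset. *)
Definition levels : Type :=
  {P : B -> Prop | exists (T : finType) (q : S -> T), P = level q}.

HB.instance Definition _ := gen_eqMixin levels.
HB.instance Definition _ := gen_choiceMixin levels.

Definition levels_le (i j : levels) : bool := `[< forall x, sval i x -> sval j x >].

Lemma levels_le_refl : reflexive levels_le.
Proof. by move=> i; apply/asboolP. Qed.

Lemma levels_le_anti : antisymmetric levels_le.
Proof.
move=> [P HP] [Q HQ] /andP[/asboolP /= PQ /asboolP /= QP].
by apply: eq_exist; apply/funext => x; apply/propext; split; [exact: PQ | exact: QP].
Qed.

Lemma levels_le_trans : transitive levels_le.
Proof.
by move=> j i k /asboolP ij /asboolP jk; apply/asboolP => x /ij /jk.
Qed.

HB.instance Definition _ := Order.Le_isPOrder.Build (Order.Disp tt tt) levels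
  levels_le_refl levels_le_anti levels_le_trans.

Definition to_levels (T : finType) (q : S -> T) : levels :=
  exist _ (level q) (ex_intro _ T (ex_intro _ q erefl)).

Lemma levels_directed : directed levels.
Proof.
split; first by constructor; exact: (to_levels (fun=> tt)).
move=> [P [T [q Pq]]] [Q [T' [q' Qq']]].
exists (to_levels (fun s => (q s, q' s))).
by split; apply/asboolP => x /=; rewrite ?Pq ?Qq' => qx s s' [qs qs']; exact: qx.
Qed.

End FiniteLevels.

Section FiniteNet.
Context {R : realType}.

Lemma grid (d : R) (K : nat) (x : R) : 0 <= d -> 0 <= x -> x <= K%:R * d ->
  exists k : 'I_K.+1, `|x - k%:R * d| <= d.
Proof.
move=> d0; elim: K => [|K IH] x0 xK.
  exists ord0; rewrite mul0r in xK.
  have -> : x = 0 by apply/le_anti; rewrite xK x0.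
  by rewrite mul0r subr0 normr0.
have [xk|kx] := leP x (K%:R * d).
  have [k hk] := IH x0 xk; by exists (widen_ord (leqnSn _) k).
exists (inord K); rewrite inordK ?leqnSn // ger0_norm ?subr_ge0 ?(ltW kx) //.
by rewrite lerBlDl -[X in _ + X]mul1r -mulrDl natr1.
Qed.

Lemma finite_net (M e : R) : 0 < e -> exists (T : finType) (v : T -> R[i]),
  forall z, cmod z <= M -> exists t, cmod (z - v t) <= e.
Proof.
(* A square grid with coordinate error [e / 2] has error at most [e / sqrt 2] in the plane. *)
move=> e0; pose d := e / 2; have d0 : 0 < d by rewrite divr_gt0.
pose K := Num.bound (2 * `|M| / d).
have KM : 2 * `|M| <= K%:R * d.
  rewrite -ler_pdivrMr //; apply: ltW; apply: archi_boundP.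
  by apply: divr_ge0; [exact: mulr_ge0 | exact: ltW].
have near (x : R) : `|x| <= `|M| -> exists k : 'I_K.+1, `|x - (k%:R * d - `|M|)| <= d.
  rewrite ler_norml => /andP[x1 x2].
  have [|||k hk] := @grid d K (x + `|M|); rewrite ?(ltW d0) //.
  - by rewrite -lerBlDr sub0r.
  - by apply: le_trans KM; rewrite mulr_natl mulr2n lerD.
  by exists k; rewrite opprD opprK addrA addrAC.
exists ('I_K.+1 * 'I_K.+1)%type.
exists (fun k : 'I_K.+1 * 'I_K.+1 => Complex ((k.1 : nat)%:R * d - `|M|) ((k.2 : nat)%:R * d - `|M|)) => z zM.
have zM' : cmod z <= `|M| by rewrite (le_trans zM) // ler_norm.
have [k hk] := near _ (le_trans (Re_le_cmod z) zM').
have [l hl] := near _ (le_trans (Im_le_cmod z) zM').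
exists (k, l); rewrite -ler_sqr ?nnegrE ?cmod_ge0 ?(ltW e0) // cmod2E /=.
move: hk hl; case: z {zM zM'} => x y /=; rewrite !ler_norml /d.
set a := _ - `|M|; set b := _ - `|M| => /andP[? ?] /andP[? ?]; nra.
Qed.

End FiniteNet.

(** * Bounds on the dimension of a generated algebra *)

Section Generated.
Context {R : realType} {A : cstarAlgType R[i]} (A_com : cstar_commutative A).
Local Notation S := (star_hom A (cplx R)).

Lemma char_ext (x : A) : (forall s : S, s x = 0) -> x = 0.
Proof.
move=> sx; apply: contrapT => x0; have [s] := char_separates A_com x0.
by rewrite sx cplx_val0.
Qed.

(** An element of [A] is determined by its values at one character in each nonempty fibre of [q];
    the coordinate of an empty fibre is set to 0. *)
Lemma level_finite_dim (T : finType) (q : S -> T)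
    (f : star_hom A (linf (fun _ : S => cplx R))) :
  (forall a s, linf_ev s (f a) = s a) -> (forall a, level q (f a)) ->
  dim_le A #|T|.
Proof.
move=> fE fq.
have /choice[r hr] : forall t, exists o : option S,
    if o is Some s then q s = t else forall s, q s <> t.
  move=> t; have [[s st]|nt] := pselect (exists s, q s = t); first by exists (Some s).
  by exists None => s st; apply: nt; exists s.
pose c a t : R[i] := if r t is Some s then cplx_val (s a) else 0.
apply: (@dim_le_inj _ _ _ (fun a => \row_(i < #|T|) c a (enum_val i))).
  move=> k a b; apply/rowP => i; rewrite !mxE /c; case: (r _) => [s|].
    by rewrite star_homD star_homZ cplx_valD; congr (_ + _); exact: cplx_valZ.
  by rewrite mulr0 addr0.
move=> a b ab; apply/eqP; rewrite -subr_eq0; apply/eqP/char_ext => s.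
rewrite star_homB; apply/eqP; rewrite subr_eq0; apply/eqP.
move/rowP: ab => /(_ (enum_rank (q s))); rewrite !mxE enum_rankK /c.
have := hr (q s); case: (r _) => [s' ss' /cplx_val_inj|/(_ s)//].
by rewrite -!fE (fq a _ _ ss') (fq b _ _ ss').
Qed.

Lemma com_aleph0_finite_dim :
  aleph0_generated (@com_cstar_embedding R[i]) (exist _ A A_com : com_cstar_cat R[i]) ->
  finite_dimensional A.
Proof.
move=> Agen; have [f fE] := linf_pair (fun s : S => s).
(* The values of [a] on the characters lie in the disc of radius [nr a]; rounding them to a finite
   net gives a function with finitely many values within [e] of [f a]. *)
have fclos a : seq_closure (fun x => exists i : levels S, sval i x) (f a).
  move=> e e0; have [T [v hv]] := finite_net (nr a) e0.
  have /choice[q hq] : forall s : S, exists t, cmod (cplx_val (s a) - v t) <= e.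
    by move=> s; apply: hv; rewrite -nr_cplx star_hom_contract.
  have bnd (s : S) : nr (in_cplx (v (q s))) <= nr a + e.
    rewrite nr_cplx in_cplxK -[v _](subKr (cplx_val (s a))).
    apply: le_trans (cmodD _ _) _; rewrite cmodN lerD //.
    by rewrite -nr_cplx star_hom_contract.
  have [b hb] := linf_tuple bnd.
  exists b; split.
    by exists (to_levels q) => s s' ss'; rewrite !hb ss'.
  apply: nr_linf (ltW e0) _ => s; rewrite star_homB fE hb nr_cplx.
  have -> : s a - in_cplx (v (q s)) = in_cplx (cplx_val (s a) - v (q s)); last first.
    by rewrite in_cplxK.
  rewrite -[X in X - _]cplx_valK -(scaleN1r (in_cplx _)) -in_cplxZ -in_cplxD.
  by rewrite mulN1r.
have [||||[P [T [q Pq]]] HP] := @com_aleph0_range R _ _ (levels S) (fun i => sval i)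
  (levels_directed S) _ _ _ A f fclos A_com _ Agen.
- by move=> [P [T [q Pq]]] /=; rewrite Pq; exact: level_subalg.
- by move=> [P [T [q Pq]]] /=; rewrite Pq; exact: level_closed.
- by move=> i j x /asboolP ij; exact: ij.
- by apply: linf_com => s; exact: cplx_com.
have [|n _ An] := @level_finite_dim T q f fE; last by exists n.
by move=> a; rewrite -Pq; exact: HP.
Qed.

(** The partition into a single block. The case without characters, that of the zero algebra, is
    included. *)
Lemma one_char_dim_le : (forall s s' : S, s = s') -> dim_le A 1.
Proof.
move=> one; have [f fE] := linf_pair (fun s : S => s).
rewrite -(card_unit); apply: (@level_finite_dim unit (fun=> tt) f fE).
by move=> a s s' _; rewrite (one s s').
Qed.

(** The orthogonal projection onto the line spanned by the vector [(1, t)]. *)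
Definition rotproj (t : R) : 'M[R[i]]_2 :=
  \matrix_(i, j) ((1 + t ^+ 2)^-1 * t ^+ (i + j))%:C.

Lemma den_neq0 (t : R) : 1 + t ^+ 2 != 0.
Proof. by rewrite gt_eqF // ltr_pwDl // sqr_ge0. Qed.

Lemma rotproj_idem t : rotproj t *m rotproj t = rotproj t.
Proof.
apply/matrixP => i j; rewrite !mxE !big_ord_recl big_ord0 !mxE addr0 /=.
rewrite -!rmorphM -rmorphD /=; congr (_%:C); rewrite /bump /= addn0 add0n.
rewrite !exprD expr1 !expr0 !mulr1; move: (t ^+ i) (t ^+ j) => a b.
by field; exact: den_neq0.
Qed.

Lemma rotproj_adj t : mxadj (rotproj t) = rotproj t.
Proof. by apply/matrixP => i j; rewrite !mxE conjcE conjc_real addnC. Qed.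

Lemma rotproj_dist t : 0 <= t -> t <= 1 -> entry_sum (rotproj t - rotproj 0) <= 4 * t.
Proof.
move=> t0 t1; have d0 := den_neq0 t.
have dp : 0 < 1 + t ^+ 2 by rewrite ltr_pwDl // sqr_ge0.
have H (i j : 'I_2) : cmod ((rotproj t - rotproj 0) i j) <= t.
  rewrite !mxE -rmorphB cmodR expr0n /= addr0 invr1 mul1r.
  case: i j => [[|[|//]] ?] [[|[|//]] ?] /=; rewrite ?addn0 ?add0n ?expr0n ?expr0 ?expr1 /=.
  - rewrite mulr1 (_ : _ - 1 = - (t ^+ 2 / (1 + t ^+ 2))); last by field.
    rewrite normrN ger0_norm ?divr_ge0 ?sqr_ge0 ?(ltW dp) // ler_pdivrMr //; nra.
  - rewrite subr0 ger0_norm ?mulr_ge0 ?invr_ge0 ?(ltW dp) // mulrC ler_pdivrMr //; nra.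
  - rewrite subr0 ger0_norm ?mulr_ge0 ?invr_ge0 ?(ltW dp) // mulrC ler_pdivrMr //; nra.
  - rewrite subr0 ger0_norm ?mulr_ge0 ?invr_ge0 ?exprn_ge0 ?(ltW dp) // mulrC ler_pdivrMr //; nra.
rewrite /entry_sum !big_ord_recl !big_ord0 !addr0.
by have := H ord0 ord0; have := H ord0 (lift ord0 ord0); have := H (lift ord0 ord0) ord0;
  have := H (lift ord0 ord0) (lift ord0 ord0); lra.
Qed.

Lemma rotproj_inj t t' : 0 <= t -> 0 <= t' -> rotproj t = rotproj t' -> t = t'.
Proof.
move=> t0 t0' /matrixP/(_ 0 0); rewrite !mxE /= addn0 !expr0 !mulr1 => /complexI/invr_inj.
by move/addrI => tt'; apply/eqP; rewrite -(@eqrXn2 _ 2) // tt'.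
Qed.

Lemma in_mxalgB (x y : 'M[R[i]]_2) : in_mxalg (x - y) = in_mxalg x - in_mxalg y.
Proof. by rewrite -(scaleN1r y) in_mxalgD in_mxalgZ scaleN1r. Qed.

Lemma two_char_hom (s s' : S) (t : R) : exists f : star_hom A (mxalg R 2), forall x,
  f x = in_mxalg (cplx_val (s x) *: rotproj t + cplx_val (s' x) *: (1%:M - rotproj t)).
Proof.
pose p := rotproj t; pose q := 1%:M - p.
have pp : p *m p = p := rotproj_idem t.
have pq : p *m q = 0 by rewrite mulmxBr mulmx1 pp subrr.
have qp : q *m p = 0 by rewrite mulmxBl mul1mx pp subrr.
have qq : q *m q = q by rewrite {2}/q mulmxBr mulmx1 qp subr0.
have ps : mxadj p = p := rotproj_adj t.
have qs : mxadj q = q.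
  have N1 : (-1 : R[i])^*%R = -1 by rewrite rmorphN rmorph1.
  rewrite /q -(scaleN1r p) mxadjD mxadjZ ps N1; congr (_ + _).
  by apply/matrixP => i j; rewrite !mxE eq_sym conjC_nat.
unshelve eexists; first (exists (fun x => in_mxalg (cplx_val (s x) *: p + cplx_val (s' x) *: q))).
- move=> x y; rewrite -in_mxalgD !star_homD !cplx_valD !scalerDl; congr in_mxalg.
  by rewrite addrACA.
- move=> k x.
  have E (c : S) : cplx_val (c (k *: x)) = k * cplx_val (c x).
    by rewrite star_homZ; exact: cplx_valZ.
  by rewrite !E -!scalerA -scalerDr in_mxalgZ.
- have E (c : S) : cplx_val (c cone) = 1 by rewrite star_hom1; exact: cplx_val1.
  by rewrite !E !scale1r /q addrC subrK; exact: in_mxalg1.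
- move=> x y.
  have E (c : S) : cplx_val (c (cmul x y)) = cplx_val (c x) * cplx_val (c y).
    by rewrite star_homM; exact: cplx_valM.
  rewrite !E -[RHS]in_mxalgM; apply: (congr1 in_mxalg).
  rewrite mulmxDl !mulmxDr -!scalemxAl -!scalemxAr pp pq qp qq !scaler0 addr0 add0r.
  by rewrite !scalerA.
- move=> x.
  have E (c : S) : cplx_val (c (star x)) = (cplx_val (c x))^*%R.
    by rewrite star_hom_star; exact: cplx_valS.
  rewrite !E -[RHS]in_mxalgS; apply: (congr1 in_mxalg).
  by rewrite mxadjD !mxadjZ ps qs.
- by [].
Qed.

Lemma aleph0_dim_le1 :
  aleph0_generated (@cstar_embedding R[i]) (A : cstar_cat R[i]) -> dim_le A 1.
Proof.
move=> Agen; apply: one_char_dim_le => s s'; apply: contrapT => ss'.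
have [a sa] : exists a, s a <> s' a.
  by apply: contrapT => n; apply: ss'; apply: star_hom_ext => x;
    apply: contrapT => nx; apply: n; exists x.
(* The lines spanned by [(1, t n)] are pairwise distinct and tend to the first axis. *)
pose t (n : nat) : R := n.+1%:R^-1.
have t0 n : 0 <= t n by rewrite invr_ge0.
have t1 n : t n <= 1 by rewrite invf_le1 ?ler1n ?ltr0n.
have hom_t u := cid (two_char_hom s s' u).
pose F := fun _ : nat => mxalg R 2.
have [f fE] := @linf_pair R nat F A (fun n => sval (hom_t (t n))).
have fE' x n : linf_ev n (f x) = in_mxalg (cplx_val (s x) *: rotproj (t n)
    + cplx_val (s' x) *: (1%:M - rotproj (t n))).
  by rewrite fE; exact: (svalP (hom_t (t n))).
pose P (N : nat) (x : linf F) := forall n, (N <= n)%N -> linf_ev n x = linf_ev N x.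
have P_sub N : is_subalg (P N).
  split.
  - by move=> n _; rewrite !star_hom1.
  - by move=> x y Px Py n Nn; rewrite !star_homD (Px n Nn) (Py n Nn).
  - by move=> k x Px n Nn; rewrite !star_homZ (Px n Nn).
  - by move=> x y Px Py n Nn; rewrite !star_homM (Px n Nn) (Py n Nn).
  - by move=> x Px n Nn; rewrite !star_hom_star (Px n Nn).
have P_closed N : seq_closed (P N).
  move=> u l Pu ul n Nn; apply: (seq_cvg_unique (seq_cvg_star_hom (linf_ev n) ul)).
  have := seq_cvg_star_hom (linf_ev N) ul.
  by rewrite (_ : linf_ev n \o u = linf_ev N \o u) //; apply/funext => m; exact: (Pu m n Nn).
have P_mono (M N : nat) x : (M <= N)%O -> P M x -> P N x.
  rewrite leEnat => MN Px n Nn; apply: etrans (Px n (leq_trans MN Nn)) _.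
  exact: (esym (Px N MN)).
have nat_dir : directed nat.
  split; first by constructor; exact: 0%N.
  by move=> m n; exists (maxn m n); rewrite !leEnat leq_maxl leq_maxr.
have fclos x : seq_closure (fun y => exists N, P N y) (f x).
  move=> e e0; pose c := cplx_val (s x) - cplx_val (s' x).
  (* The value at [x] of the limiting homomorphism; the approximant [y] keeps the terms of [f x]
     before [N] and continues with [g0]. *)
  pose g0 := sval (hom_t 0) x.
  have g0E : g0 = in_mxalg (cplx_val (s x) *: rotproj 0 + cplx_val (s' x) *: (1%:M - rotproj 0)).
    exact: (svalP (hom_t 0)).
  have dist n : nr (linf_ev n (f x) - g0) <= cmod c * (4 * t n).
    have -> : linf_ev n (f x) - g0 = c *: in_mxalg (rotproj (t n) - rotproj 0).
      rewrite fE' g0E; apply: etrans (esym (in_mxalgB _ _)) _.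
      apply: etrans _ (in_mxalgZ _ _); apply: congr1; rewrite /c; apply/matrixP => i j.
      by rewrite !mxE; ring.
    rewrite nrZ ler_wpM2l ?cmod_ge0 // (le_trans (nr_in_mxalg _)) //.
    exact: rotproj_dist.
  pose N := Num.bound (cmod c * 4 / e).
  have hN n : (N <= n)%N -> cmod c * (4 * t n) <= e.
    move=> Nn; rewrite mulrA ler_pdivrMr ?ltr0n // -ler_pdivrMl // [e^-1 * _]mulrC.
    apply: le_trans (_ : N%:R <= _); last by rewrite ler_nat leqW.
    by apply: ltW; apply: archi_boundP;
      apply: divr_ge0; [rewrite mulr_ge0 ?cmod_ge0 | exact: ltW].
  have bnd n : nr (if (n < N)%N then linf_ev n (f x) else g0) <= nr x.
    case: ifP => _; last exact: star_hom_contract.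
    by apply: le_trans (star_hom_contract _ _) _; exact: star_hom_contract.
  have [y hy] := @linf_tuple R nat F _ _ bnd.
  exists y; split.
    by exists N => n Nn; rewrite !hy ltnn ltnNge Nn.
  apply: nr_linf (ltW e0) _ => n; rewrite star_homB hy; case: ltnP => nN.
    by rewrite subrr nr0 ltW.
  exact: le_trans (dist n) (hN n nN).
have [N hN] := @aleph0_range R (linf F) _ nat P nat_dir P_sub P_closed P_mono A f fclos Agen.
(* Constancy of [f a] from [N] on is contradicted at [N.+1]: since [s a] and [s' a] differ, the two
   projections can be recovered and would coincide. *)
have := hN a N.+1 (leqnSn N); rewrite !fE' => /in_mxalg_inj E.
have c0 : cplx_val (s a) - cplx_val (s' a) != 0.
  by rewrite subr_eq0; apply/eqP => /cplx_val_inj.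
have E' : rotproj (t N.+1) = rotproj (t N).
  have D (a1 a2 : R[i]) (P1 P2 : 'M[R[i]]_2) :
      a1 *: P1 + a2 *: (P2 - P1) = (a1 - a2) *: P1 + a2 *: P2.
    by rewrite scalerBr scalerBl addrA addrAC.
  by move: E; rewrite !D => /addIr /(scalerI c0).
have := rotproj_inj (t0 _) (t0 _) E' => /invr_inj /eqP.
by rewrite eqr_nat gtn_eqF.
Qed.

End Generated.

(** * Sufficiency *)

Section Converse.
Context {R : realType}.

(** In a directed colimit of sets, two elements of a stage may merge at a later one. Connecting maps
    that are embeddings exclude this, so the criterion asks that each leg be injective on
    homomorphisms out of [c], along with joint surjectivity. *)
Lemma aleph0_intro (C : category) (M : morphism_class C) (c : C) :
  (forall (d : Order.disp_t) (I : porderType d) (F : functor (poset_cat I) C)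
     (K : cocone F), directed I ->
     (forall (i j : poset_cat I) (ij : hom i j), M _ _ (fmap F ij)) ->
     is_colimit K ->
     (forall f : hom c (apex K), exists i (g : hom c (F i)), f = comp (leg K i) g) /\
     (forall i (g g' : hom c (F i)), comp (leg K i) g = comp (leg K i) g' -> g = g')) ->
  aleph0_generated M c.
Proof.
move=> H d I F dirI FM K colK L.
have [surj inj] := H d I F K dirI FM colK.
have wd i j (g : hom c (F i)) (g' : hom c (F j)) :
    comp (leg K i) g = comp (leg K j) g' -> leg L i g = leg L j g'.
  case: dirI => _ dI gg'; have [k [ik jk]] := dI i j.
  rewrite -(legP L (ik : @hom (poset_cat I) i k)) -(legP L (jk : @hom (poset_cat I) j k)).
  rewrite /=; congr (leg L k _); apply: inj; rewrite !compmA.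
  by rewrite (legP K (ik : @hom (poset_cat I) i k)) (legP K (jk : @hom (poset_cat I) j k)).
have /choice[u hu] : forall f : hom c (apex K), exists y : (apex L : Type),
    forall i (g : hom c (F i)), f = comp (leg K i) g -> leg L i g = y.
  by move=> f; have [i [g ->]] := surj f; exists (leg L i g) => j g' /esym; exact: wd.
exists u; split; first by move=> j; apply/funext => g /=; exact/esym/hu.
move=> v vL; apply/funext => f; have [i [g fg]] := surj f.
by rewrite -(hu _ _ _ fg) fg -(vL i).
Qed.

Lemma dim_le1_scalar (A : cstarAlgType R[i]) : dim_le A 1 ->
  forall x : A, exists k : R[i], x = k *: cone.
Proof.
move=> [n n1 [[u lu [v uv vu]]]] x.
have u0 : u 0 = 0 by have := lu (-1) 0 0; rewrite scaler0 addr0 scaleN1r addNr.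
have uZ k y : u (k *: y) = k *: u y by rewrite -[k *: y]addr0 lu u0 addr0.
case: n n1 u lu v uv vu u0 uZ => [|[|//]] _ u lu v uv vu u0 uZ.
  by exists 0; rewrite scale0r -(uv x) -(uv 0); congr v; apply/rowP => -[].
have [c0|c0] := eqVneq (u cone 0 0) 0.
  exists 0; rewrite scale0r -(cmulx1 x) (_ : cone = 0) ?cmulx0 //.
  by rewrite -(uv cone) -(uv 0) u0; congr v; apply/rowP => i; rewrite ord1 c0 mxE.
exists (u x 0 0 / u cone 0 0); apply: (can_inj uv); rewrite uZ.
by apply/rowP => i; rewrite ord1 mxE divfK.
Qed.

(** The norm of a projection equals its own square, hence is 0 or 1. *)
Lemma nr_proj_lt1 (A : cstarAlgType R[i]) (p : A) : star p = p -> cmul p p = p ->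
  nr p < 1 -> p = 0.
Proof.
move=> sp pp p1; apply: nr_eq0; apply/eqP; apply: contraLR p1 => p0.
have : nr p = nr p ^+ 2 by rewrite -nr_sa_sq // pp.
by rewrite expr2 -{1}[nr p]mulr1 => /(mulfI p0) <-; rewrite ltxx.
Qed.

Section Cocone.
Context {d : Order.disp_t} {I : porderType d}.
Context (F : functor (poset_cat I) (cstar_cat R[i])) (dirI : directed I).
Context (Finj : forall (i j : poset_cat I) (ij : hom i j), cstar_embedding (fmap F ij)).

(** If [p] dies under [lam i], its image at a later stage has norm at most 1/2 and is a projection,
    hence zero; the connecting map being injective, [p] is zero. *)
Lemma projection_survives (L : cstarAlgType R[i]) (lam : forall i : I, star_hom (F i) L)
    (i : I) (p : F i : cstarAlgType R[i]) :
  (forall (i : I) (x : F i : cstarAlgType R[i]) (c : R), nr (lam i x) < c ->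
      exists (j : I) (ij : (i <= j)%O),
        nr ((fmap F (ij : @hom (poset_cat I) i j) : star_hom _ _) x) <= c) ->
  star p = p -> cmul p p = p -> lam i p = 0 -> p = 0.
Proof.
move=> lamP sp pp p0.
have [|j [ij pj]] := lamP i p 2^-1; first by rewrite p0 nr0 invr_gt0.
set phi := fmap _ _ in pj; have phi_inj : injective phi := @Finj i j ij.
apply: phi_inj; rewrite star_hom0; apply: nr_proj_lt1.
- by rewrite -star_hom_star sp.
- by rewrite -star_homM pp.
- by rewrite (le_lt_trans pj) // invf_lt1 // ltr1n.
Qed.

End Cocone.

(** Homomorphisms out of [A] are unique, and a nonzero [A] maps to every stage. If [A] is zero, a
    homomorphism to the colimit forces the colimit to be zero; the unit of a stage is then a
    projection that dies, so the stage is zero and receives a map. *)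
Lemma dim_le1_aleph0 (A : cstarAlgType R[i]) : dim_le A 1 ->
  aleph0_generated (@cstar_embedding R[i]) (A : cstar_cat R[i]).
Proof.
move=> /dim_le1_scalar A1; apply: aleph0_intro => d I F K dirI Finj colK.
have hom_uniq (B : cstarAlgType R[i]) (f g : star_hom A B) : f = g.
  by apply: star_hom_ext => x; have [k ->] := A1 x; rewrite !star_homZ !star_hom1.
split; last by move=> i g g' _; exact: hom_uniq.
move=> f; suff [i [g _]] : exists (i : I) (g : star_hom A (F i)), True.
  by exists i, g; exact: hom_uniq.
have [c0|/eqP c0] := pselect ((cone : A) = 0).
  have [L [lam [lamE lamP _]]] := directed_system_cocone F dirI.
  pose LL : cocone F := @Cocone _ _ F (L : cstar_cat R[i]) lam
    (fun i j ij => @star_hom_ext _ _ _ (star_hom_comp (lam j) (fmap F ij)) (lam i) (lamE i j ij)).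
  have [u [uE _]] := colK LL; pose u' : star_hom (apex K) L := u.
  have K0 : cone = 0 :> (apex K : cstarAlgType R[i]).
    by rewrite -(star_hom1 (f : star_hom A (apex K))) c0 star_hom0.
  have L0 : (cone : L) = 0 by rewrite -(star_hom1 u') K0 star_hom0.
  have [[i0] _] := dirI; exists i0.
  have F0 : (cone : (F i0 : cstarAlgType R[i])) = 0.
    apply: (projection_survives Finj lamP); rewrite ?star1 ?cmul1x //.
    by rewrite star_hom1.
  unshelve eexists; last by [].
  exists (fun=> 0).
  - by move=> x y; rewrite addr0.
  - by move=> k x; rewrite scaler0.
  - by rewrite F0.
  - by move=> x y; rewrite cmul0x.
  - by move=> x; rewrite star0.
have [[i0] _] := dirI; exists i0.
have [k hk] := choice A1.
have kI a b : a *: (cone : A) = b *: (cone : A) -> a = b.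
  by move/eqP; rewrite -subr_eq0 -scalerBl scaler_eq0 (negbTE c0) orbF subr_eq0 => /eqP.
unshelve eexists; last by [].
exists (fun x => k x *: cone).
- by move=> x y; rewrite -scalerDl; congr (_ *: _); apply: kI; rewrite scalerDl -!hk.
- by move=> l x; rewrite scalerA; congr (_ *: _); apply: kI; rewrite -scalerA -!hk.
- by rewrite (_ : k cone = 1) ?scale1r //; apply: kI; rewrite scale1r -hk.
- move=> x y; rewrite -cscalerAl cmul1x scalerA; congr (_ *: _); apply: kI.
  by rewrite -scalerA -hk -(hk y) {1}(hk x) -cscalerAl cmul1x.
- move=> x; rewrite starZ star1; congr (_ *: _); apply: kI.
  by rewrite -hk {1}(hk x) starZ star1.
Qed.

End Converse.

(** * The projections spanning a finite-dimensional commutative algebra *)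

Section FiniteDimensional.
Context {R : realType} {A : cstarAlgType R[i]} (A_com : cstar_commutative A).
Local Notation C := (comring A_com).
Local Notation S := (star_hom A (cplx R)).

Definition cv (s : S) (x : C) : R[i] := cplx_val (s x).

Lemma cvD s x y : cv s (x + y) = cv s x + cv s y.
Proof. by rewrite /cv star_homD cplx_valD. Qed.
Lemma cvZ s k x : cv s (k *: x) = k * cv s x.
Proof. by rewrite /cv star_homZ; exact: cplx_valZ. Qed.
Lemma cvM s x y : cv s (x * y) = cv s x * cv s y.
Proof. by rewrite /cv star_homM; exact: cplx_valM. Qed.
Lemma cv1 s : cv s 1 = 1.
Proof. by rewrite /cv star_hom1; exact: cplx_val1. Qed.
Lemma cvS s x : cv s (star (x : A)) = (cv s x)^*%R.
Proof. by rewrite /cv star_hom_star; exact: cplx_valS. Qed.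
Lemma cv0 s : cv s 0 = 0.
Proof. by rewrite /cv star_hom0; exact: cplx_val0. Qed.
Lemma cvN s x : cv s (- x) = - cv s x.
Proof. by apply/eqP; rewrite -addr_eq0 -cvD addNr cv0. Qed.
Lemma cv_sum s (J : finType) (f : J -> C) : cv s (\sum_j f j) = \sum_j cv s (f j).
Proof. by apply: (big_morph (cv s)); [exact: cvD | exact: cv0]. Qed.
Lemma cv_prod s (J : finType) (P : pred J) (f : J -> C) :
  cv s (\prod_(j | P j) f j) = \prod_(j | P j) cv s (f j).
Proof. by apply: (big_morph (cv s)); [exact: cvM | exact: cv1]. Qed.

Lemma cv_ext (x y : C) : (forall s, cv s x = cv s y) -> x = y.
Proof.
move=> xy; apply/eqP; rewrite -subr_eq0; apply/eqP/(char_ext A_com) => s.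
by apply: cplx_val_inj; rewrite cplx_val0 -[LHS]/(cv s (x - y)) cvD cvN xy subrr.
Qed.

(** Lagrange interpolation: [p j] is the product over [i != j] of elements with value 0 at [chi i]
    and 1 at [chi j]. *)
Lemma lagrange m (chi : 'I_m -> S) : injective chi ->
  exists p : 'I_m -> C, forall i j, cv (chi i) (p j) = (i == j)%:R.
Proof.
move=> chi_inj.
have sep i j : exists a : C, i != j -> cv (chi i) a = 0 /\ cv (chi j) a = 1.
  have [->|ij] := eqVneq i j; first by exists 0.
  have [b hb] : exists b : C, cv (chi i) b != cv (chi j) b.
    apply: contrapT => nb; case/eqP: ij; apply: chi_inj; apply: star_hom_ext => x.
    apply: cplx_val_inj; apply: contrapT => nx; apply: nb; exists x; exact/eqP.
  exists ((cv (chi j) b - cv (chi i) b)^-1 *: (b - cv (chi i) b *: (1 : C))) => _.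
  rewrite !cvZ !cvD !cvN !cvZ !cv1 !mulr1 subrr mulr0; split => //.
  by rewrite mulVf // subr_eq0 eq_sym.
pose a i j := sval (cid (sep i j)).
have aP i j : i != j -> cv (chi i) (a i j) = 0 /\ cv (chi j) (a i j) = 1.
  exact: (svalP (cid (sep i j))).
exists (fun j => \prod_(i | i != j) a i j) => i j; rewrite cv_prod.
have [->|ij] := eqVneq i j; first by rewrite big1 // => k /aP[].
by rewrite (bigD1 i) //= (aP i j ij).1 mul0r.
Qed.

(** Lagrange elements are linearly independent, so the dimension bounds the number of distinct
    characters. A maximal family contains all of them, and since characters separate points, [x]
    equals its interpolation. *)
Lemma finite_dim_projections : finite_dimensional A ->
  exists m (chi : 'I_m -> S) (p : 'I_m -> A),
    (forall i j, cv (chi i) (p j) = (i == j)%:R) /\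
    (forall x : A, x = \sum_i cv (chi i) x *: p i).
Proof.
move=> [n [[u lu [v uv _]]]].
pose P m := `[< exists chi : 'I_m -> S, injective chi >].
have P0 : exists m, P m.
  exists 0%N; apply/asboolP.
  have f (i : 'I_0) : S by case: i.
  by exists f => -[].
have Pn m : P m -> (m <= n)%N.
  move=> /asboolP[chi /lagrange[p pP]].
  apply: (@indep_card_le _ _ _ _ u p lu (can_inj uv)) => c cp; apply/rowP => i.
  rewrite mxE -(cv0 (chi i)) -[in RHS]cp cv_sum (bigD1 i) //= big1 => [|j ji].
    by rewrite cvZ pP eqxx mulr1 addr0.
  by rewrite cvZ pP eq_sym (negbTE ji) mulr0.
case: (ex_maxnP P0 Pn) => m /asboolP[chi chi_inj] mmax.
have [p pP] := lagrange chi_inj; exists m, chi, p; split=> // x.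
have all s : exists i, s = chi i.
  apply: contrapT => ns; have : P m.+1.
    apply/asboolP; exists (fun i => if unlift ord0 i is Some j then chi j else s).
    move=> i j; case: unliftP => [i' ->|->]; case: unliftP => [j' ->|->] //.
    - by move/chi_inj ->.
    - by move=> E; case: ns; exists i'.
    - by move=> E; case: ns; exists j'.
  by move/mmax; rewrite ltnn.
apply: cv_ext => s; have [i ->] := all s; rewrite cv_sum (bigD1 i) //= big1 => [|j ji].
  by rewrite cvZ pP eqxx mulr1 addr0.
by rewrite cvZ pP eq_sym (negbTE ji) mulr0.
Qed.

End FiniteDimensional.

(** * Rigidity and correction of projections *)

Section Projections.
Context {R : realType}.

Definition is_proj (A : cstarAlgType R[i]) (p : A) : Prop := star p = p /\ cmul p p = p.

Lemma star_hom_proj (A B : cstarAlgType R[i]) (f : star_hom A B) p :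
  is_proj p -> is_proj (f p).
Proof. by move=> [sp pp]; split; rewrite -?star_hom_star -?star_homM ?sp ?pp. Qed.

Context {A : cstarAlgType R[i]} (A_com : cstar_commutative A).
Local Notation C := (comring A_com).

(** For commuting projections [h = p - q] satisfies [h^3 = h], so [h^2] is a projection of norm less
    than 1 and vanishes. *)
Lemma proj_close (p q : A) : is_proj p -> is_proj q -> nr (p - q) < 1 -> p = q.
Proof.
move=> [sp pp] [sq qq] pq; apply/eqP; rewrite -subr_eq0; apply/eqP.
have cube (a b : C) : a * a = a -> b * b = b -> (a - b) * (a - b) * (a - b) = a - b.
  move=> aa bb; have -> : (a - b) * (a - b) * (a - b) = a * a * a - b * b * b
      - 3%:R * ((a * a) * b) + 3%:R * (a * (b * b)) by ring.
  by rewrite !aa !bb; ring.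
pose h : C := (p - q : A); have h3 : h * h * h = h := cube p q pp qq.
rewrite -[p - q]/(h : A).
have sh : star (h : A) = h by rewrite starB sp sq.
have k0 : cmul h h = 0 :> A.
  apply: nr_proj_lt1; first by rewrite starM sh.
    have E : (h * h) * (h * h) = h * h by rewrite mulrA h3.
    exact: E.
  by rewrite nr_sa_sq // expr_lt1 // nr_ge0.
by apply: starM_eq0; rewrite sh.
Qed.

(* Newton's iteration for [x^2 = x]; with [d = x^2 - x], the step is [d (1 - 2 x)],
   the next [d] is [d^2 (4 d - 3)] and [(1 - 2 x)^2 = 1 + 4 d]. *)
Lemma almost_proj (z : A) : star z = z -> nr (cmul z z - z) <= 16^-1 ->
  exists2 p : A, is_proj p & nr (p - z) <= 2^-1.
Proof.
move=> sz dz; pose f (x : C) : C := 3%:R * (x * x) - 2%:R * (x * x * x).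
pose u n : A := iter n f (z : C); pose d (x : C) : C := x * x - x.
have natC (k : nat) (x : C) : star (k%:R * x : A) = (k%:R * (star (x : A) : C) : A).
  rewrite !mulr_natl; elim: k => [|k IH]; first by rewrite !mulr0n star0.
  by rewrite !mulrS starD IH.
have sf (x : C) : star (x : A) = x -> star (f x : A) = f x.
  move=> sx; have sx2 := saM sx sx; have sx3 := saM sx2 sx.
  by rewrite /f starB !natC sx2 sx3.
have su n : star (u n) = u n by elim: n => [//|n IH]; exact: sf IH.
have dS (x : C) : d (f x) = d x * d x * (4%:R * d x - 3%:R) by rewrite /d /f; ring.
have stepE (x : C) : f x - x = d x * (1 - 2%:R * x) by rewrite /d /f; ring.
have sqE (x : C) : (1 - 2%:R * x) * (1 - 2%:R * x) = 1 + 4%:R * d x by rewrite /d; ring.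
have n1 : nr ((1 : C) : A) <= 1 by exact: nr1_le.
have nrnat (k : nat) (x : C) : nr (k%:R * x : A) <= k%:R * nr (x : A).
  rewrite !mulr_natl; elim: k => [|k IH]; first by rewrite !mulr0n nr0.
  by rewrite !mulrS (le_trans (nrD _ _)) // lerD.
have nrnat1 (k : nat) : nr ((k%:R : C) : A) <= k%:R.
  by have := nrnat k 1; rewrite mulr1 => /le_trans; apply; rewrite ler_piMr.
have nrM' (x y : C) : nr (x * y : A) <= nr (x : A) * nr (y : A) by exact: nrM.
(* With [|d| <= 1/16] the factor [|d| (4 |d| + 3)] is at most 1/4. *)
have dn n : nr (d (u n) : A) <= 16^-1 * 4^-1 ^+ n.
  elim: n => [|n IH]; first by rewrite expr0 mulr1.
  rewrite /u iterS -/(u n) dS; set e : C := d (u n) in IH *.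
  have h0 : 0 <= 4^-1 ^+ n :> R by rewrite exprn_ge0 // invr_ge0.
  have h1 : 4^-1 ^+ n <= 1 :> R by rewrite exprn_ile1 ?invr_ge0 // invf_le1 // ler1n.
  have e16 : nr (e : A) <= 16^-1 by apply: le_trans IH _; rewrite ler_piMr ?invr_ge0.
  have e0 := nr_ge0 (e : A).
  have b1 : nr ((4%:R * e - 3%:R : C) : A) <= 4 * nr (e : A) + 3.
    by apply: le_trans (nrB _ _) _; rewrite lerD // ?nrnat // nrnat1.
  apply: le_trans (nrM' _ _) _.
  apply: le_trans (ler_pM (nr_ge0 _) (nr_ge0 _) (nrM' _ _) b1) _.
  rewrite exprS; move: (nr (e : A)) (4^-1 ^+ n) IH e16 e0 h0 h1 => a h; nra.
have steps n : nr (u n.+1 - u n) <= 8^-1 * 4^-1 ^+ n.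
  have -> : u n.+1 - u n = d (u n) * (1 - 2%:R * (u n : C)) :> C.
    by rewrite /u iterS; exact: stepE.
  set e : C := d (u n); set w : C := 1 - _.
  have sw : star (w : A) = w by rewrite starB star1 natC su.
  have e16 : nr (e : A) <= 16^-1.
    apply: le_trans (dn n) _; rewrite ler_piMr ?invr_ge0 //.
    by rewrite exprn_ile1 ?invr_ge0 // invf_le1 // ler1n.
  (* Since [w] is self-adjoint, its norm is computed from its square [1 + 4 d], so no bound on [u n]
     enters. *)
  have w2 : nr (w : A) <= 2.
    rewrite -ler_sqr ?nnegrE ?nr_ge0 // -nr_sa_sq //.
    rewrite -[cmul _ _]/(w * w) sqE; apply: le_trans (nrD _ _) _.
    apply: le_trans (lerD n1 (nrnat 4 e)) _; rewrite expr2.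
    by move: e16; move: (nr (e : A)) => r; lra.
  apply: le_trans (nrM' _ _) _; have := dn n; rewrite -/e => en.
  apply: le_trans (ler_pM (nr_ge0 _) (nr_ge0 _) en w2) _.
  by rewrite mulrAC ler_wpM2r ?exprn_ge0 ?invr_ge0 //; lra.
have [||p up pz] := geometric_cvg _ _ steps.
- by rewrite invr_ge0.
- by rewrite invf_lt1 // ltr1n.
exists p; last first.
  apply: le_trans pz _; rewrite (_ : 8^-1 / (1 - 4^-1) = 6^-1 :> R); [lra | by field].
split.
  apply: (seq_cvg_unique _ up); have := seq_cvg_star up.
  by rewrite (_ : (fun n => star (u n)) = u) //; apply/funext.
apply/eqP; rewrite -subr_eq0; apply/eqP.
have lim : seq_cvg (fun n => d (u n) : A) (cmul p p - p).
  apply: seq_cvgD; first exact: seq_cvgM.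
  have := seq_cvgZ (-1) up; rewrite scaleN1r.
  by rewrite (_ : (fun n => -1 *: u n) = (fun n => - u n)) //; apply/funext => n; rewrite scaleN1r.
apply: (seq_cvg_unique lim) => e e0.
have [||N hN] := @expr_small R 4^-1 e _ _ e0.
- by rewrite invr_ge0.
- by rewrite invf_lt1 // ltr1n.
exists N => n Nn; rewrite subr0; apply: le_trans (dn n) _; apply: le_trans (hN n Nn).
rewrite ler_piMl ?exprn_ge0 ?invr_ge0 //; lra.
Qed.

End Projections.

(** * Projections in a directed colimit of commutative algebras *)

Section CommutativeColimit.
Context {R : realType} {d : Order.disp_t} {I : porderType d}.
Context (F : functor (poset_cat I) (com_cstar_cat R[i])) (K : cocone F).
Context (dirI : directed I) (colK : is_colimit K).
Context (Finj : forall (i j : poset_cat I) (ij : hom i j), com_cstar_embedding (fmap F ij)).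

Let Fc (i : I) : cstarAlgType R[i] := sval (F i).
Let Kc : cstarAlgType R[i] := sval (apex K).
Let kap (i : I) : star_hom (Fc i) Kc := leg K i.
Let phi (i j : I) (ij : (i <= j)%O) : star_hom (Fc i) (Fc j) :=
  @fmap _ _ F i j (ij : @hom (poset_cat I) i j).

Lemma Fc_com i : cstar_commutative (Fc i). Proof. exact: svalP (F i). Qed.
Lemma Kc_com : cstar_commutative Kc. Proof. exact: svalP (apex K). Qed.

Lemma kapE (i j : I) (ij : (i <= j)%O) x : kap j (phi ij x) = kap i x.
Proof.
exact: (congr1 (fun g : star_hom (Fc i) Kc => g x) (legP K (ij : @hom (poset_cat I) i j))).
Qed.

Lemma range_subalg (A B : cstarAlgType R[i]) (f : star_hom A B) :
  is_subalg (fun y => exists x, f x = y).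
Proof.
split.
- by exists cone; rewrite star_hom1.
- by move=> _ _ [x <-] [y <-]; exists (x + y); rewrite star_homD.
- by move=> k _ [x <-]; exists (k *: x); rewrite star_homZ.
- by move=> _ _ [x <-] [y <-]; exists (cmul x y); rewrite star_homM.
- by move=> _ [x <-]; exists (star x); rewrite star_hom_star.
Qed.

(** The closure [D] of the union of the ranges of the legs is itself a cocone. The mediating map [v]
    followed by the inclusion is the identity of the colimit, by uniqueness, so the inclusion is
    onto. *)
Lemma colimit_dense (q : Kc) (e : R) : 0 < e -> exists i x, nr (q - kap i x) <= e.
Proof.
pose P (i : I) (y : Kc) := exists x, kap i x = y.
have mono (i j : I) y : (i <= j)%O -> P i y -> P j y.
  by move=> ij [x <-]; exists (phi ij x); exact: kapE.
have US := closure_subalg (directed_union_subalg dirI (fun i => range_subalg (kap i)) mono).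
have UC : seq_closed (seq_closure (fun y => exists i, P i y)) := @seq_closed_closure R Kc _.
pose D := csub US UC; pose val : star_hom D Kc := csub_val US UC.
have val_inj : injective val by exact: csub_val_inj.
have gP i : exists g : star_hom (Fc i) D, forall x, val (g x) = kap i x.
  apply: star_hom_lift val_inj _ => x; apply: csub_val_surj.
  by apply: seq_closure_sub; exists i, x.
pose g i := sval (cid (gP i)).
have gE i x : val (g i x) = kap i x by exact: (svalP (cid (gP i))).
have gL (i j : poset_cat I) (ij : hom i j) : star_hom_comp (g j) (fmap F ij) = g i.
  apply: star_hom_ext => x; apply: val_inj.
  exact: (etrans (gE j _) (etrans (kapE ij x) (esym (gE i x)))).
pose DD : cocone F := @Cocone _ _ F
  (exist _ D (csub_com Kc_com) : com_cstar_cat R[i]) g gL.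
have [v [vE _]] := colK DD; have [w [_ wU]] := colK K.
have vid : star_hom_comp val v = star_hom_id Kc.
  have e1 : w = star_hom_comp val v.
    apply: wU => i; apply: star_hom_ext => x.
    exact: (etrans (congr1 (fun h : star_hom (Fc i) D => val (h x)) (vE i)) (gE i x)).
  have e2 : w = star_hom_id Kc by apply: wU => i; exact: star_hom_ext.
  exact: (etrans (esym e1) e2).
have : seq_closure (fun y => exists i, P i y) q.
  have -> : q = val ((v : star_hom Kc D) q).
    exact: (esym (congr1 (fun h : star_hom Kc Kc => h q) vid)).
  exact: csub_valP.
by move=> H e0; have [b [[i [x <-]] qb]] := H e e0; exists i, x.
Qed.

(** The mediating map to the cocone of bounded families is contractive, so [nr (lam i x)] is below
    [c] as well, and there smallness is visible at a stage. *)
Lemma colimit_norm (i : I) (x : Fc i) (c : R) : nr (kap i x) < c ->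
  exists (j : I) (ij : (i <= j)%O), nr (phi ij x) <= c.
Proof.
have [L [lam [lamE lamP lamC]]] := directed_system_cocone (forget F) dirI.
have lamL (k l : poset_cat I) (kl : hom k l) :
  star_hom_comp (lam l) (fmap F kl) = lam k by apply: star_hom_ext; exact: lamE.
pose LL : cocone F := @Cocone _ _ F
  (exist _ L (lamC Fc_com) : com_cstar_cat R[i]) lam lamL.
have [u [uE _]] := colK LL; pose u' : star_hom Kc L := u.
have uk : u' (kap i x) = lam i x.
  exact: (congr1 (fun g : star_hom (Fc i) L => g x) (uE i)).
by move=> xc; apply: lamP; rewrite -uk (le_lt_trans (star_hom_contract _ _)).
Qed.

Lemma proj_survives (i : I) (p : Fc i) : is_proj p -> kap i p = 0 -> p = 0.
Proof.
move=> [sp pp] p0.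
exact: (@projection_survives R d I (forget F) Finj Kc kap i p colimit_norm sp pp p0).
Qed.

Lemma nr_proj_le1 (A : cstarAlgType R[i]) (p : A) : is_proj p -> nr p <= 1.
Proof.
move=> [sp pp]; rewrite leNgt; apply/negP => p1.
have : nr p = nr p ^+ 2 by rewrite -nr_sa_sq // pp.
by move: p1; move: (nr p) => r r1; nra.
Qed.

Lemma proj_lift (q : Kc) : is_proj q -> exists i (p : Fc i), is_proj p /\ kap i p = q.
Proof.
move=> qP; have [sq qq] := qP; have q1 := nr_proj_le1 qP.
(* With [y] within 1/80 of [q], the defect [y^2 - y] is at most 1/20, strictly below the 1/16 that
   [almost_proj] requires. The corrected projection is then within [1/2 + 1/80 < 1] of [q]. *)
have [|i [x0 qx0]] := @colimit_dense q 80^-1; first by rewrite invr_gt0.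
pose x : Fc i := (2^-1)%:C *: (x0 + star x0).
have sx : star x = x by rewrite /x starZr starD starK addrC.
pose y : Kc := kap i x; pose dd : Kc := y - q.
have h2 : (2^-1)%:C + (2^-1)%:C = 1 :> R[i].
  by rewrite -rmorphD /= (_ : 2^-1 + 2^-1 = 1) //; lra.
have ddE : dd = - ((2^-1)%:C *: ((q - kap i x0) + star (q - kap i x0))).
  rewrite starB sq -star_hom_star addrACA -opprD -star_homD scalerBr opprB.
  by rewrite /dd /y star_homZ scalerDr -scalerDl h2 scale1r.
have nd : nr dd <= 80^-1.
  rewrite ddE nrN nrZr ?invr_ge0 //; have := nrD (q - kap i x0) (star (q - kap i x0)).
  rewrite nr_star; move: qx0; lra.
have yy : nr (cmul y y - y) <= 20^-1.
  have E (a b : comring Kc_com) : a * a = a ->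
      (a + b) * (a + b) - (a + b) = a * b + (b * a + (b * b - b)).
    by move=> aa; have -> : (a + b) * (a + b) = a * a + a * b + b * a + b * b;
      [ring | rewrite aa; ring].
  have -> : cmul y y - y = cmul q dd + (cmul dd q + (cmul dd dd - dd)).
    have qd : q + dd = y by rewrite /dd addrC subrK.
    exact: (eq_ind (q + dd) (fun w : Kc => cmul w w - w = _) (E q dd qq) y qd).
  have := nr_ge0 dd; have := nrM q dd; have := nrM dd q; have := nrM dd dd.
  have := nrB (cmul dd dd) dd; have := nrD (cmul dd q) (cmul dd dd - dd).
  have := nrD (cmul q dd) (cmul dd q + (cmul dd dd - dd)); have := nr_ge0 q.
  move: nd q1; nra.
have yx : kap i (cmul x x - x) = cmul y y - y by rewrite star_homB star_homM.
have [|j [ij xj]] := @colimit_norm i (cmul x x - x) 16^-1.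
  by rewrite yx (le_lt_trans yy) // ltf_pV2 ?posrE ?ltr0n // ltr_nat.
have [||p pP pz] := @almost_proj R (Fc j) (@Fc_com j) (phi ij x).
- by rewrite -star_hom_star sx.
- by rewrite -star_homM -star_homB.
exists j, p; split=> //; apply: (proj_close Kc_com) => //; first exact: star_hom_proj.
apply: le_lt_trans (nr_tri (kap i x) _ _) _.
rewrite -{1}(kapE ij) -star_homB; have := star_hom_contract (kap j) (p - phi ij x).
move: nd; rewrite -/y -/dd; lra.
Qed.

Lemma finite_upper_bound m (j : 'I_m -> I) : exists k, forall i, (j i <= k)%O.
Proof.
case: dirI => -[i0] dI; elim: m j => [|m IH] j; first by exists i0 => -[].
have [k hk] := IH (fun i => j (lift ord0 i)); have [l [kl jl]] := dI k (j ord0).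
by exists l => i; case: (unliftP ord0 i) => [i' ->|->] //; exact: le_trans (hk i') kl.
Qed.

Lemma proj_lift_all m (q : 'I_m -> Kc) : (forall i, is_proj (q i)) ->
  exists k (p : 'I_m -> Fc k), forall i, is_proj (p i) /\ kap k (p i) = q i.
Proof.
move=> qP; have H i := cid (proj_lift (qP i)).
have [k hk] := finite_upper_bound (fun i => sval (H i)).
have G i : exists p : Fc k, is_proj p /\ kap k p = q i.
  have [p [pP pq]] := svalP (H i); exists (phi (hk i) p).
  by split; [exact: star_hom_proj | rewrite kapE].
by exists k, (fun i => sval (cid (G i))) => i; exact: (svalP (cid (G i))).
Qed.

Lemma projM (A : cstarAlgType R[i]) (A_com : cstar_commutative A) (p q : A) :
  is_proj p -> is_proj q -> is_proj (cmul p q).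
Proof.
move=> [sp pp] [sq qq]; split; first by rewrite starM sp sq; exact: A_com.
have E (a b : comring A_com) : (a * b) * (a * b) = (a * a) * (b * b) by ring.
by apply: etrans (E p q) _; apply: congr2.
Qed.

Lemma proj1B (A : cstarAlgType R[i]) (p : A) : is_proj p -> is_proj (cone - p).
Proof.
move=> [sp pp]; split; first by rewrite starB star1 sp.
by rewrite cmulBr cmulx1 cmulBl cmul1x pp subrr subr0.
Qed.

(** The projection [p (1 - q)] dies in the colimit, hence is zero and [p = p q]; by symmetry
    [q = q p]. *)
Lemma proj_inj (i : I) (p q : Fc i) : is_proj p -> is_proj q -> kap i p = kap i q -> p = q.
Proof.
have le p' q' : is_proj p' -> is_proj q' -> kap i p' = kap i q' -> p' = cmul p' q'.
  move=> pP qP pq; apply/eqP; rewrite -subr_eq0 -{1}(cmulx1 p') -cmulBr; apply/eqP.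
  apply: proj_survives; first by apply: (projM (@Fc_com i)) => //; exact: proj1B.
  by rewrite star_homM star_homB star_hom1 pq cmulBr cmulx1 -star_homM (proj2 qP) subrr.
by move=> pP qP pq; rewrite (le p q) // (@Fc_com i) -(le q p).
Qed.

Lemma star_hom_sum (A B : cstarAlgType R[i]) (f : star_hom A B) m (c : 'I_m -> R[i])
  (x : 'I_m -> A) : f (\sum_i c i *: x i) = \sum_i c i *: f (x i).
Proof.
elim/big_rec2: _ => [|i y z _ <-]; first exact: star_hom0.
by rewrite star_homD star_homZ.
Qed.

Lemma finite_dim_factor (A : cstarAlgType R[i]) (A_com : cstar_commutative A) :
  finite_dimensional A ->
  (forall f : star_hom A Kc, exists i (g : star_hom A (Fc i)), f = star_hom_comp (kap i) g) /\
  (forall i (g g' : star_hom A (Fc i)),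
     star_hom_comp (kap i) g = star_hom_comp (kap i) g' -> g = g').
Proof.
move=> /(finite_dim_projections A_com)[m [chi [p [pP xE]]]].
have ext (x y : A) : (forall i, cv (A_com := A_com) (chi i) x = cv (A_com := A_com) (chi i) y) -> x = y.
  by move=> xy; rewrite (xE x) (xE y); apply: eq_bigr => i _; rewrite xy.
have p_proj i : is_proj (p i).
  split; apply: ext => j; first by rewrite cvS pP conjC_nat.
  by apply: etrans (cvM _ _ _) _; rewrite pP -natrM mulnb andbb.
have p_orth i j : i != j -> cmul (p i) (p j) = 0.
  move=> ij; apply: ext => k; apply: etrans (cvM _ _ _) _; rewrite !pP cv0.
  by have [->|] := eqVneq k i; rewrite ?mul0r // (negbTE ij) mulr0.
have p_sum : \sum_i p i = cone.
  by rewrite (xE cone); apply: eq_bigr => i _; rewrite cv1 scale1r.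
split=> [f|i g g' gg']; last first.
  apply: star_hom_ext => x; rewrite (xE x) !star_hom_sum; apply: eq_bigr => j _.
  congr (_ *: _); apply: proj_inj; try exact: star_hom_proj.
  exact: (congr1 (fun h : star_hom A Kc => h (p j)) gg').
have [k [r rP]] := proj_lift_all (fun i => star_hom_proj f (p_proj i)).
have r_proj i := (rP i).1; have kr i := (rP i).2.
(* Orthogonality holds already at stage [k]: the product of the two lifts is a projection that dies
   in the colimit. *)
have r_orth i j : i != j -> cmul (r i) (r j) = 0.
  move=> ij; apply: proj_survives; first exact: (projM (@Fc_com k)).
  by rewrite star_homM !kr -star_homM p_orth // star_hom0.
have mul_sum (c e : 'I_m -> R[i]) :
    cmul (\sum_i c i *: r i) (\sum_i e i *: r i) = \sum_i (c i * e i) *: r i.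
  rewrite [LHS](@mulr_suml (cring (Fc k))); apply: eq_bigr => i _.
  rewrite [LHS](@mulr_sumr (cring (Fc k))) (bigD1 i) //= big1 => [|j ji].
    rewrite addr0 -[LHS]/(cmul (c i *: r i) (e i *: r i)).
    by rewrite -cscalerAl -cscalerAr scalerA (r_proj i).2.
  rewrite -[LHS]/(cmul (c i *: r i) (e j *: r j)) -cscalerAl -cscalerAr r_orth ?scaler0 //.
  by rewrite eq_sym.
have star_sum (c : 'I_m -> R[i]) : star (\sum_i c i *: r i) = \sum_i (c i)^*%R *: r i.
  elim/big_rec2: _ => [|i y z _ <-]; first exact: star0.
  by rewrite starD starZ (r_proj i).1.
(* The same argument for the projection [1 - \sum_i r i]. *)
have sum1 : \sum_i (1 : R[i]) *: r i = cone.
  apply/eqP; rewrite eq_sym -subr_eq0; apply/eqP/proj_survives.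
    apply: proj1B; split.
      by rewrite star_sum; apply: eq_bigr => i _; rewrite rmorph1.
    by rewrite mul_sum; apply: eq_bigr => i _; rewrite mulr1.
  rewrite star_homB star_hom1 star_hom_sum -(star_hom1 f) -p_sum.
  have -> : \sum_i p i = \sum_i (1 : R[i]) *: p i by apply: eq_bigr => i _; rewrite scale1r.
  by rewrite star_hom_sum -sumrB big1 // => i _; rewrite kr subrr.
exists k; unshelve eexists.
  exists (fun x => \sum_i cv (A_com := A_com) (chi i) x *: r i).
  - move=> x y; rewrite -big_split; apply: eq_bigr => i _ /=.
    by rewrite -scalerDl; congr (_ *: _); exact: cvD.
  - move=> c x; rewrite scaler_sumr; apply: eq_bigr => i _.
    by rewrite scalerA; congr (_ *: _); exact: cvZ.
  - by rewrite -sum1; apply: eq_bigr => i _; congr (_ *: _); exact: cv1.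
  - by move=> x y; rewrite mul_sum; apply: eq_bigr => i _; congr (_ *: _); exact: cvM.
  - by move=> x; rewrite star_sum; apply: eq_bigr => i _; congr (_ *: _); exact: cvS.
apply: star_hom_ext => x; rewrite {1}(xE x) star_hom_sum [RHS]star_hom_sum.
by apply: eq_bigr => i _; rewrite kr.
Qed.

End CommutativeColimit.

Lemma finite_dim_com_aleph0 (R : realType) (A : cstarAlgType R[i])
    (A_com : cstar_commutative A) : finite_dimensional A ->
  aleph0_generated (@com_cstar_embedding R[i]) (exist _ A A_com : com_cstar_cat R[i]).
Proof.
move=> Afin; apply: aleph0_intro => d I F K dirI Finj colK.
exact: (finite_dim_factor dirI colK Finj A_com Afin).
Qed.

Theorem proposition3p1 (R : realType) (A : cstarAlgType R[i])
    (A_com : cstar_commutative A) :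
  (aleph0_generated (@com_cstar_embedding R[i])
     (exist _ A A_com : com_cstar_cat R[i])
   <-> finite_dimensional A)
  /\
  (aleph0_generated (@cstar_embedding R[i]) (A : cstar_cat R[i])
   <-> dim_le A 1).
Proof.
split; split; [exact: com_aleph0_finite_dim | exact: finite_dim_com_aleph0
  | exact: aleph0_dim_le1 | exact: dim_le1_aleph0].
Qed.
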